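(* Let $\mathbf W$ be the universal model associated with the abstract regular polydomain $\mathbf D_{\mathbf q}$. A formal power series $\varphi:=\sum_{\boldsymbol\alpha\in\mathbb F_{n_1}^+\times\cdots\times\mathbb F_{n_k}^+}A_{(\boldsymbol\alpha)}\otimes\mathbf Z_{\boldsymbol\alpha}$, with $A_{(\boldsymbol\alpha)}\in B(\mathcal K)$, is a free holomorphic function (with coefficients in $B(\mathcal K)$) on the abstract polydomain $\boldsymbol\rho\mathbf D_{\mathbf q}$, where $\boldsymbol\rho=(\rho_1,\dots,\rho_k)$, $\rho_i>0$, if and only if the series $$\sum_{m=0}^\infty\ \sum_{\substack{\boldsymbol\alpha\in\mathbb F_{n_1}^+\times\cdots\times\mathbb F_{n_k}^+\\|\alpha_1|+\cdots+|\alpha_k|=m}}A_{(\boldsymbol\alpha)}\otimes s_1^{|\alpha_1|}\cdots s_k^{|\alpha_k|}\mathbf W_{\boldsymbol\alpha}$$ is convergent in the operator norm topology for any $s_i\in[0,\rho_i)$. Moreover, the set $Hol(\boldsymbol\rho\mathbf D_{\mathbf q})$ of all free holomorphic functions with scalar coefficients on $\boldsymbol\rho\mathbf D_{\mathbf q}$ is an algebra.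
   Context: Polydomains. Fix $k\in\mathbb N=\{1,2,\dots\}$ and $n_1,\dots,n_k\in\mathbb N$. Hilbert spaces are complex; $A>0$ means that the operator $A$ is positive and invertible. $\mathbb F_{n_i}^+$ is the unital free semigroup on generators $g^i_1,\dots,g^i_{n_i}$ with identity $g^i_0$, and $|\alpha|$ is the length of $\alpha$. For $X_i=(X_{i,1},\dots,X_{i,n_i})\in B(\mathcal H)^{n_i}$ put $X_{i,\alpha}:=X_{i,j_1}\cdots X_{i,j_p}$ if $\alpha=g^i_{j_1}\cdots g^i_{j_p}$, and $X_{i,g_0^i}:=I$. Fix $\mathbf q=(q_1,\dots,q_k)$, where each $q_i=\sum_{\alpha\in\mathbb F_{n_i}^+}a_{i,\alpha}Z_\alpha$ is a positive regular polynomial in $n_i$ noncommuting indeterminates: a finite sum with $a_{i,\alpha}\ge0$, $a_{i,g_0^i}=0$ and $a_{i,g_j^i}>0$ for $j=1,\dots,n_i$. Define $\Phi_{q_i,X_i}(Y):=\sum_\alpha a_{i,\alpha}X_{i,\alpha}YX_{i,\alpha}^*$ for $Y\in B(\mathcal H)$. $B(\mathcal H)^{n_1}\times_c\cdots\times_cB(\mathcal H)^{n_k}$ is the set of $\mathbf X=(X_1,\dots,X_k)\in B(\mathcal H)^{n_1}\times\cdots\times B(\mathcal H)^{n_k}$ such that, for $s\ne t$, every entry of $X_s$ commutes with every entry of $X_t$. For $\mathbf p\in\{0,1\}^k$ let $\mathbf\Delta^{\mathbf p}_{\mathbf q,\mathbf X}:=(\mathrm{id}-\Phi_{q_1,X_1})^{p_1}\circ\cdots\circ(\mathrm{id}-\Phi_{q_k,X_k})^{p_k}$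 and $\mathbf\Delta_{\mathbf q,\mathbf X}:=\mathbf\Delta^{(1,\dots,1)}_{\mathbf q,\mathbf X}$. Set $\mathbf D^-_{\mathbf q}(\mathcal H):=\{\mathbf X\in B(\mathcal H)^{n_1}\times_c\cdots\times_cB(\mathcal H)^{n_k}:\mathbf\Delta^{\mathbf p}_{\mathbf q,\mathbf X}(I)\ge0\text{ for all }\mathbf p\in\{0,1\}^k\}$ and $\mathbf D_{\mathbf q}(\mathcal H):=\{\mathbf X\in\mathbf D^-_{\mathbf q}(\mathcal H):\mathbf\Delta_{\mathbf q,\mathbf X}(I)>0\}$. For $\boldsymbol\rho=(\rho_1,\dots,\rho_k)$, $\boldsymbol\rho\mathbf X:=(\rho_1X_1,\dots,\rho_kX_k)$, $\boldsymbol\rho\mathbf D_{\mathbf q}(\mathcal H):=\{\boldsymbol\rho\mathbf X:\mathbf X\in\mathbf D_{\mathbf q}(\mathcal H)\}$, and the abstract polydomain $\boldsymbol\rho\mathbf D_{\mathbf q}$ is the disjoint union of these over all Hilbert spaces $\mathcal H$. Universal model. $b_{i,g_0^i}:=1$ and, for $|\alpha|\ge1$, $b_{i,\alpha}:=\sum_{p=1}^{|\alpha|}\sum a_{i,\gamma_1}\cdots a_{i,\gamma_p}$, the inner sum over $\gamma_1,\dots,\gamma_p\in\mathbb F_{n_i}^+$ with $\gamma_1\cdots\gamma_p=\alpha$ and all $|\gamma_l|\ge1$. $F^2(H_{n_i})$ is the full Fock space of $\mathbb C^{n_i}$, with orthonormal basis $\{e^i_\alpha\}_{\alpha\in\mathbb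 F_{n_i}^+}$, and $W_{i,j}e^i_\alpha:=\sqrt{b_{i,\alpha}/b_{i,g^i_j\alpha}}\,e^i_{g^i_j\alpha}$. On $F^2(H_{n_1})\otimes\cdots\otimes F^2(H_{n_k})$ let $\mathbf W_{i,j}:=I\otimes\cdots\otimes W_{i,j}\otimes\cdots\otimes I$ ($W_{i,j}$ in position $i$); $\mathbf W=(\mathbf W_1,\dots,\mathbf W_k)$, $\mathbf W_i=(\mathbf W_{i,1},\dots,\mathbf W_{i,n_i})$, is the universal model. Free holomorphic functions. For $\boldsymbol\alpha=(\alpha_1,\dots,\alpha_k)$, $\mathbf X_{\boldsymbol\alpha}:=X_{1,\alpha_1}\cdots X_{k,\alpha_k}$; $\mathbf W_{\boldsymbol\alpha}$ and $\mathbf Z_{\boldsymbol\alpha}$ are defined likewise ($\mathbf Z_{\boldsymbol\alpha}$ from indeterminates $Z_{i,j}$, with $Z_{s,j},Z_{t,l}$ commuting when $s\ne t$). $\Lambda_{\mathbf p}:=\{\boldsymbol\alpha:|\alpha_i|=p_i,\ i=1,\dots,k\}$ for $\mathbf p\in\mathbb Z_+^k$ ($\mathbb Z_+$ the nonnegative integers). $\varphi=\sum A_{(\boldsymbol\alpha)}\otimes\mathbf Z_{\boldsymbol\alpha}$ is a free holomorphic function on $\boldsymbol\rho\mathbf D_{\mathbf q}$ if $\sum_{\mathbf p\in\mathbb Z_+^k}\sum_{\boldsymbol\alpha\in\Lambda_{\mathbf p}}A_{(\boldsymbol\alpha)}\otimes\mathbf X_{\boldsymbol\alpha}$ converges in the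 operator norm (unordered sum over $\mathbf p$) for every $\mathbf X\in\boldsymbol\rho\mathbf D_{\mathbf q}(\mathcal H)$ and every Hilbert space $\mathcal H$. Scalar coefficients means $\mathcal K=\mathbb C$; the product in $Hol(\boldsymbol\rho\mathbf D_{\mathbf q})$ is multiplication of formal power series (equivalently, pointwise multiplication). *)

(* Defs.v *)
From HB Require Import structures.
From mathcomp Require Import all_boot all_order all_algebra finmap complex sesquilinear.
From mathcomp Require Import all_classical all_reals all_analysis summability.
Set Implicit Arguments.
Unset Strict Implicit.
Unset Printing Implicit Defensive.
Import Order.TTheory GRing.Theory Num.Theory.
Import numFieldNormedType.Exports.
Local Open Scope classical_set_scope.
Local Open Scope complex_scope.
Local Open Scope ring_scope.
(* The inner product is linear in its first argument and conjugate-linear in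
   the second. The zero space is a Hilbert space. *)
HB.mixin Record isHilbert (R : realType) (H : Type)
    & CompleteNormedModule R[i] H := {
  hdot : {dot H for Num.conj};
  hdot_norm : forall x : H, hdot x x = `|x| ^+ 2 }.

#[short(type="hilbertType")]
HB.structure Definition Hilbert (R : realType) :=
  {H of isHilbert R H & CompleteNormedModule R[i] H}.
Section BoundedOperators.
Variables (R : realType) (H : hilbertType R).
Implicit Types (f g : H -> H) (x y : H) (a : R[i]).

(* In a normed module over R[i] the norm is a nonnegative element of R[i];
   rnorm is the same number seen in R. *)
Definition rnorm (V : normedModType R[i]) (v : V) : R := complex.Re `|v|.

Lemma rnormE (V : normedModType R[i]) (v : V) : `|v| = (rnorm v)%:C.
Proof. by rewrite RRe_real ?normr_real. Qed.

Lemma rnorm_ge0 (V : normedModType R[i]) (v : V) : 0 <= rnorm v.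
Proof. by rewrite -lecR -[leRHS]rnormE normr_ge0. Qed.

Lemma rnorm_def (V : normedModType R[i]) (v : V) (r : R) :
  `|v| = r%:C -> rnorm v = r.
Proof. by rewrite /rnorm => ->. Qed.

Lemma rnormC a : `|a| = (rnorm (a : R[i]^o))%:C.
Proof. exact: (@rnormE R[i]^o). Qed.

Definition bounded_op : {pred H -> H} := [pred f : H -> H |
  `[< linear f /\ exists M : R, forall x, `|f x| <= M%:C * `|x| >]].

(* B(H): the normed algebra of bounded linear operators on H, whose product is
   composition. It is only a pzRingType because H may be zero. *)
Record bop := Bop { bop_fun :> H -> H; _ : bop_fun \in bounded_op }.

HB.instance Definition _ := [isSub for bop_fun].
HB.instance Definition _ := gen_eqMixin bop.
HB.instance Definition _ := gen_choiceMixin bop.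

Lemma bounded_opP f : reflect
  (linear f /\ exists2 M : R, 0 <= M & forall x, rnorm (f x) <= M * rnorm x)
  (f \in bounded_op).
Proof.
apply: (iffP (asboolP _)) => -[lf [M]]; last first.
  by move=> _ Mf; split=> //; exists M => x; rewrite !rnormE -rmorphM lecR.
move=> Mf; split=> //; exists `|M| => // x; have := Mf x.
rewrite !rnormE -rmorphM lecR => /le_trans; apply.
by rewrite ler_wpM2r ?rnorm_ge0// ler_norm.
Qed.

Lemma rnormD (V : normedModType R[i]) (u v : V) :
  rnorm (u + v) <= rnorm u + rnorm v.
Proof. rewrite -lecR rmorphD/= -!rnormE; exact: ler_normD. Qed.

Lemma rnormZ (V : normedModType R[i]) a (v : V) :
  rnorm (a *: v) = rnorm (a : R[i]^o) * rnorm v.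
Proof. by apply: rnorm_def; rewrite normrZ rnormC rnormE -rmorphM. Qed.

Lemma bounded_op_submod : submod_closed bounded_op.
Proof.
split.
  apply/bounded_opP; split; first by move=> a u v; rewrite /= scaler0 addr0.
  exists 0 => // x; rewrite mul0r (@rnorm_def _ _ 0) //.
  exact: normr0.
move=> a f g /bounded_opP[lf [M M0 fM]] /bounded_opP[lg [N N0 gN]].
apply/bounded_opP; split.
  move=> b u v; rewrite !fctE lf lg !scalerDr !scalerA [b * a]mulrC.
  by rewrite -!addrA; congr +%R; rewrite addrCA.
exists (rnorm (a : R[i]^o) * M + N).
  by apply: addr_ge0 => //; apply: mulr_ge0 => //; exact: rnorm_ge0.
move=> x; rewrite !fctE (le_trans (rnormD _ _))// rnormZ mulrDl lerD//.
by rewrite -mulrA ler_wpM2l// rnorm_ge0.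
Qed.

HB.instance Definition _ :=
  GRing.isSubmodClosed.Build _ _ bounded_op bounded_op_submod.

HB.instance Definition _ := [SubChoice_isSubLmodule of bop by <:].

Lemma bop_linear (T : bop) : linear T.
Proof. by have /bounded_opP[] := valP T. Qed.

HB.instance Definition _ (T : bop) := GRing.isLinear.Build _ _ _ _ T (bop_linear T).

Lemma bop_ext (S T : bop) : S =1 T -> S = T.
Proof. by move=> ST; apply/val_inj/funext. Qed.

Lemma bopDE (S T : bop) x : (S + T) x = S x + T x. Proof. by []. Qed.
Lemma bopZE a (T : bop) x : (a *: T) x = a *: T x. Proof. by []. Qed.

Definition opnorm (T : bop) : R :=
  sup [set rnorm (T x) | x in [set x | rnorm x <= 1]].

Lemma rnorm0 (V : normedModType R[i]) : rnorm (0 : V) = 0.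
Proof. by apply: rnorm_def; rewrite normr0. Qed.

Lemma rnorm_eq0 (V : normedModType R[i]) (v : V) : rnorm v = 0 -> v = 0.
Proof. by move=> v0; apply: normr0_eq0; rewrite rnormE v0. Qed.

Lemma has_sup_opnorm (T : bop) :
  has_sup [set rnorm (T x) | x in [set x | rnorm x <= 1]].
Proof.
split; first by exists (rnorm (T 0)), 0 => //=; rewrite rnorm0.
have /bounded_opP[_ [M M0 TM]] := valP T.
by exists M => _ [x /= x1 <-]; rewrite (le_trans (TM x))// ler_piMr.
Qed.

Lemma opnorm_ge0 (T : bop) : 0 <= opnorm T.
Proof.
have [_ ub] := has_sup_opnorm T.
apply: (le_trans (rnorm_ge0 (T 0))); apply: ub_le_sup => //.
by exists 0 => //=; rewrite rnorm0.
Qed.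

Lemma opnorm_ler (T : bop) x : rnorm (T x) <= opnorm T * rnorm x.
Proof.
have [x0|x0] := eqVneq (rnorm x) 0.
  by rewrite (rnorm_eq0 x0) linear0 !rnorm0 mulr0.
have xp : 0 < rnorm x by rewrite lt_def x0 rnorm_ge0.
rewrite -ler_pdivrMr// mulrC.
have ->: (rnorm x)^-1 * rnorm (T x) = rnorm (T ((rnorm x)^-1%:C *: x)).
  rewrite linearZ rnormZ; congr (_ * _); apply/esym/rnorm_def.
  by rewrite /= ger0_norm// lecR invr_ge0 ltW.
have [_ ub] := has_sup_opnorm T.
apply: ub_le_sup => //; exists ((rnorm x)^-1%:C *: x) => //=.
rewrite rnormZ (_ : rnorm _ = (rnorm x)^-1) ?mulVf//; apply: rnorm_def.
by rewrite /= ger0_norm// lecR invr_ge0 ltW.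
Qed.

Lemma opnorm_le (T : bop) (M : R) : 0 <= M ->
  (forall x, rnorm (T x) <= M * rnorm x) -> opnorm T <= M.
Proof.
move=> M0 TM; apply: ge_sup; first by have [] := has_sup_opnorm T.
by move=> _ [x /= x1 <-]; rewrite (le_trans (TM x))// ler_piMr.
Qed.

Definition copnorm (T : bop) : R[i] := (opnorm T)%:C.

Lemma copnormD (S T : bop) : copnorm (S + T) <= copnorm S + copnorm T.
Proof.
rewrite /copnorm -rmorphD lecR; apply: opnorm_le.
  by rewrite addr_ge0 ?opnorm_ge0.
by move=> x; rewrite bopDE mulrDl (le_trans (rnormD _ _))// lerD// opnorm_ler.
Qed.

Lemma copnormZ a (T : bop) : copnorm (a *: T) = `|a| * copnorm T.
Proof.
rewrite /copnorm rnormC -rmorphM; congr (_%:C).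
have Zle b (S : bop) : opnorm (b *: S) <= rnorm (b : R[i]^o) * opnorm S.
  apply: opnorm_le; first by rewrite mulr_ge0 ?rnorm_ge0 ?opnorm_ge0.
  by move=> x; rewrite bopZE rnormZ -mulrA ler_wpM2l ?rnorm_ge0 ?opnorm_ler.
apply/eqP; rewrite eq_le Zle/=.
have [->|a0] := eqVneq a 0.
  by rewrite (_ : rnorm _ = 0) ?mul0r ?opnorm_ge0//; exact: (@rnorm0 R[i]^o).
have ap : 0 < rnorm (a : R[i]^o) by rewrite -ltcR -rnormC normr_gt0.
rewrite -ler_pdivlMl//; have := Zle a^-1 (a *: T).
rewrite scalerA mulVf// scale1r; congr (_ <= _ * _).
by apply: rnorm_def; rewrite /= normfV rnormC -rmorphV ?unitfE ?gt_eqF.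
Qed.

Lemma copnorm_eq0 (T : bop) : copnorm T = 0 -> T = 0.
Proof.
move=> [T0]; apply: bop_ext => x; apply: rnorm_eq0; apply/eqP.
by rewrite eq_le rnorm_ge0 andbT; have := opnorm_ler T x; rewrite T0 mul0r.
Qed.

(* From here on, limits in bop are limits for the operator norm. *)
HB.instance Definition _ :=
  Lmodule_isNormed.Build R[i] bop copnormD copnormZ copnorm_eq0.

Lemma bounded_op1 : (idfun : H -> H) \in bounded_op.
Proof. by apply/bounded_opP; split=> //; exists 1 => // x; rewrite mul1r. Qed.

Lemma bounded_opM (S T : bop) : (S \o T : H -> H) \in bounded_op.
Proof.
apply/bounded_opP; split; first by move=> a u v; rewrite /= !linearP.
exists (opnorm S * opnorm T); first by rewrite mulr_ge0 ?opnorm_ge0.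
move=> x; rewrite (le_trans (opnorm_ler _ _))// -mulrA.
by rewrite ler_wpM2l ?opnorm_ge0 ?opnorm_ler.
Qed.

Definition bop1 : bop := Bop bounded_op1.
Definition bopM (S T : bop) : bop := Bop (bounded_opM S T).

Lemma bopMA : associative bopM. Proof. by move=> *; exact: bop_ext. Qed.
Lemma bop1M : left_id bop1 bopM. Proof. by move=> *; exact: bop_ext. Qed.
Lemma bopM1 : right_id bop1 bopM. Proof. by move=> *; exact: bop_ext. Qed.
Lemma bopMDl : left_distributive bopM +%R.
Proof. by move=> S T U; exact: bop_ext. Qed.
Lemma bopMDr : right_distributive bopM +%R.
Proof. by move=> S T U; apply: bop_ext => x; exact: linearD. Qed.

HB.instance Definition _ :=
  GRing.Zmodule_isPzRing.Build bop bopMA bop1M bopM1 bopMDl bopMDr.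

(* "The" bounded operator with property P. In every use below P is satisfied by
   exactly one bounded operator (Riesz representation for adjoint; density of
   the span of the vectors on which P prescribes the operator otherwise), so
   the default value 0 is never taken. *)
Definition the_op (P : set bop) : bop := xget 0 P.
Definition adjoint (T : bop) : bop :=
  the_op [set S | forall x y, hdot (T x) y = hdot x (S y)].

Definition op_ge0 (T : bop) := forall x, 0 <= hdot (T x) x.
Definition op_gt0 (T : bop) := op_ge0 T /\ exists S : bop, S * T = 1 /\ T * S = 1.

Lemma bopE (S T : bop) x : (S * T) x = S (T x). Proof. by []. Qed.
End BoundedOperators.
Section ScalarHilbert.
Variable R : realType.

(* The Hilbert space of complex numbers, as a separate alias because the
   library already attaches a completeness instance to (_)^o. *)
Definition scalarH : Type := R[i]^o.
HB.instance Definition _ := NormedModule.copy scalarH R[i]^o.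

Lemma scalarH_complete (F : set_system scalarH) :
  ProperFilter F -> cauchy F -> cvg F.
Proof.
move=> FF /cauchy_ballP Fc.
have [Re_le Im_le] : (forall z : R[i], `|complex.Re z|%:C <= `|z|) /\
                     (forall z : R[i], `|complex.Im z|%:C <= `|z|).
  split=> -[a b]; rewrite normc_def lecR -sqrtr_sqr ler_sqrt ?addr_ge0 ?sqr_ge0//.
    by rewrite lerDl sqr_ge0.
  by rewrite lerDr sqr_ge0.
have part (p : R[i] -> R) : (forall z w, p (z - w) = p z - p w) ->
    (forall z, `|p z|%:C <= `|z|) -> cvg (p @ (F : set_system R[i])).
  move=> pB ple; apply: cauchy_cvg; apply/cauchy_ballP => e e0.
  have := Fc e%:C; rewrite ltcR => /(_ e0) [[A B] [FA FB] AB].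
  exists (p @` A, p @` B) => /=.
    by split; [apply: filterS FA => z Az|apply: filterS FB => z Bz]; exists z.
  move=> [_ _] [/= [z Az <-] [w Bw <-]]; rewrite /ball/= -pB -ltcR.
  exact: le_lt_trans (ple _) (AB (z, w) (conj Az Bw)).
have /cvg_ex[a Fa] := part (@complex.Re R) (@raddfB _ _ (@complex.Re R)) Re_le.
have /cvg_ex[b Fb] := part (@complex.Im R) (@raddfB _ _ (@complex.Im R)) Im_le.
apply/cvg_ex; exists (a +i* b : scalarH); apply/cvgrPdist_lt => e e0.
have [r r0 ->] : exists2 r : R, 0 < r & e = r%:C.
  by move: e0; case: e => x y; rewrite ltcE/= => /andP[/eqP-> x0]; exists x.
have sqrt_le (u v : R) : Num.sqrt (u ^+ 2 + v ^+ 2) <= `|u| + `|v|.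
  rewrite -[leRHS]ger0_norm ?addr_ge0// -sqrtr_sqr ler_sqrt ?sqr_ge0//.
  by rewrite sqrrD !real_normK ?num_real// addrAC lerDl mulrn_wge0// mulr_ge0.
near=> z.
have nle : `|(a +i* b : scalarH) - z| <=
    (`|a - complex.Re z| + `|b - complex.Im z|)%:C.
  by case: (z) => x y; rewrite [leLHS]normc_def lecR; exact: sqrt_le.
apply: (le_lt_trans nle); rewrite ltcR [r]splitr.
by apply: ltrD; near: z; [move/cvgrPdist_lt: Fa|move/cvgrPdist_lt: Fb]; apply;
  rewrite divr_gt0.
Unshelve. all: by end_near. Qed.

HB.instance Definition _ := Uniform_isComplete.Build scalarH scalarH_complete.

Definition scalar_dot (x y : scalarH) : R[i] := (x : R[i]) * Num.conj (y : R[i]).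

Lemma scalar_dotl (y : scalarH) : linear_for *%R (scalar_dot^~ y).
Proof. by move=> a u v; rewrite /scalar_dot mulrDl mulrA. Qed.

Lemma scalar_dotr (x : scalarH) : linear_for (Num.conj \; *%R) (scalar_dot x).
Proof.
by move=> a u v; rewrite /scalar_dot rmorphD rmorphM/= mulrDr mulrCA.
Qed.

HB.instance Definition _ := bilinear_isBilinear.Build R[i] scalarH scalarH R[i]
  *%R (Num.conj \; *%R) scalar_dot (scalar_dotl, scalar_dotr).

Lemma scalar_dotC (x y : scalarH) :
  scalar_dot x y = (-1) ^+ false * Num.conj (scalar_dot y x).
Proof. by rewrite /scalar_dot rmorphM/= conjCK mul1r mulrC. Qed.

HB.instance Definition _ :=
  isHermitianSesquilinear.Build R[i] scalarH false Num.conj scalar_dot scalar_dotC.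

Lemma scalar_dot_norm (x : scalarH) : scalar_dot x x = `|x| ^+ 2.
Proof. by rewrite /scalar_dot -normCK. Qed.

Lemma scalar_dot_gt0 (x : scalarH) : x != 0 -> 0 < scalar_dot x x.
Proof. by move=> x0; rewrite scalar_dot_norm exprn_gt0// normr_gt0. Qed.

HB.instance Definition _ :=
  isDotProduct.Build R[i] scalarH scalar_dot scalar_dot_gt0.

HB.instance Definition _ := isHilbert.Build R scalarH scalar_dot_norm.
End ScalarHilbert.
Section Words.
Variables (k : nat) (n : 'I_k -> nat).

(* The elements of the product of the free semigroups on n i generators. *)
Definition mword := {dffun forall i : 'I_k, seq 'I_(n i)}.
HB.instance Definition _ := Choice.on mword.

Definition mnil : mword := [ffun i => [::]].
Definition mcat (u v : mword) : mword := [ffun i => u i ++ v i].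

Lemma mcatA : associative mcat.
Proof. by move=> u v w; apply/ffunP => i; rewrite !ffunE catA. Qed.
Lemma mcat0w : left_id mnil mcat.
Proof. by move=> u; apply/ffunP => i; rewrite !ffunE. Qed.
Lemma mcatw0 : right_id mnil mcat.
Proof. by move=> u; apply/ffunP => i; rewrite !ffunE cats0. Qed.

Definition mword_of m (w : {dffun forall i : 'I_k, m.-bseq 'I_(n i)}) : mword :=
  [ffun i => val (w i)].
Definition mwords (m : nat) : seq mword := undup (codom (@mword_of m)).

Lemma mem_mwords m (u : mword) : (u \in mwords m) = [forall i, size (u i) <= m]%N.
Proof.
rewrite mem_undup; apply/codomP/forallP => [[w ->] i|um].
  by rewrite ffunE size_bseq.
by exists [ffun i => Bseq (um i)]; apply/ffunP => i; rewrite !ffunE.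
Qed.

Lemma mwords_factors m (u v : mword) : mcat u v \in mwords m ->
  (u \in mwords m) && (v \in mwords m).
Proof.
rewrite !mem_mwords => /forallP uv; apply/andP; split; apply/forallP => i;
  by apply: leq_trans (uv i); rewrite ffunE size_cat ?leq_addr ?leq_addl.
Qed.
End Words.

Section PowerSeries.
Variables (C : comNzRingType) (k : nat) (n : 'I_k -> nat).

(* Formal power series in indeterminates Z_(i,j), with Z_(s,j) and Z_(t,l)
   commuting for s != t: the monomials are the multiwords, multiplied
   componentwise. The sum defining the product is finite. *)
Definition fps := mword n -> C.
HB.instance Definition _ := GRing.Lmodule.copy fps (mword n -> C^o).
Implicit Types f g h : fps.

Definition fps1 : fps := fun w => (w == mnil n)%:R.
Definition fpsM f g : fps := fun w =>
  \sum_(p \in [set p : mword n * mword n | mcat p.1 p.2 == w]) f p.1 * g p.2.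

Lemma fpsME m f g w : w \in mwords n m ->
  fpsM f g w = \sum_(u <- mwords n m) \sum_(v <- mwords n m)
    if mcat u v == w then f u * g v else 0.
Proof.
move=> wm; 
pose r := [seq (u, v) | u <- mwords n m, v <- mwords n m].
transitivity (\sum_(p <- r | mcat p.1 p.2 == w) f p.1 * g p.2); last first.
  by rewrite big_mkcond big_allpairs.
rewrite bigfs//.
  by apply: allpairs_uniq => [||[? ?] [? ?] _ _ /= [-> ->]//]; rewrite undup_uniq.
move=> [u v] /= /eqP uvw; case/negP; apply/allpairsP; exists (u, v) => /=.
by move: wm; rewrite -uvw => /mwords_factors/andP[].
Qed.

Lemma sum_mwords m w (F : mword n -> C) :
  \sum_(u <- mwords n m) (if w == u then F u else 0) =
  if w \in mwords n m then F w else 0.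
Proof.
case: ifPn => wm; last first.
  by rewrite big1_seq// => u /andP[_ um]; case: eqP wm => // ->; rewrite um.
rewrite (bigD1_seq w) ?undup_uniq//= eqxx big1 ?addr0// => u.
by rewrite eq_sym => /negbTE ->.
Qed.

Lemma mwords_ex w : exists m, w \in mwords n m.
Proof.
exists (\max_i size (w i)); rewrite mem_mwords; apply/forallP => i.
exact: leq_bigmax.
Qed.

Lemma fpsMA : associative fpsM.
Proof.
move=> f g h; apply/funext => w; have [m wm] := mwords_ex w.
rewrite !(fpsME _ _ wm); set s := mwords n m.
pose F u v x := if mcat u (mcat v x) == w then f u * g v * h x else 0.
transitivity (\sum_(u <- s) \sum_(v <- s) \sum_(x <- s) F u v x).
  apply: eq_bigr => u _.
  transitivity (\sum_(y <- s) \sum_(v <- s) \sum_(x <- s)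
      if mcat v x == y then F u v x else 0).
    apply: eq_big_seq => y ys; rewrite (fpsME _ _ ys) mulr_sumr.
    case: eqP => [uyw|uyw].
      apply: eq_bigr => v _; rewrite mulr_sumr; apply: eq_bigr => x _.
      by rewrite /F; case: eqP => [->|_]; rewrite ?mulr0// uyw eqxx mulrA.
    rewrite big1// => v _; rewrite big1// => x _; rewrite /F.
    by case: eqP => [->|//]; case: eqP.
  rewrite exchange_big; apply: eq_bigr => v _; rewrite exchange_big.
  apply: eq_bigr => x _; rewrite sum_mwords /F; case: ifPn => //.
  by case: eqP => // uvx; move: wm; rewrite -uvx => /mwords_factors/andP[_ ->].
symmetry.
transitivity (\sum_(x <- s) \sum_(u <- s) \sum_(v <- s) F u v x); last first.
  by rewrite exchange_big; apply: eq_bigr => u _; rewrite exchange_big.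
rewrite exchange_big; apply: eq_bigr => x _.
transitivity (\sum_(y <- s) \sum_(u <- s) \sum_(v <- s)
    if mcat u v == y then F u v x else 0).
  apply: eq_big_seq => y ys; rewrite (fpsME _ _ ys) mulr_suml.
  case: eqP => [yxw|yxw].
    apply: eq_bigr => u _; rewrite mulr_suml; apply: eq_bigr => v _.
    by rewrite /F mcatA; case: eqP => [->|_]; rewrite ?mul0r// yxw eqxx.
  rewrite big1// => u _; rewrite big1// => v _; rewrite /F mcatA.
  by case: eqP => [->|//]; case: eqP.
rewrite exchange_big; apply: eq_bigr => u _; rewrite exchange_big.
apply: eq_bigr => v _; rewrite sum_mwords /F; case: ifPn => //.
rewrite mcatA.
by case: eqP => // uvx; move: wm; rewrite -uvx => /mwords_factors/andP[-> _].
Qed.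

Lemma fps1M : left_id fps1 fpsM.
Proof.
move=> f; apply/funext => w; have [m wm] := mwords_ex w.
have nm : mnil n \in mwords n m.
  by rewrite mem_mwords; apply/forallP => i; rewrite ffunE.
rewrite (fpsME _ _ wm) (bigD1_seq (mnil n)) ?undup_uniq//= [X in _ + X]big1.
  rewrite addr0 (eq_bigr (fun v => if w == v then f v else 0)).
    by rewrite sum_mwords wm.
  by move=> v _; rewrite mcat0w eq_sym /fps1 eqxx mul1r.
move=> u /negbTE u0; rewrite big1// => v _.
by rewrite /fps1 u0 mul0r; case: ifP.
Qed.

Lemma fpsM1 : right_id fps1 fpsM.
Proof.
move=> f; apply/funext => w; have [m wm] := mwords_ex w.
have nm : mnil n \in mwords n m.
  by rewrite mem_mwords; apply/forallP => i; rewrite ffunE.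
rewrite (fpsME _ _ wm) exchange_big.
rewrite (bigD1_seq (mnil n)) ?undup_uniq//= [X in _ + X]big1.
  rewrite addr0 (eq_bigr (fun v => if w == v then f v else 0)).
    by rewrite sum_mwords wm.
  by move=> v _; rewrite mcatw0 eq_sym /fps1 eqxx mulr1.
move=> u /negbTE u0; rewrite big1// => v _.
by rewrite /fps1 u0 mulr0; case: ifP.
Qed.

Lemma fpsMDl : left_distributive fpsM +%R.
Proof.
move=> f g h; apply/funext => w; have [m wm] := mwords_ex w.
transitivity (fpsM f h w + fpsM g h w) => //.
rewrite !(fpsME _ _ wm) -big_split; apply: eq_bigr => u _ /=.
rewrite -big_split; apply: eq_bigr => v _ /=.
by case: ifP => _; rewrite ?addr0// mulrDl.
Qed.

Lemma fpsMDr : right_distributive fpsM +%R.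
Proof.
move=> f g h; apply/funext => w; have [m wm] := mwords_ex w.
transitivity (fpsM f g w + fpsM f h w) => //.
rewrite !(fpsME _ _ wm) -big_split; apply: eq_bigr => u _ /=.
rewrite -big_split; apply: eq_bigr => v _ /=.
by case: ifP => _; rewrite ?addr0// mulrDr.
Qed.

Lemma fps1_neq0 : fps1 != 0 :> fps.
Proof.
apply/eqP => /(congr1 (@^~ (mnil n))) /eqP.
by rewrite /fps1 eqxx; apply/negP; exact: oner_neq0.
Qed.

HB.instance Definition _ := GRing.Zmodule_isNzRing.Build fps
  fpsMA fps1M fpsM1 fpsMDl fpsMDr fps1_neq0.

Lemma fps_scaleAl (a : C) f g : a *: (f * g) = (a *: f) * g.
Proof.
apply/funext => w; have [m wm] := mwords_ex w.
transitivity (a * fpsM f g w) => //.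
transitivity (fpsM (a *: f) g w) => //.
rewrite !(fpsME _ _ wm) mulr_sumr; apply: eq_bigr => u _ /=.
rewrite mulr_sumr; apply: eq_bigr => v _ /=.
by case: ifP => _; rewrite ?mulr0// mulrA.
Qed.

Lemma fps_scaleAr (a : C) f g : a *: (f * g) = f * (a *: g).
Proof.
apply/funext => w; have [m wm] := mwords_ex w.
transitivity (a * fpsM f g w) => //.
transitivity (fpsM f (a *: g) w) => //.
rewrite !(fpsME _ _ wm) mulr_sumr; apply: eq_bigr => u _ /=.
rewrite mulr_sumr; apply: eq_bigr => v _ /=.
by case: ifP => _; rewrite ?mulr0// mulrCA.
Qed.

HB.instance Definition _ := GRing.Lmodule_isLalgebra.Build C fps fps_scaleAl.
HB.instance Definition _ := GRing.Lalgebra_isAlgebra.Build C fps fps_scaleAr.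
End PowerSeries.

Section Tensor.
Variable R : realType.

Definition lspan (V : lmodType R[i]) (S : set V) : set V :=
  [set v | exists s : seq (R[i] * V),
     (forall p, p \in s -> S p.2) /\ v = \sum_(p <- s) p.1 *: p.2].

Definition orthonormal_basis (I : eqType) (H : hilbertType R) (e : I -> H) :=
  (forall a b, hdot (e a) (e b) = (a == b)%:R) /\ dense (lspan (range e)).

(* Hilbert tensor products are characterized up to a unique unitary, not
   constructed: t is a realization of the tensor product of H1 and H2 on T. *)
Definition is_tensor (H1 H2 T : hilbertType R)
    (t : {bilinear H1 -> H2 -> T}) :=
  (forall x y x' y', hdot (t x y) (t x' y') = hdot x x' * hdot y y') /\
  dense (lspan [set t x.1 x.2 | x in [set: H1 * H2]]).

Definition tensor_op (H1 H2 T : hilbertType R) (t : {bilinear H1 -> H2 -> T})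
    (A : bop H1) (B : bop H2) : bop T :=
  the_op [set S | forall x y, S (t x y) = t (A x) (B y)].

(* dfwith x i y is the family x with its i-th member replaced by y. *)
Definition is_bigtensor (k : nat) (F : 'I_k -> hilbertType R)
    (T : hilbertType R) (t : (forall i, F i) -> T) :=
  [/\ forall x i, linear (fun y : F i => t (dfwith x i y)),
      forall x y, hdot (t x) (t y) = \prod_i hdot (x i) (y i) &
      dense (lspan (range t))].

(* I (x) ... (x) B (x) ... (x) I, with B in position i *)
Definition bigtensor_op (k : nat) (F : 'I_k -> hilbertType R)
    (T : hilbertType R) (t : (forall i, F i) -> T) (i : 'I_k)
    (B : bop (F i)) : bop T :=
  the_op [set S | forall x, S (t x) = t (dfwith x i (B (x i)))].
End Tensor.

Section Polydomain.
Variables (R : realType) (k : nat) (n : 'I_k -> nat).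
Implicit Types (q : forall i, {fsfun seq 'I_(n i) -> R with 0}).

Definition positive_regular m (q : {fsfun seq 'I_m -> R with 0}) :=
  [/\ forall w, 0 <= q w, q [::] = 0 & forall j, 0 < q [:: j]].

Section Operators.
Variable H : hilbertType R.

Definition optuple := forall i : 'I_k, 'I_(n i) -> bop H.

Definition wordop m (Y : 'I_m -> bop H) (w : seq 'I_m) : bop H :=
  \prod_(j <- w) Y j.

Definition mwordop (X : optuple) (w : mword n) : bop H :=
  \prod_(i < k) wordop (X i) (w i).

Definition Phi m (q : {fsfun seq 'I_m -> R with 0}) (X : 'I_m -> bop H)
    (Y : bop H) : bop H :=
  \sum_(w <- finsupp q) (q w)%:C *: (wordop X w * Y * adjoint (wordop X w)).

(* The composite (id - Phi_1)^(p 1) \o ... \o (id - Phi_k)^(p k), where the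
   exponents p i are booleans read as 0 or 1. *)
Definition defect q (X : optuple) (p : 'I_k -> bool) : bop H -> bop H :=
  \big[comp/idfun]_(i < k) iter (p i) (fun Y => Y - Phi (q i) (X i) Y).

Definition cross_commuting (X : optuple) :=
  forall s t, s != t -> forall j l, GRing.comm (X s j) (X t l).

Definition polydomain_minus q : set optuple :=
  [set X | cross_commuting X /\ forall p, op_ge0 (defect q X p 1)].

Definition polydomain q : set optuple :=
  [set X | polydomain_minus q X /\ op_gt0 (defect q X xpredT 1)].

Definition scaled_polydomain (rho : 'I_k -> R) q : set optuple :=
  [set (fun i j => (rho i)%:C *: X i j) | X in polydomain q].
End Operators.

(* The inner sum runs over the factorizations of w into p nonempty words, a
   finite set. *)
Definition b_coef m (q : {fsfun seq 'I_m -> R with 0}) (w : seq 'I_m) : R :=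
  if w is [::] then 1 else
  \sum_(1 <= p < (size w).+1)
    \sum_(s \in [set s : seq (seq 'I_m) |
                  [/\ size s = p, flatten s = w & [::] \notin s]])
      \prod_(v <- s) q v.

(* Realizations of the full Fock spaces, each with its orthonormal basis indexed
   by words, and of their tensor product; any two are unitarily equivalent. *)
Record fock_model := FockModel {
  fock : 'I_k -> hilbertType R;
  fbasis : forall i, seq 'I_(n i) -> fock i;
  fbasisP : forall i, orthonormal_basis (fbasis (i := i));
  fspace : hilbertType R;
  ftensor : (forall i, fock i) -> fspace;
  ftensorP : is_bigtensor ftensor }.

Definition shift q (F : fock_model) (i : 'I_k) (j : 'I_(n i)) : bop (fock F i) :=
  the_op [set S | forall w, S (fbasis F w) =
    (Num.sqrt (b_coef (q i) w / b_coef (q i) (j :: w)))%:C *: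
      fbasis F (j :: w)].

Definition universal_model q (F : fock_model) : optuple (fspace F) :=
  fun i j => bigtensor_op (@ftensor F) (shift q F j).

(* Finite, so that \sum_(w \in Lambda p) really sums over all of Lambda p (a
   \sum_(_ \in _) with infinite support is 0 by convention). *)
Definition Lambda (p : {ffun 'I_k -> nat}) : set (mword n) :=
  [set w | forall i, size (w i) = p i].

(* partial_sum f @ totally is the net of the sums of f over finite sets of
   indices: its convergence is that of the unordered sum of f. *)
Definition free_holomorphic (rho : 'I_k -> R) q (K : hilbertType R)
    (A : mword n -> bop K) :=
  forall (H T : hilbertType R) (t : {bilinear K -> H -> T}), is_tensor t ->
  forall X : optuple H, scaled_polydomain rho q X ->
  cvg (partial_sum (fun p => \sum_(w \in Lambda p)
         tensor_op t (A w) (mwordop X w)) @ totally).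

Definition Hol (rho : 'I_k -> R) q : set (fps R[i] n) :=
  [set phi | free_holomorphic rho q (fun w => phi w *: (1 : bop (scalarH R)))].
End Polydomain.

(* Main.v *)
Require Import Defs.
From mathcomp Require Import all_boot all_order all_algebra finmap complex sesquilinear.
From mathcomp Require Import all_classical all_reals all_analysis.
From mathcomp Require Import summability ring lra.
Set Implicit Arguments.
Unset Strict Implicit.
Unset Printing Implicit Defensive.
Import Order.TTheory GRing.Theory Num.Theory.
Import numFieldNormedType.Exports.
Local Open Scope classical_set_scope.
Local Open Scope complex_scope.
Local Open Scope ring_scope.

(** Fix a positive regular tuple [q], write [b] for the weights of the universal
    model [W], and let [e_w] be the basis of its space indexed by multiwords, so that
    [W_w e_0 = b_w^(-1/2) e_w].

    From holomorphic to convergent at [s W]: for [0 <= r_i < 1] all defects of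
    [r W] are diagonal in the basis [e_w], with entries at least the product of
    the [1 - r_i^2]; so [r W] lies in the polydomain
    ([scaled_model_polydomain]). A free holomorphic function can therefore be
    evaluated at [s W = rho (s / rho) W], and the partial sums of the series over
    the total degree are partial sums of that unordered sum, over finite sets
    which exhaust the multidegrees.

    From convergent at [s W] to holomorphic: two bounds with the same weights
    replace a von Neumann inequality. Applying the terms of the series to vectors
    [x (x) e_0] bounds, for every multidegree [p], the column of the
    [b_w^(-1/2) A_w] with [|w| = p] by [M s^(-p)] ([vacuum_bound]). On the other
    side, if [Phi_i(1) <= 1] for all [i], then the row of the [b_w^(1/2) Y_w] with
    [|w| = p] is a contraction ([degree_contraction]): this is an induction along
    the recursion [b_w = sum_(w = uv, u <> 1) q_u b_v]. By Cauchy-Schwarz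
    ([tensor_row_column]) the homogeneous part of degree [p] at [Y] has norm at most
    [M s^(-p)]. Now the polydomain is open under scaling ([polydomain_open]): since
    the maps [id - Phi_i] commute, every defect dominates the full one, hence is
    bounded below, and the defects depend continuously on the scaling factor. So a
    point [X] of the scaled polydomain is [rho / tau] times a point [Y] of the
    polydomain, with [tau > 1], and taking [s] between [rho / tau] and [rho] makes
    the series at [X] converge absolutely, at a geometric rate.

    The same room between [X] and [tau X] shows that a convergent unordered sum at
    all points is absolutely convergent at each of them ([Hol_abs_summable]): its
    terms are bounded at [tau X]. As the homogeneous parts of a product are the
    Cauchy products of the homogeneous parts, the free holomorphic functions with
    scalar coefficients are stable under multiplication.

    The objects that the definitions describe by a property (adjoints, tensor
    products of operators, weighted shifts) exist by the Riesz representation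
    theorem ([riesz]) and by extension from a dense span ([bop_extend]), the
    required bounds being positivity statements on Gram matrices
    ([psd_column_bound], [orthogonal_bound]). *)

(** * Inner products *)

(** Expand [B] on [x - t y], with [t = B x y / B y y] if [B y y > 0]; if
    [B y y = 0], a large multiple [t] of [B x y] would make the value negative unless
    [B x y = 0]. *)
Lemma psd_cauchy_schwarz (C : numClosedFieldType) (U : lmodType C)
    (B : U -> U -> C) :
  (forall y, linear_for *%R (B^~ y)) -> (forall x y, B y x = Num.conj (B x y)) ->
  (forall x, 0 <= B x x) -> forall x y, `|B x y| ^+ 2 <= B x x * B y y.
Proof.
move=> Bl Bc B0 x y.
have key t : 0 <= B x x - Num.conj t * B x y - t * Num.conj (B x y) +
    `|t| ^+ 2 * B y y.
  have Bl' z a u v : B (a *: u + v) z = a * B u z + B v z by rewrite Bl.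
  have Br' z a u v : B z (a *: u + v) = Num.conj a * B z u + B z v.
    by rewrite Bc Bl' rmorphD rmorphM/= -!Bc.
  have := B0 (- t *: y + x); rewrite Bl' !Br' (Bc x y) normCK rmorphN /=.
  by congr (0 <= _); ring.
have [c0|c0] := eqVneq (B y y) 0.
  have [b0|b0] := eqVneq (B x y) 0; first by rewrite b0 normr0 expr0n/= c0 mulr0.
  have b2 : 0 < `|B x y| ^+ 2 by rewrite exprn_gt0 ?normr_gt0.
  have := key (((B x x + 1) / `|B x y| ^+ 2) * B x y).
  have s_real : Num.conj ((B x x + 1) / `|B x y| ^+ 2) = (B x x + 1) / `|B x y| ^+ 2.
    by apply: geC0_conj; rewrite divr_ge0 ?(ltW b2)// addr_ge0.
  rewrite rmorphM/= s_real c0 mulr0 addr0 -!mulrA [Num.conj _ * _]mulrC -normCK.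
  rewrite mulVf ?gt_eqF// mulr1.
  have -> : B x x - (B x x + 1) - (B x x + 1) = - (B x x + 1 + 1) by ring.
  by rewrite oppr_ge0 lt_geF// ltr_wpDl// addr_ge0.
have cp : 0 < B y y by rewrite lt_def c0 B0.
have := key (B x y / B y y).
have cr : Num.conj (B y y)^-1 = (B y y)^-1 by apply: geC0_conj; rewrite invr_ge0.
rewrite rmorphM/= cr normrM exprMn (@ger0_norm _ (B y y)^-1) ?invr_ge0// normCK.
move=> h; rewrite -ler_pdivrMr// -subr_ge0; move: h; congr (0 <= _); field.
exact: c0.
Qed.

Section HilbertBasics.
Variables (R : realType) (H : hilbertType R).
Implicit Types (x y z : H) (a : R[i]).

Lemma hdotC x y : hdot x y = Num.conj (hdot y x).
Proof. by rewrite hermC mul1r. Qed.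

Lemma hdotDl x y z : hdot (x + y) z = hdot x z + hdot y z.
Proof. by rewrite linearDl. Qed.
Lemma hdotDr x y z : hdot z (x + y) = hdot z x + hdot z y.
Proof. by rewrite linearDr. Qed.
Lemma hdotBl x y z : hdot (x - y) z = hdot x z - hdot y z.
Proof. by rewrite linearBl. Qed.
Lemma hdotBr x y z : hdot z (x - y) = hdot z x - hdot z y.
Proof. by rewrite linearBr. Qed.
Lemma hdotZl a x z : hdot (a *: x) z = a * hdot x z.
Proof. by rewrite linearZl_LR. Qed.
Lemma hdotZr a x z : hdot z (a *: x) = Num.conj a * hdot z x.
Proof. by rewrite linearZr_LR. Qed.
Lemma hdot0l z : hdot 0 z = 0. Proof. exact: linear0l. Qed.
Lemma hdot0r z : hdot z 0 = 0. Proof. exact: linear0r. Qed.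
Lemma hdot_suml (I : Type) (r : seq I) (P : pred I) (E : I -> H) z :
  hdot (\sum_(i <- r | P i) E i) z = \sum_(i <- r | P i) hdot (E i) z.
Proof. by rewrite linear_sumlz. Qed.
Lemma hdot_sumr (I : Type) (r : seq I) (P : pred I) (E : I -> H) z :
  hdot z (\sum_(i <- r | P i) E i) = \sum_(i <- r | P i) hdot z (E i).
Proof. by rewrite linear_sumr. Qed.
Lemma hdotxx x : hdot x x = (rnorm x ^+ 2)%:C.
Proof. by rewrite hdot_norm rnormE rmorphXn. Qed.
Lemma hdotxx_ge0 x : 0 <= hdot x x.
Proof. by rewrite hdot_norm exprn_ge0. Qed.

Lemma cauchy_schwarz x y : rnorm (hdot x y : R[i]^o) <= rnorm x * rnorm y.
Proof.
have := @psd_cauchy_schwarz R[i] H (fun x y => hdot x y) _ _ hdotxx_ge0 x y.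
rewrite rnormC !hdotxx -rmorphXn -rmorphM lecR -exprMn.
rewrite ler_pXn2r ?nnegrE ?mulr_ge0 ?rnorm_ge0//; apply.
  by move=> u a v w; rewrite hdotDl hdotZl.
by move=> u v; rewrite hdotC.
Qed.

Lemma hdot_eq x y : (forall z, hdot x z = hdot y z) -> x = y.
Proof.
move=> xy; apply/eqP; rewrite -subr_eq0; apply/eqP/rnorm_eq0/eqP.
have := hdotxx (x - y); rewrite hdotBl xy subrr => -[] /esym/eqP.
by rewrite expf_eq0.
Qed.
Lemma hdot_eqr x y : (forall z, hdot z x = hdot z y) -> x = y.
Proof. by move=> xy; apply: hdot_eq => z; rewrite hdotC xy -hdotC. Qed.

Lemma rnormN (V : normedModType R[i]) (u : V) : rnorm (- u) = rnorm u.
Proof. by rewrite /rnorm normrN. Qed.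
Lemma rnormCr (r : R) : rnorm (r%:C : R[i]^o) = `|r|.
Proof. by apply: rnorm_def; rewrite normc_def/= expr0n/= addr0 sqrtr_sqr. Qed.
Lemma rnormZr (V : normedModType R[i]) (r : R) (v : V) :
  rnorm (r%:C *: v) = `|r| * rnorm v.
Proof. by rewrite rnormZ rnormCr. Qed.
Lemma rnorm_sum (V : normedModType R[i]) (I : Type) (r : seq I) (P : pred I)
    (E : I -> V) :
  rnorm (\sum_(i <- r | P i) E i) <= \sum_(i <- r | P i) rnorm (E i).
Proof.
elim/big_ind2 : _ => //; first by rewrite rnorm0.
by move=> x a y b xa yb; rewrite (le_trans (rnormD _ _))// lerD.
Qed.
Lemma Re_rnorm (a : R[i]) : complex.Re a <= rnorm (a : R[i]^o).
Proof.
rewrite -lecR -rnormC; case: a => x y; rewrite normc_def lecR/=.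
by rewrite (le_trans (ler_norm _))// -sqrtr_sqr ler_wsqrtr// lerDl sqr_ge0.
Qed.
End HilbertBasics.

(** * Limits measured by real norms *)

Section RealNorm.
Variables (R : realType).

Lemma complex_gt0 (e : R[i]) : 0 < e -> exists2 r : R, 0 < r & e = r%:C.
Proof. by case: e => x y; rewrite ltcE/= => /andP[/eqP-> x0]; exists x. Qed.

Lemma cvg_rnormP (V : normedModType R[i]) (F : set_system V) (l : V) :
  Filter F ->
  F --> l <-> forall e : R, 0 < e -> F [set x | rnorm (l - x) < e].
Proof.
move=> FF; split=> [/cvgrPdist_lt Fl e e0|Fl].
  have := Fl e%:C; rewrite ltcR => /(_ e0); apply: filterS => x /=.
  by rewrite rnormE ltcR.
apply/cvgrPdist_lt => _ /complex_gt0[e e0 ->]; have := Fl e e0.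
by apply: filterS => x /=; rewrite rnormE ltcR.
Qed.

Lemma cauchy_rnorm (V : normedModType R[i]) (F : set_system V) :
  ProperFilter F ->
  cauchy F <-> forall e : R, 0 < e ->
    exists2 A, F A & forall x y, A x -> A y -> rnorm (x - y) < e.
Proof.
move=> FF; split=> [/cauchy_ballP Fc e e0|Fc].
  have := Fc (e / 2)%:C; rewrite ltcR divr_gt0// => /(_ erefl)[[A B] [/= FA FB] AB].
  have FAB : F (A `&` B) by exact: filterI.
  exists (A `&` B) => // x y [Ax Bx] [Ay By].
  by have := AB (x, y) (conj Ax By); rewrite -ball_normE/= rnormE ltcR => /lt_le_trans;
    apply; lra.
apply/cauchy_ballP => _ /complex_gt0[e e0 ->]; have [A FA Ae] := Fc _ e0.
exists (A, A) => // -[x y] [/= Ax Ay].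
by rewrite -ball_normE/= rnormE ltcR; exact: Ae.
Qed.

Lemma cvg_seq_rnorm (V : completeNormedModType R[i]) (u : nat -> V) :
  (forall e : R, 0 < e -> exists N : nat, forall m n, (N <= m)%N -> (N <= n)%N ->
     rnorm (u m - u n) < e) ->
  exists l, forall e : R, 0 < e -> exists N : nat, forall n, (N <= n)%N ->
     rnorm (l - u n) < e.
Proof.
move=> uc; have /cauchy_cvg/cvg_ex[l /cvg_rnormP ul] : cauchy (u @ \oo).
  apply/cauchy_rnorm => e e0; have [N Ne] := uc e e0.
  exists (u @` [set n | (N <= n)%N]); first by exists N => // n /= Nn; exists n.
  by move=> _ _ [m Nm <-] [n Nn <-]; exact: Ne.
by exists l => e e0; have [N _ Ne] := ul e e0; exists N => n /Ne.
Qed.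
End RealNorm.

(** * Riesz representation and adjoints *)

Section Riesz.
Variables (R : realType) (H : hilbertType R).
Implicit Types (x y z : H) (a : R[i]).

Lemma rnorm_sqrD x y :
  rnorm (x + y) ^+ 2 = rnorm x ^+ 2 + rnorm y ^+ 2 + complex.Re (hdot x y) *+ 2.
Proof.
have := hdotxx (x + y); rewrite !(hdotDl, hdotDr) (hdotC y x) !hdotxx.
move/(congr1 (@complex.Re R)) => /= <-; rewrite !raddfD/=.
by case: (hdot x y) => u v /=; ring.
Qed.

Lemma rnorm_sqrZ (r : R) x : rnorm (r%:C *: x) ^+ 2 = r ^+ 2 * rnorm x ^+ 2.
Proof. by rewrite rnormZr exprMn real_normK ?num_real. Qed.

(** The representing vector minimizes [J x = |x|^2 - 2 Re (f x)]. By the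
    parallelogram law minimizing sequences are Cauchy, and the derivative of [J] at
    the minimum [y], in the directions [z] and [i z], gives [f z = <z, y>]. *)
Lemma riesz (f : H -> R[i]) (M : R) : (forall a x y, f (a *: x + y) = a * f x + f y) ->
  (forall x, rnorm (f x : R[i]^o) <= M * rnorm x) ->
  exists y, forall x, f x = hdot x y.
Proof.
move=> fl fM.
have f0 : f 0 = 0.
  have := fl 1 0 0; rewrite scale1r addr0 mul1r => h.
  by apply: (addrI (f 0)); rewrite addr0 -h.
have fZ a x : f (a *: x) = a * f x by have := fl a x 0; rewrite addr0 f0 addr0.
have fD x y : f (x + y) = f x + f y by have := fl 1 x y; rewrite scale1r mul1r.
pose J x := rnorm x ^+ 2 - complex.Re (f x) *+ 2.
have JM x : - M ^+ 2 <= J x.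
  have := le_trans (@Re_rnorm _ (f x)) (fM x); rewrite /J => h.
  have := sqr_ge0 (rnorm x - M); move: h; set u := rnorm x; set v := complex.Re _.
  by move=> *; nra.
have Jinf : has_inf (range J).
  by split; [exists (J 0), 0|exists (- M ^+ 2) => _ [x _ <-]].
pose d := inf (range J).
have Jd x : d <= J x by apply: ge_inf; [case: Jinf|exists x].
have Jpar x y : J (x + y) = J x + J y + complex.Re (hdot x y) *+ 2.
  by rewrite /J rnorm_sqrD fD raddfD/=; ring.
have JZ (r : R) x : J (r%:C *: x) = r ^+ 2 * rnorm x ^+ 2 - r * complex.Re (f x) *+ 2.
  rewrite /J rnorm_sqrZ fZ; case: (f x) => u v /=; ring.
have near_min e x y : J x <= d + e -> J y <= d + e -> rnorm (x - y) ^+ 2 <= 4 * e.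
  move=> Jx Jy; have := Jd ((1/2)%:C *: (x + y)).
  rewrite JZ rnorm_sqrD fD raddfD/=; move: Jx Jy.
  have := rnorm_sqrD x (- y); rewrite rnormN -scaleN1r hdotZr rmorphN1 mulN1r raddfN/=.
  by rewrite /J scaleN1r; move=> -> *; lra.
have /choice[u uP] (n : nat) : exists x, J x < d + n.+1%:R^-1.
  have [_ [x _ <-] Jx] := @inf_adherent _ (range J) n.+1%:R^-1 ltac:(by []) Jinf.
  by exists x.
have inve (e : R) : 0 < e -> exists N : nat, N.+1%:R^-1 < e.
  move=> e0; exists (Num.truncn e^-1).
  by rewrite invf_plt ?posrE// truncnS_gt.
have uN (N n : nat) : (N <= n)%N -> J (u n) <= d + N.+1%:R^-1.
  move=> Nn; rewrite (le_trans (ltW (uP n)))// lerD2l lef_pV2 ?posrE//.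
  by rewrite ler_nat.
have [y yP] : exists y, forall e : R, 0 < e -> exists N : nat, forall n, (N <= n)%N ->
    rnorm (y - u n) < e.
  apply: cvg_seq_rnorm => e e0; have [N Ne] :=
    inve (e ^+ 2 / 4) ltac:(by rewrite divr_gt0// exprn_gt0).
  exists N => m n Nm Nn; have := near_min _ _ _ (uN _ _ Nm) (uN _ _ Nn).
  move: Ne; set w := N.+1%:R^-1 => we h.
  have : rnorm (u m - u n) ^+ 2 < e ^+ 2 by lra.
  by rewrite ltr_pXn2r ?nnegrE ?rnorm_ge0// ltW.
(* continuity of J, made explicit at a late term x of the minimizing sequence *)
have Jy : J y <= d.
  suff Je (e : R) : 0 < e -> J y <= e + d by apply/ler_addgt0Pl.
  move=> e0.
  pose K := 2 * (rnorm y + 2 + `|M|).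
  have K0 : 0 < K by rewrite /K mulr_gt0// ltr_wpDr// ltr_wpDl// rnorm_ge0.
  have [N1 N1P] := yP (Num.min 1 (e / 2 / K)) ltac:(by rewrite lt_min ltr01 !divr_gt0).
  have [N2 N2P] := inve (e / 2) ltac:(by rewrite divr_gt0).
  have := N1P (maxn N1 N2) (leq_maxl _ _).
  have := uN N2 (maxn N1 N2) (leq_maxr _ _).
  move: (u _) => x Jx; rewrite lt_min => /andP[yx1 yx].
  have -> : y = x + (y - x) by rewrite addrC subrK.
  move: yx1 yx; set z := y - x => z1 zK.
  rewrite Jpar.
  have xy : rnorm x <= rnorm y + 1.
    have -> : x = y - z by rewrite /z opprB addrC subrK.
    by rewrite (le_trans (rnormD _ _))// rnormN lerD2l ltW.
  have h1 := le_trans (@Re_rnorm _ (hdot x z)) (cauchy_schwarz x z).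
  have h2 : - complex.Re (f z) <= `|M| * rnorm z.
    rewrite -raddfN -[- f z]mulN1r -fZ scaleN1r.
    rewrite (le_trans (@Re_rnorm _ _))// (le_trans (fM _))// rnormN.
    by rewrite ler_wpM2r ?rnorm_ge0// ler_norm.
  have z0 := rnorm_ge0 z.
  have h3 : K * rnorm z < e / 2 by rewrite mulrC -ltr_pdivlMr.
  have h4 : rnorm x * rnorm z <= (rnorm y + 1) * rnorm z by rewrite ler_wpM2r.
  have h5 : rnorm z ^+ 2 <= rnorm z by rewrite expr2 ler_piMr// ltW.
  have h6 : 0 <= rnorm y * rnorm z by rewrite mulr_ge0 ?rnorm_ge0.
  move: h3; rewrite /J /K => h3; move: Jx; rewrite /J => Jx.
  move: h1 h2 h3 h4 h5 h6 Jx N2P z0; clearbody z d.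
  move: (complex.Re (hdot x z)) (complex.Re (f z)) (complex.Re (f x)).
  move: (N2.+1%:R^-1) (`|M|) {N1P K K0 zK xy z1} => iN aM.
  move: (rnorm x) (rnorm y) (rnorm z) => *.
  lra.
have Re0 z : complex.Re (hdot z y) = complex.Re (f z).
  have key (t : R) : 0 <= t ^+ 2 * rnorm z ^+ 2 + t * (complex.Re (hdot z y) - complex.Re
    (f z)) *+ 2.
    have := le_trans Jy (Jd (t%:C *: z + y)); rewrite Jpar JZ hdotZl.
    by case: (hdot z y) => p q /=; lra.
  set w := complex.Re (hdot z y) - _ in key.
  suff : w = 0 by rewrite /w; lra.
  apply/eqP; rewrite -sqrf_eq0 -[_ == 0]negbK; apply/negP => w0.
  have w2 : 0 < w ^+ 2 by rewrite lt_def w0 sqr_ge0.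
  set s := rnorm z ^+ 2 in key; have s0 : 0 <= s by exact: sqr_ge0.
  have s1 : 0 < s + 1 by lra.
  have := key (- w / (s + 1)).
  have -> : (- w / (s + 1)) ^+ 2 * s + - w / (s + 1) * w *+ 2 =
    - (w ^+ 2 / (s + 1)) * (1 + (s + 1)^-1).
    by field; rewrite gt_eqF.
  apply/negP; rewrite -ltNge mulNr oppr_lt0 mulr_gt0 ?divr_gt0// ltr_wpDr// invr_ge0 ltW//.
exists y => x.
have := Re0 x; have := Re0 (- 'i *: x); rewrite fZ hdotZl.
case: (hdot x y) => p q; case: (f x) => p' q' /=;
  rewrite !(mul0r, mulN1r, add0r, oppr0, sub0r, opprK).
by move=> -> ->.
Qed.
End Riesz.

Section Adjoint.
Variables (R : realType) (H : hilbertType R).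
Implicit Types (S T : bop H) (x y : H) (a : R[i]).

Lemma the_opE (P : set (bop H)) T :
  P T -> (forall S, P S -> S = T) -> the_op P = T.
Proof. by move=> PT PU; apply: PU; apply: xgetPex; exists T. Qed.

(** For each [y], represent the functional [x |-> <T x, y>]. *)
Lemma adjoint_ex T : exists S : bop H, forall x y, hdot (T x) y = hdot x (S y).
Proof.
have /choice[S SP] y : exists z, forall x, hdot (T x) y = hdot x z.
  apply: (@riesz _ _ (fun x => hdot (T x) y) (opnorm T * rnorm y)) => [a u v|x].
    by rewrite linearP hdotDl hdotZl.
  by rewrite (le_trans (cauchy_schwarz _ _))// mulrAC ler_wpM2r ?rnorm_ge0 ?opnorm_ler.
suff bS : S \in @bounded_op R H by exists (Bop bS).
apply/bounded_opP; split=> [a u v|].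
  by apply: hdot_eqr => z; rewrite -SP !(hdotDr, hdotZr) !SP.
exists (opnorm T) => [|y]; first exact: opnorm_ge0.
have [->|Sy] := eqVneq (rnorm (S y)) 0; first by rewrite mulr_ge0 ?opnorm_ge0 ?rnorm_ge0.
have Sp : 0 < rnorm (S y) by rewrite lt_def Sy rnorm_ge0.
rewrite -(ler_pM2r Sp) -expr2.
have := Re_rnorm (hdot (S y) (S y)); rewrite {1}hdotxx/= => /le_trans; apply.
rewrite -SP (le_trans (cauchy_schwarz _ _))// mulrAC.
by rewrite ler_wpM2r ?rnorm_ge0 ?opnorm_ler.
Qed.

Lemma adjoint_unique T S :
  (forall x y, hdot (T x) y = hdot x (S y)) -> adjoint T = S.
Proof.
move=> TS; apply: the_opE => // S' TS'; apply: bop_ext => y.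
by apply: hdot_eqr => x; rewrite -TS' TS.
Qed.

Lemma adjointP T x y : hdot (T x) y = hdot x (adjoint T y).
Proof. by have [S TS] := adjoint_ex T; rewrite (adjoint_unique TS). Qed.

Lemma adjointM S T : adjoint (S * T) = adjoint T * adjoint S.
Proof. by apply: adjoint_unique => x y; rewrite !bopE !adjointP. Qed.

Lemma adjoint1 : adjoint (1 : bop H) = 1.
Proof. by apply: adjoint_unique. Qed.

Lemma adjointZ a T : adjoint (a *: T) = Num.conj a *: adjoint T.
Proof.
apply: adjoint_unique => x y.
by rewrite !bopZE hdotZl hdotZr conjCK adjointP.
Qed.
End Adjoint.

(** * Dense spans and extension of operators *)

Section Density.
Variable R : realType.

Lemma dense_approx (V : normedModType R[i]) (A : set V) v (e : R) :
  dense A -> 0 < e -> exists2 u, A u & rnorm (v - u) < e.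
Proof.
move=> dA e0; have e0' : 0 < e%:C by rewrite ltcR.
have [//||u [/= uv Au]] := dA (ball v e%:C).
- by exists v; exact: ballxx.
- exact: ball_open.
by exists u => //; move: uv; rewrite -ball_normE/= rnormE ltcR.
Qed.

(** Identities and bounds on a whole space are checked on generators and
    transported by this principle. *)
Lemma dense_ind (V : normedModType R[i]) (S P : set V) :
  dense (lspan S) -> (forall v, S v -> P v) -> P 0 ->
  (forall a u v, P u -> P v -> P (a *: u + v)) ->
  (forall v, (forall e : R, 0 < e -> exists2 u, P u & rnorm (v - u) < e) -> P v) ->
  forall v, P v.
Proof.
move=> dS SP P0 PD Pc v; apply: Pc => e e0.
have [_ [s [sS ->]] vs] := dense_approx v dS e0; exists (\sum_(p <- s) p.1 *: p.2) => //.
elim: s sS {vs} => [|p s IH] sS; first by rewrite big_nil.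
rewrite big_cons; apply: PD; first by apply/SP/sS; rewrite mem_head.
by apply: IH => r rs; apply: sS; rewrite in_cons rs orbT.
Qed.

Lemma le0_eps (x c : R) : 0 <= c -> (forall e : R, 0 < e -> x <= c * e) -> x <= 0.
Proof.
move=> c0 xe; rewrite leNgt; apply/negP => x0.
have c1 : 0 < c + 1 by rewrite ltr_wpDl.
have := xe (x / (c + 1)) (divr_gt0 x0 c1).
by rewrite mulrA ler_pdivlMr// mulrDr mulr1 [c * x]mulrC gerDl leNgt x0.
Qed.

Lemma dense_linear0 (V W : normedModType R[i]) (A : set V) (f : V -> W) (M : R) :
  linear f -> 0 <= M -> (forall x, rnorm (f x) <= M * rnorm x) ->
  dense (lspan A) -> (forall v, A v -> f v = 0) -> forall v, f v = 0.
Proof.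
move=> lf M0 fM dA A0; apply: (dense_ind dA) => //=.
- by apply: rnorm_eq0; apply/eqP; rewrite eq_le rnorm_ge0 (le_trans (fM _))// rnorm0 mulr0.
- by move=> a u v fu fv; rewrite lf fu fv scaler0 addr0.
move=> v vP; apply/rnorm_eq0/eqP; rewrite eq_le rnorm_ge0 andbT.
apply: (le0_eps M0) => e /vP[u fu vu].
have -> : f v = f (v - u) by rewrite addrC -scaleN1r lf fu scaler0 add0r.
by rewrite (le_trans (fM _))// ler_wpM2l// ltW.
Qed.

Lemma bopBE (H : hilbertType R) (S T : bop H) x : (S - T) x = S x - T x.
Proof. by []. Qed.

Lemma bop_sumE (H : hilbertType R) (I : Type) (r : seq I) (P : pred I)
    (E : I -> bop H) x :
  (\sum_(i <- r | P i) E i) x = \sum_(i <- r | P i) E i x.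
Proof. by elim/big_ind2 : _ => // S y T z <- <-. Qed.

Lemma bop_eq_dense (H : hilbertType R) (A : set H) (S T : bop H) :
  dense (lspan A) -> (forall v, A v -> S v = T v) -> S = T.
Proof.
move=> dA ST; apply: bop_ext => v; apply/eqP; rewrite -subr_eq0; apply/eqP.
apply: (@dense_linear0 _ _ A (fun v => (S - T) v) (opnorm (S - T)) _ _ _ dA).
- by move=> a x y; rewrite linearP.
- exact: opnorm_ge0.
- exact: opnorm_ler.
by move=> u Au; rewrite bopBE ST// subrr.
Qed.

Definition lcomb (V : lmodType R[i]) (I : Type) (g : I -> V) (s : seq (R[i] * I)) : V :=
  \sum_(p <- s) p.1 *: g p.2.

Lemma lspan_range (V : lmodType R[i]) (I : Type) (g : I -> V) v :
  lspan (range g) v -> exists s, v = lcomb g s.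
Proof.
move=> [s [sg ->]]; elim: s sg => [|p s IH] sg.
  by exists [::]; rewrite /lcomb !big_nil.
have [|s' es] := IH; first by move=> r rs; apply: sg; rewrite in_cons rs orbT.
have [i _ gi] := sg p (mem_head _ _).
by exists ((p.1, i) :: s'); rewrite big_cons es /lcomb big_cons gi.
Qed.

Lemma lcomb_scale_cat (V : lmodType R[i]) (I : Type) (g : I -> V) a s s' :
  lcomb g ([seq (a * p.1, p.2) | p <- s] ++ s') = a *: lcomb g s + lcomb g s'.
Proof.
rewrite /lcomb big_cat big_map scaler_sumr; congr (_ + _).
by apply: eq_bigr => p _; rewrite scalerA.
Qed.

(** The closure of the relation between [sum c_i g_i] and [sum c_i h_i] is the
    graph of a bounded operator: by the bound, sequences of combinations that
    converge on the side of [g] are Cauchy on the side of [h]. All operators given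
    by their values on generators are obtained in this way. *)
Lemma bop_extend (H : hilbertType R) (I : Type) (g h : I -> H) (C : R) :
  dense (lspan (range g)) -> 0 <= C ->
  (forall s, rnorm (lcomb h s) <= C * rnorm (lcomb g s)) ->
  exists2 S : bop H, (forall i, S (g i) = h i) & opnorm S <= C.
Proof.
move=> dg C0 hC.
pose rel v w := forall e : R, 0 < e ->
  exists2 s, rnorm (v - lcomb g s) < e & rnorm (w - lcomb h s) < e.
have relP a v w v' w' : rel v w -> rel v' w' -> rel (a *: v + v') (a *: w + w').
  move=> vw vw' e e0.
  have a0 : 0 < rnorm (a : R[i]^o) + 1 by rewrite ltr_wpDl ?rnorm_ge0.
  have [|s vs ws] := vw (e / 2 / (rnorm (a : R[i]^o) + 1)); first by rewrite !divr_gt0.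
  have [|s' vs' ws'] := vw' (e / 2); first by rewrite !divr_gt0.
  exists ([seq (a * p.1, p.2) | p <- s] ++ s'); rewrite lcomb_scale_cat opprD addrACA -scalerBr.
    rewrite (le_lt_trans (rnormD _ _))// [e]splitr; apply: ler_ltD => //.
    rewrite rnormZ; move: vs; rewrite ltr_pdivlMr// => /ltW; apply: le_trans.
    by rewrite mulrC ler_wpM2l ?rnorm_ge0// lerDl.
  rewrite (le_lt_trans (rnormD _ _))// [e]splitr; apply: ler_ltD => //.
  rewrite rnormZ; move: ws; rewrite ltr_pdivlMr// => /ltW; apply: le_trans.
  by rewrite mulrC ler_wpM2l ?rnorm_ge0// lerDl.
have rel_le v w : rel v w -> rnorm w <= C * rnorm v.
  move=> vw; rewrite -subr_le0; apply: (@le0_eps _ (C + 1)) => [|e e0]; first exact: addr_ge0.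
  have [s vs ws] := vw e e0; rewrite lerBlDr.
  have -> : w = lcomb h s + (w - lcomb h s) by rewrite addrC subrK.
  rewrite (le_trans (rnormD _ _))// mulrDl mul1r addrAC lerD//; last exact: ltW.
  rewrite (le_trans (hC s))// -mulrDr ler_wpM2l// addrC.
  have {1}-> : lcomb g s = v + - (v - lcomb g s) by rewrite opprB addrC subrK.
  by rewrite (le_trans (rnormD _ _))// rnormN lerD2l ltW.
have /choice[S SP] v : exists w, rel v w.
  have /choice[s sP] (n : nat) : exists s, rnorm (v - lcomb g s) < n.+1%:R^-1.
    have n0 : 0 < n.+1%:R^-1 :> R by [].
    have [u /lspan_range[s ->] vs] := dense_approx v dg n0.
    by exists s.
  have inve (e : R) : 0 < e -> exists N : nat, forall n, (N <= n)%N -> n.+1%:R^-1 < e.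
    move=> e0; exists (Num.truncn e^-1) => n Nn.
    rewrite invf_plt ?posrE//; apply: lt_le_trans (truncnS_gt _) _.
    by rewrite ler_nat.
  have [w wP] : exists w, forall e : R, 0 < e -> exists N : nat, forall n, (N <= n)%N ->
      rnorm (w - lcomb h (s n)) < e.
    apply: cvg_seq_rnorm => e e0.
    have [|N NP] := inve (e / 2 / (C + 1)); first by rewrite !divr_gt0// ltr_wpDl.
    exists N => m n Nm Nn.
    have -> : lcomb h (s m) - lcomb h (s n) =
      lcomb h ([seq (-1 * p.1, p.2) | p <- s n] ++ s m).
      by rewrite lcomb_scale_cat scaleN1r addrC.
    apply: (le_lt_trans (hC _)); rewrite lcomb_scale_cat scaleN1r addrC.
    have -> : lcomb g (s m) - lcomb g (s n) = (v - lcomb g (s n)) - (v - lcomb g (s m)).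
      by rewrite opprB [RHS]addrC subrKA.
    have h1 := lt_trans (sP m) (NP m Nm); have h2 := lt_trans (sP n) (NP n Nn).
    have := rnormD (v - lcomb g (s n)) (- (v - lcomb g (s m))); rewrite rnormN.
    set p := rnorm (_ - _ - _); move: h1 h2; rewrite !ltr_pdivlMr ?ltr_wpDl//.
    have : 0 <= p by exact: rnorm_ge0.
    move: p (rnorm _) (rnorm _) => p p1 p2 p0; nra.
  exists w => e e0; have [N1 N1P] := wP e e0; have [N2 N2P] := inve e e0.
  exists (s (maxn N1 N2)); last exact: N1P (leq_maxl _ _).
  by apply: lt_trans (sP _) _; apply: N2P (leq_maxr _ _).
have rel_uniq v w w' : rel v w -> rel v w' -> w = w'.
  move=> vw vw'; apply/eqP; rewrite -subr_eq0; apply/eqP/rnorm_eq0/eqP.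
  have := rel_le _ _ (relP (-1) _ _ _ _ vw' vw); rewrite !scaleN1r !(addrC (- _)) subrr.
  by rewrite rnorm0 mulr0 => w0; rewrite eq_le rnorm_ge0 w0.
have bS : S \in @bounded_op R H.
  apply/bounded_opP; split=> [a u v|]; last by exists C => // x; exact: rel_le.
  by apply: (rel_uniq (a *: u + v)) => //; exact: relP.
exists (Bop bS) => /= [i|]; last by apply: opnorm_le => // x; exact: rel_le.
apply: (rel_uniq (g i)) => // e e0; exists [:: (1, i)];
  by rewrite /lcomb big_seq1 scale1r subrr rnorm0.
Qed.

Definition in_closed_span (V : normedModType R[i]) (A : set V) (v : V) :=
  forall e : R, 0 < e -> exists2 u, lspan A u & rnorm (v - u) < e.

Lemma in_closed_span_closed (V : normedModType R[i]) (A : set V) v :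
  (forall e : R, 0 < e -> exists2 u, in_closed_span A u & rnorm (v - u) < e) ->
  in_closed_span A v.
Proof.
move=> vA e e0; have e2 : 0 < e / 2 by rewrite divr_gt0.
have [u uA vu] := vA _ e2; have [w wA uw] := uA _ e2; exists w => //.
rewrite -[v](subrK u) -addrA (le_lt_trans (rnormD _ _))// [e]splitr.
exact: ltrD.
Qed.

Lemma lspan_linear (V : lmodType R[i]) (A : set V) a u v :
  lspan A u -> lspan A v -> lspan A (a *: u + v).
Proof.
move=> [s [sA ->]] [s' [s'A ->]]; exists ([seq (a * p.1, p.2) | p <- s] ++ s').
split=> [p|].
  by rewrite mem_cat => /orP[/mapP[r /sA ? ->]|/s'A].
rewrite big_cat big_map scaler_sumr; congr (_ + _).
by apply: eq_bigr => p _; rewrite scalerA.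
Qed.

Lemma in_closed_span_linear (V : normedModType R[i]) (A : set V) a u v :
  in_closed_span A u -> in_closed_span A v -> in_closed_span A (a *: u + v).
Proof.
move=> uA vA e e0.
have a0 : 0 < rnorm (a : R[i]^o) + 1 by rewrite ltr_wpDl ?rnorm_ge0.
have [|u' u'A uu'] := uA (e / 2 / (rnorm (a : R[i]^o) + 1)); first by rewrite !divr_gt0.
have [|v' v'A vv'] := vA (e / 2); first by rewrite divr_gt0.
exists (a *: u' + v'); first exact: lspan_linear.
rewrite opprD addrACA -scalerBr (le_lt_trans (rnormD _ _))// [e]splitr.
apply: ler_ltD => //; rewrite rnormZ; move: uu'; rewrite ltr_pdivlMr// => /ltW.
by apply: le_trans; rewrite mulrC ler_wpM2l ?rnorm_ge0// lerDl.
Qed.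

Lemma lspan0 (V : lmodType R[i]) (A : set V) : lspan A 0.
Proof. by exists [::]; rewrite big_nil. Qed.

Lemma in_closed_span0 (V : normedModType R[i]) (A : set V) : in_closed_span A 0.
Proof. by move=> e e0; exists 0; rewrite ?subrr ?rnorm0//; exact: lspan0. Qed.

Lemma mem_closed_span (V : normedModType R[i]) (A : set V) v :
  A v -> in_closed_span A v.
Proof.
move=> Av e e0; exists v; last by rewrite subrr rnorm0.
exists [:: (1, v)]; rewrite big_seq1 scale1r; split=> // p.
by rewrite inE => /eqP ->.
Qed.

Lemma dense_closed_span (V : normedModType R[i]) (A : set V) :
  (forall v, in_closed_span A v) -> dense (lspan A).
Proof.
move=> VA O [v Ov]; rewrite openE => /(_ v Ov)/nbhs_ballP[_ /= /complex_gt0[e e0 ->] eO].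
have [u uA vu] := VA v e e0; exists u; split=> //.
by apply: eO; rewrite -ball_normE/= rnormE ltcR.
Qed.
End Density.

(** * Positive semidefinite kernels *)

Section Schur.
Variable R : realType.

Definition psd (I : finType) (k : I -> I -> R[i]) :=
  forall c : I -> R[i], 0 <= \sum_i \sum_j c i * Num.conj (c j) * k i j.

Lemma gram_sum (H : hilbertType R) (I : finType) (c : I -> R[i]) (x : I -> H) :
  hdot (\sum_i c i *: x i) (\sum_i c i *: x i) =
  \sum_i \sum_j c i * Num.conj (c j) * hdot (x i) (x j).
Proof.
rewrite hdot_suml; apply: eq_bigr => i _; rewrite hdot_sumr; apply: eq_bigr => j _.
by rewrite hdotZl hdotZr mulrA.
Qed.

(** The Schur product theorem with one Gram factor. Subtract from every [x i]
    its component along a nonzero vector [x i0] of the family: the sum changes by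
    a nonnegative multiple of a value of the form of [k], and [x i0] becomes zero;
    conclude by induction on the number of nonzero vectors. *)
Lemma psd_gram_pairing (H : hilbertType R) (I : finType) (k : I -> I -> R[i])
    (x : I -> H) :
  psd k -> 0 <= \sum_i \sum_j k i j * hdot (x i) (x j).
Proof.
move=> k0; have [m] := ubnP #|[pred i | x i != 0]|.
elim: m x => // m IH x xm.
have [/existsP[i0 xi0]|/existsPn x0] := boolP [exists i, x i != 0]; last first.
  rewrite big1// => i _; rewrite big1// => j _.
  by have := x0 i; rewrite negbK => /eqP->; rewrite hdot0l mulr0.
pose v := hdot (x i0) (x i0); pose a i := hdot (x i) (x i0) / v.
have v0 : 0 < v by rewrite /v hdotxx ltcR exprn_gt0// lt_def rnorm_ge0 andbT;
  apply: contra_neq xi0 => /rnorm_eq0.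
pose x' i := x i - a i *: x i0.
have av i : hdot (x i) (x i0) = a i * v by rewrite /a divfK ?gt_eqF.
have x'E i j : hdot (x i) (x j) = hdot (x' i) (x' j) + v * (a i * Num.conj (a j)).
  have avc : Num.conj (a j * v) = Num.conj (a j) * v.
    by rewrite [LHS]rmorphM; congr (_ * _); apply: geC0_conj; exact: ltW.
  rewrite /x' !(hdotBl, hdotBr, hdotZl, hdotZr) av (hdotC (x i0)) av avc -/v.
  ring.
rewrite (eq_bigr (fun i => \sum_j k i j * hdot (x' i) (x' j) +
    v * \sum_j a i * Num.conj (a j) * k i j)); last first.
  move=> i _; rewrite mulr_sumr -big_split; apply: eq_bigr => j _ /=.
  by rewrite x'E; ring.
rewrite big_split -mulr_sumr/= addr_ge0 ?mulr_ge0 ?k0 ?(ltW v0)//.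
apply: IH; move: xm; rewrite ltnS; apply: leq_trans.
apply: proper_card; apply/properP; split.
  apply/fintype.subsetP => i; rewrite !inE; apply: contra_neq.
  by rewrite /x' /a => ->; rewrite hdot0l mul0r scale0r subr0.
by exists i0; rewrite !inE// /x' /a divff ?gt_eqF// scale1r subrr eqxx.
Qed.

Lemma psd_mul_gram (H : hilbertType R) (I : finType) (k : I -> I -> R[i])
    (x : I -> H) :
  psd k -> psd (fun i j => k i j * hdot (x i) (x j)).
Proof.
move=> k0 c; have := psd_gram_pairing (fun i => c i *: x i) k0.
congr (_ <= _); apply: eq_bigr => i _; apply: eq_bigr => j _.
by rewrite hdotZl hdotZr; ring.
Qed.

Lemma psd_mul_prod_gram (J : Type) (F : J -> hilbertType R) (r : seq J) (P : pred J)
   (I : finType) (k : I -> I -> R[i]) (x : I -> forall j, F j) :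
  psd k -> psd (fun i j => k i j * \prod_(l <- r | P l) hdot (x i l) (x j l)).
Proof.
elim: r k => [|l r IH] k k0 c.
  by have := k0 c; congr (_ <= _); apply: eq_bigr => i _; apply: eq_bigr => j _;
    rewrite big_nil mulr1.
case Pl : (P l).
  have := IH _ (psd_mul_gram (fun i => x i l) k0) c.
  congr (_ <= _); apply: eq_bigr => i _; apply: eq_bigr => j _.
  by rewrite big_cons Pl !mulrA.
have := IH _ k0 c.
by congr (_ <= _); apply: eq_bigr => i _; apply: eq_bigr => j _; rewrite big_cons Pl.
Qed.

(** The kernel [C <x_i, x_j> - sum_l <B_l x_i, B_l x_j>] is positive
    semidefinite, and multiplying it by the Gram kernel [G] of the other tensor
    factors preserves this. So tensoring a column of operators with the identity
    does not increase its norm. *)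
Lemma psd_column_bound (I : finType) (L : Type) (r : seq L) (K T : hilbertType R)
    (B : L -> bop K) (C : R) (x : I -> K) (G : I -> I -> R[i])
    (f : L -> I -> T) (g : I -> T) :
  (forall z, \sum_(l <- r) rnorm (B l z) ^+ 2 <= C * rnorm z ^+ 2) ->
  (forall k, psd k -> psd (fun i j => k i j * G i j)) ->
  (forall l i j, hdot (f l i) (f l j) = hdot (B l (x i)) (B l (x j)) * G i j) ->
  (forall i j, hdot (g i) (g j) = hdot (x i) (x j) * G i j) ->
  forall c, \sum_(l <- r) rnorm (\sum_i c i *: f l i) ^+ 2 <=
    C * rnorm (\sum_i c i *: g i) ^+ 2.
Proof.
move=> BC GP fE gE c.
have /GP/(_ c) : psd (fun i j => C%:C * hdot (x i) (x j) -
    \sum_(l <- r) hdot (B l (x i)) (B l (x j))).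
  move=> d; pose z := \sum_i d i *: x i.
  have := BC z; rewrite -subr_ge0 -lecR rmorphB rmorphM rmorph_sum/= -hdotxx.
  rewrite gram_sum; under eq_bigr do rewrite -hdotxx.
  have Bz l : B l z = \sum_i d i *: B l (x i).
    by rewrite linear_sum; apply: eq_bigr => i _; rewrite linearZ.
  rewrite (eq_bigr (fun l => \sum_i \sum_j d i * Num.conj (d j) * hdot (B l (x i)) (B l (x
    j)))); last first.
    by move=> l _; rewrite Bz gram_sum.
  rewrite [X in _ - X]exchange_big/= mulr_sumr -sumrB; congr (_ <= _); apply: eq_bigr => i _.
  rewrite exchange_big/= mulr_sumr -sumrB; apply: eq_bigr => j _.
  by rewrite -mulr_sumr mulrBr mulrCA.
have -> : \sum_i \sum_j c i * Num.conj (c j) * ((C%:C * hdot (x i) (x j) -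
    \sum_(l <- r) hdot (B l (x i)) (B l (x j))) * G i j) =
  C%:C * hdot (\sum_i c i *: g i) (\sum_i c i *: g i) -
    \sum_(l <- r) hdot (\sum_i c i *: f l i) (\sum_i c i *: f l i).
  rewrite gram_sum; under [X in _ = _ - X]eq_bigr do rewrite gram_sum.
  rewrite [X in _ - X]exchange_big/= mulr_sumr -sumrB; apply: eq_bigr => i _.
  rewrite exchange_big/= mulr_sumr -sumrB; apply: eq_bigr => j _.
  rewrite gE -mulr_sumr mulrBl mulrBr mulr_suml; congr (_ - _ * _); first by ring.
  by apply: eq_bigr => l _; rewrite fE.
rewrite hdotxx (eq_bigr _ (fun l _ => hdotxx (\sum_i c i *: f l i))).
by rewrite -rmorphM -rmorph_sum -rmorphB ler0c subr_ge0.
Qed.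

Lemma lcomb_ord (V : lmodType R[i]) (J : Type) (g : J -> V) (s : seq (R[i] * J)) :
  lcomb g s = \sum_(i < size s) (tnth (in_tuple s) i).1 *: g (tnth (in_tuple s) i).2.
Proof. by rewrite /lcomb big_tnth. Qed.
End Schur.

(** * Operators on Hilbert tensor products *)

Section TensorOps.
Variables (R : realType) (K H T : hilbertType R) (t : {bilinear K -> H -> T}).
Hypothesis ht : is_tensor t.

Let tdot x y x' y' : hdot (t x y) (t x' y') = hdot x x' * hdot y y'.
Proof. by have [-> _] := ht. Qed.

Let tp (p : K * H) : T := t p.1 p.2.

Lemma tensor_dense : dense (lspan (range tp)).
Proof. by have [_] := ht. Qed.

Lemma rnorm_tensor x y : rnorm (t x y) = rnorm x * rnorm y.
Proof.
apply/eqP; rewrite -(@eqrXn2 _ 2)// ?mulr_ge0 ?rnorm_ge0//.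
by have := tdot x y x y; rewrite !hdotxx -rmorphM -exprMn => -[->].
Qed.

Lemma tensor_column_l (L : Type) (r : seq L) (B : L -> bop K) (C : R) s :
  (forall z, \sum_(l <- r) rnorm (B l z) ^+ 2 <= C * rnorm z ^+ 2) ->
  \sum_(l <- r) rnorm (lcomb (fun p => t (B l p.1) p.2) s) ^+ 2 <=
    C * rnorm (lcomb tp s) ^+ 2.
Proof.
move=> BC; pose u i := tnth (in_tuple s) i; rewrite lcomb_ord.
under eq_bigr do rewrite lcomb_ord.
apply: (@psd_column_bound _ 'I_(size s) _ r _ _ B C (fun i => (u i).2.1)
  (fun i j => hdot (u i).2.2 (u j).2.2) (fun l i => t (B l (u i).2.1) (u i).2.2)
  (fun i => tp (u i).2)) => //.
- by move=> k /psd_mul_gram; exact.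
- by move=> i j; rewrite tdot.
Qed.

Lemma tensor_column_r (L : Type) (r : seq L) (B : L -> bop H) (C : R) s :
  (forall z, \sum_(l <- r) rnorm (B l z) ^+ 2 <= C * rnorm z ^+ 2) ->
  \sum_(l <- r) rnorm (lcomb (fun p => t p.1 (B l p.2)) s) ^+ 2 <=
    C * rnorm (lcomb tp s) ^+ 2.
Proof.
move=> BC; pose u i := tnth (in_tuple s) i; rewrite lcomb_ord.
under eq_bigr do rewrite lcomb_ord.
apply: (@psd_column_bound _ 'I_(size s) _ r _ _ B C (fun i => (u i).2.2)
  (fun i j => hdot (u i).2.1 (u j).2.1) (fun l i => t (u i).2.1 (B l (u i).2.2))
  (fun i => tp (u i).2)) => //.
- by move=> k /psd_mul_gram; exact.
- by move=> l i j; rewrite tdot mulrC.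
- by move=> i j; rewrite tdot mulrC.
Qed.

(** The operator exists since the column bounds, applied to [A] on the left
    and to [B] on the right, bound it on the span of the elementary tensors. *)
Lemma tensor_opP A B x y : tensor_op t A B (t x y) = t (A x) (B y).
Proof.
have AB (s : seq (R[i] * (K * H))) : rnorm (lcomb (fun p => t (A p.1) (B p.2)) s) <=
    opnorm A * opnorm B * rnorm (lcomb tp s).
  have AA z : \sum_(l <- [:: tt]) rnorm (A z) ^+ 2 <= opnorm A ^+ 2 * rnorm z ^+ 2.
    by rewrite big_seq1 -exprMn ler_pXn2r ?nnegrE ?mulr_ge0 ?opnorm_ge0 ?rnorm_ge0 ?opnorm_ler.
  have BB z : \sum_(l <- [:: tt]) rnorm (B z) ^+ 2 <= opnorm B ^+ 2 * rnorm z ^+ 2.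
    by rewrite big_seq1 -exprMn ler_pXn2r ?nnegrE ?mulr_ge0 ?opnorm_ge0 ?rnorm_ge0 ?opnorm_ler.
  have := @tensor_column_l _ _ (fun=> A) _ [seq (p.1, (p.2.1, B p.2.2)) | p <- s] AA.
  have := @tensor_column_r _ _ (fun=> B) _ s BB.
  rewrite !big_seq1 /lcomb !big_map -!exprMn.
  rewrite !ler_pXn2r ?nnegrE ?mulr_ge0 ?opnorm_ge0 ?rnorm_ge0// => h1 h2.
  by rewrite (le_trans h2)// -mulrA ler_wpM2l ?opnorm_ge0.
have [|S SP _] := bop_extend tensor_dense _ AB; first by rewrite mulr_ge0 ?opnorm_ge0.
suff -> : tensor_op t A B = S by exact: (SP (x, y)).
apply: the_opE => [x' y'|S' S'P]; first exact: (SP (x', y')).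
apply: (bop_eq_dense tensor_dense) => _ [[x' y'] _ <-].
by rewrite /tp S'P; have /= -> := SP (x', y').
Qed.

Lemma tensor_op_unique (A : bop K) (B : bop H) (S : bop T) :
  (forall x y, S (t x y) = t (A x) (B y)) -> tensor_op t A B = S.
Proof.
move=> SP; apply: (bop_eq_dense tensor_dense) => _ [[x y] _ <-].
by rewrite /tp tensor_opP SP.
Qed.

Lemma tensor_op_linearl a A A' B :
  tensor_op t (a *: A + A') B = a *: tensor_op t A B + tensor_op t A' B.
Proof.
apply: tensor_op_unique => x y.
by rewrite !bopDE !bopZE !tensor_opP linearPl.
Qed.

Lemma tensor_opZr a A B : tensor_op t A (a *: B) = a *: tensor_op t A B.
Proof.
by apply: tensor_op_unique => x y; rewrite !bopZE !tensor_opP linearZr_LR.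
Qed.

Lemma tensor_op0l B : tensor_op t 0 B = 0.
Proof. by apply: tensor_op_unique => x y; rewrite linear0l. Qed.

Lemma tensor_opM A B A' B' :
  tensor_op t A B * tensor_op t A' B' = tensor_op t (A * A') (B * B').
Proof.
by apply/esym/tensor_op_unique => x y; rewrite !bopE !tensor_opP.
Qed.
End TensorOps.

Section RowColumn.
Variable R : realType.

Lemma sum_cauchy_schwarz (L : Type) (r : seq L) (x y : L -> R) :
  (\sum_(l <- r) x l * y l) ^+ 2 <=
  (\sum_(l <- r) x l ^+ 2) * (\sum_(l <- r) y l ^+ 2).
Proof.
elim: r => [|l r IH]; first by rewrite !big_nil expr0n mul0r.
rewrite !big_cons; move: IH; set S := \sum_(_ <- _) _ * _.
set X := \sum_(_ <- _) _ ^+ 2; set Y := \sum_(_ <- _) _ ^+ 2 => SXY.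
have X0 : 0 <= X by apply: sumr_ge0 => i _; exact: sqr_ge0.
have Y0 : 0 <= Y by apply: sumr_ge0 => i _; exact: sqr_ge0.
suff h : 2 * (x l * y l * S) <= x l ^+ 2 * Y + y l ^+ 2 * X.
  by rewrite sqrrD mulrDl !mulrDr exprMn; lra.
have h0 : 0 <= x l ^+ 2 * Y + y l ^+ 2 * X.
  by apply: addr_ge0; apply: mulr_ge0 => //; exact: sqr_ge0.
have [/le_trans->//|h1] := leP (2 * (x l * y l * S)) 0.
rewrite -(@ler_pXn2r _ 2) ?nnegrE ?(ltW h1)//.
have h2 := sqr_ge0 (x l ^+ 2 * Y - y l ^+ 2 * X).
have h3 : (x l * y l) ^+ 2 * S ^+ 2 <= (x l * y l) ^+ 2 * (X * Y).
  by rewrite ler_wpM2l// sqr_ge0.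
by rewrite !exprMn in h3 *; lra.
Qed.

(** Test [x] against vectors close to [x] itself. *)
Lemma rnorm_le_dense (H : hilbertType R) (A : set H) (x : H) (M : R) :
  dense A -> 0 <= M ->
  (forall w, A w -> rnorm (hdot x w : R[i]^o) <= M * rnorm w) -> rnorm x <= M.
Proof.
move=> dA M0 xM; have [->//|x0] := eqVneq (rnorm x) 0.
have xp : 0 < rnorm x by rewrite lt_def x0 rnorm_ge0.
rewrite -subr_le0 -(pmulr_rle0 _ xp) mulrBr.
apply: (@le0_eps _ _ (M + rnorm x)) => [|e e0]; first by rewrite addr_ge0 ?rnorm_ge0.
have [w Aw xw] := dense_approx x dA e0.
have -> : rnorm x * rnorm x = complex.Re (hdot x w) + complex.Re (hdot x (x - w)).
  by rewrite hdotBr -raddfD/= addrC subrK hdotxx/= expr2.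
have h1 := le_trans (@Re_rnorm _ (hdot x w)) (xM _ Aw).
have h2 := le_trans (@Re_rnorm _ (hdot x (x - w))) (cauchy_schwarz _ _).
have h3 : rnorm w <= rnorm x + e.
  have -> : w = x - (x - w) by rewrite opprB addrC subrK.
  by rewrite (le_trans (rnormD _ _))// rnormN lerD2l ltW.
have h4 : M * rnorm w <= M * (rnorm x + e) by rewrite ler_wpM2l.
have h5 : rnorm x * rnorm (x - w) <= rnorm x * e by rewrite ler_wpM2l// ltW.
lra.
Qed.

Lemma opnorm_le_dense (H : hilbertType R) (A : set H) (S : bop H) (M : R) :
  dense A -> 0 <= M -> (forall v, A v -> rnorm (S v) <= M * rnorm v) ->
  opnorm S <= M.
Proof.
move=> dA M0 SM; apply: opnorm_le => // v; rewrite -subr_le0.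
apply: (@le0_eps _ _ (opnorm S + M)) => [|e e0]; first by rewrite addr_ge0 ?opnorm_ge0.
have [u Au vu] := dense_approx v dA e0.
have h1 : rnorm (S v) <= rnorm (S u) + opnorm S * e.
  have {1}-> : v = u + (v - u) by rewrite addrC subrK.
  rewrite linearD (le_trans (rnormD _ _))// lerD2l (le_trans (opnorm_ler _ _))//.
  by rewrite ler_wpM2l ?opnorm_ge0 ?ltW.
have h2 : rnorm u <= rnorm v + e.
  have -> : u = v - (v - u) by rewrite opprB addrC subrK.
  by rewrite (le_trans (rnormD _ _))// rnormN lerD2l ltW.
have h3 : M * rnorm u <= M * (rnorm v + e) by rewrite ler_wpM2l.
have := SM u Au; lra.
Qed.

(** Moving [Y_l] to the other side, the matrix entries of the sum are
    [sum_l <(A_l (x) 1) v, (1 (x) Y_l^ * ) w>]. Cauchy-Schwarz over [l] then only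
    involves the column of the [A_l] and that of the [Y_l^ *]. *)
Lemma tensor_row_column (K H T : hilbertType R) (t : {bilinear K -> H -> T})
    (L : Type) (r : seq L) (A : L -> bop K) (Y : L -> bop H) (C D : R) :
  is_tensor t -> 0 <= C -> 0 <= D ->
  (forall x, \sum_(l <- r) rnorm (A l x) ^+ 2 <= C ^+ 2 * rnorm x ^+ 2) ->
  (forall z, \sum_(l <- r) rnorm (adjoint (Y l) z) ^+ 2 <= D ^+ 2 * rnorm z ^+ 2) ->
  opnorm (\sum_(l <- r) tensor_op t (A l) (Y l)) <= C * D.
Proof.
move=> ht C0 D0 AC YD.
apply: (opnorm_le_dense (tensor_dense ht)) => [|_ /lspan_range[s ->]].
  exact: mulr_ge0.
apply: (rnorm_le_dense (tensor_dense ht)) => [|_ /lspan_range[s' ->]].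
  by rewrite !mulr_ge0 ?rnorm_ge0.
set v := lcomb _ s; set w := lcomb _ s'.
pose u l := lcomb (fun p => t (A l p.1) p.2) s.
pose z l := lcomb (fun p => t p.1 (adjoint (Y l) p.2)) s'.
have -> : hdot ((\sum_(l <- r) tensor_op t (A l) (Y l)) v) w =
    \sum_(l <- r) hdot (u l) (z l).
  rewrite bop_sumE hdot_suml; apply: eq_bigr => l _.
  rewrite /v /u /lcomb (linear_sum (tensor_op t (A l) (Y l))) !hdot_suml.
  apply: eq_bigr => p _.
  rewrite linearZ/= tensor_opP// hdotZl hdotZl; congr (_ * _).
  rewrite /w /z /lcomb !hdot_sumr; apply: eq_bigr => p' _.
  by rewrite !hdotZr; congr (_ * _); have [td _] := ht; rewrite !td (adjointP (Y l)).
apply: (le_trans (rnorm_sum _ _ _)).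
apply: (@le_trans _ _ (\sum_(l <- r) rnorm (u l) * rnorm (z l))).
  by apply: ler_sum => l _; exact: cauchy_schwarz.
rewrite -(@ler_pXn2r _ 2) ?nnegrE ?mulr_ge0 ?rnorm_ge0//; last first.
  by apply: sumr_ge0 => l _; rewrite mulr_ge0 ?rnorm_ge0.
apply: (le_trans (sum_cauchy_schwarz _ _ _)).
have := tensor_column_l ht s AC; have := tensor_column_r ht s' YD.
rewrite -/v -/w => hw hv.
have -> : (C * D * rnorm v * rnorm w) ^+ 2 =
  (C ^+ 2 * rnorm v ^+ 2) * (D ^+ 2 * rnorm w ^+ 2) by ring.
by rewrite ler_pM//; apply: sumr_ge0 => l _; exact: sqr_ge0.
Qed.
End RowColumn.

(** * Unordered sums of operators *)

Section Convergence.
Variables (R : realType) (H : hilbertType R).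

Lemma rnorm_bop (T : bop H) : rnorm T = opnorm T.
Proof. exact: rnorm_def. Qed.

(** A Cauchy filter converges pointwise, as the space is complete; the
    Cauchy bounds are uniform on bounded sets, so they pass to the pointwise
    limit. *)
Lemma bop_complete (F : set_system (bop H)) : ProperFilter F -> cauchy F -> cvg F.
Proof.
move=> FF /cauchy_rnorm Fc.
have limF x : exists y : H, (fun S : bop H => S x) @ F --> y.
  have FxF : ProperFilter ((fun S : bop H => S x) @ F) by exact: fmap_proper_filter.
  apply/cvg_ex; apply: cauchy_cvg; apply/cauchy_rnorm => e e0.
  have x1 : 0 < rnorm x + 1 by rewrite ltr_wpDl ?rnorm_ge0.
  have [A FA Ae] := Fc _ (divr_gt0 e0 x1).
  exists ((fun S : bop H => S x) @` A).
    suff : F ((fun S : bop H => S x) @^-1` ((fun S : bop H => S x) @` A)) by [].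
    by apply: filterS FA => S AS; exists S.
  move=> _ _ [S AS <-] [S' AS' <-]; rewrite -bopBE (le_lt_trans (opnorm_ler _ _))//.
  have := Ae _ _ AS AS'; rewrite rnorm_bop ltr_pdivlMr//; apply: le_lt_trans.
  by rewrite ler_wpM2l ?opnorm_ge0// lerDl.
have [L LP] := @boolp.choice _ _ (fun x y => (fun S : bop H => S x) @ F --> y) limF.
have Lle A e S x : F A -> (forall S S', A S -> A S' -> rnorm (S - S') < e) -> A S ->
    rnorm (L x - S x) <= e * rnorm x.
  move=> FA Ae AS; rewrite -subr_le0; apply: (@le0_eps _ _ 1) => // d d0.
  have /cvg_rnormP/(_ d d0) Fd := LP x.
  have {}Fd : F [set S' : bop H | rnorm (L x - S' x) < d] by [].
  have [S' [AS' /= S'd]] := filter_ex (filterI FA Fd).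
  have -> : L x - S x = (L x - S' x) + (S' - S) x by rewrite bopBE subrKA.
  rewrite mul1r lerBlDr (le_trans (rnormD _ _))// lerD ?(ltW S'd)//.
  rewrite (le_trans (opnorm_ler _ _))// ler_wpM2r ?rnorm_ge0//.
  by rewrite -rnorm_bop ltW// Ae.
have bL : L \in @bounded_op R H.
  apply/bounded_opP; split=> [a u v|].
    have := LP (a *: u + v).
    have -> : (fun S : bop H => S (a *: u + v)) = (fun S : bop H => a *: S u + S v).
      by apply/funext => S; rewrite linearP.
    have : (fun S : bop H => a *: S u + S v) @ F --> a *: L u + L v.
      by apply: cvgD; [apply: cvgZr|]; exact: LP.
    by move=> h1 h2; apply: (cvg_unique _ h2 h1).
  have [A FA A1] := Fc 1 ltr01; have [S AS] := filter_ex FA.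
  exists (1 + opnorm S) => [|x]; first by rewrite addr_ge0 ?opnorm_ge0.
  have -> : L x = (L x - S x) + S x by rewrite subrK.
  by rewrite (le_trans (rnormD _ _))// mulrDl lerD ?opnorm_ler// (Lle A).
apply/cvg_ex; exists (Bop bL); apply/cvg_rnormP => e e0.
have e2 : 0 < e / 2 by rewrite divr_gt0.
have [A FA Ae] := Fc _ e2; apply: filterS (FA) => S AS /=.
rewrite rnorm_bop; apply: (@le_lt_trans _ _ (e / 2)); last by lra.
by apply: opnorm_le => [|x]; [exact: ltW|rewrite bopBE; exact: (Lle A)].
Qed.

Variable I : choiceType.

Lemma partial_sumE (f : I -> bop H) (J : {fset I}) :
  partial_sum f J = \sum_(i <- J) f i.
Proof. by rewrite /partial_sum big_seq_fsetE. Qed.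

Lemma totally_ge (J : {fset I}) : totally [set J' : {fset I} | fsubset J J'].
Proof. by exists J. Qed.

(** The sums of norms over finite sets have a supremum; past a finite set where
    they are within [e / 2] of it, partial sums move by less than [e / 2]. *)
Lemma abs_summable_cvg (f : I -> bop H) (B : R) :
  (forall J : {fset I}, \sum_(i <- J) opnorm (f i) <= B) ->
  cvg (partial_sum f @ totally).
Proof.
move=> fB; have FT := @totally_filter I.
have FF : ProperFilter (partial_sum f @ totally) by exact: fmap_proper_filter.
apply: bop_complete; apply/cauchy_rnorm => e e0.
pose g (J : {fset I}) := \sum_(i <- J) opnorm (f i).
have gsup : has_sup (range g).
  by split; [exists (g fset0); exists fset0|exists B => _ [J _ <-]; exact: fB].
have e2 : 0 < e / 2 by rewrite divr_gt0.
have [_ [J0 _ <-] J0P] := sup_adherent e2 gsup.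
have near_J0 J : fsubset J0 J -> rnorm (partial_sum f J - partial_sum f J0) < e / 2.
  move=> J0J; rewrite !partial_sumE.
  have split_sum (V : nmodType) (h : I -> V) :
      \sum_(i <- J) h i = \sum_(i <- J0) h i + \sum_(i <- fsetD J J0) h i.
    rewrite (big_fsetID _ (mem J0))/=; congr (_ + _).
      apply: perm_big; apply: uniq_perm; rewrite ?fset_uniq// => i.
      rewrite !inE/= andbC; apply/andb_idr; apply: (fsubsetP J0J).
    apply: perm_big; apply: uniq_perm; rewrite ?fset_uniq// => i.
    by rewrite !inE/= andbC.
  rewrite split_sum addrC addKr (le_lt_trans (rnorm_sum _ _ _))//.
  under eq_bigr do rewrite rnorm_bop.
  have : g J <= sup (range g) by apply: ub_le_sup; [case: gsup|exists J].
  by move: J0P; rewrite /g split_sum; lra.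
exists [set partial_sum f J | J in [set J | fsubset J0 J]].
  suff : totally (partial_sum f @^-1` [set partial_sum f J | J in [set J | fsubset J0 J]])
    by [].
  by apply: filterS (totally_ge J0) => J J0J; exists J.
move=> _ _ [J J0J <-] [J' J0J' <-].
have -> : partial_sum f J - partial_sum f J' =
    (partial_sum f J - partial_sum f J0) - (partial_sum f J' - partial_sum f J0).
  by rewrite opprB addrA subrK.
rewrite (le_lt_trans (rnormD _ _))// rnormN [e]splitr.
by apply: ltrD; exact: near_J0.
Qed.

Lemma cvg_partial_sum_linear (a : R[i]) (f g : I -> bop H) :
  cvg (partial_sum f @ totally) -> cvg (partial_sum g @ totally) ->
  cvg (partial_sum (fun i => a *: f i + g i) @ totally).
Proof.
have FT := @totally_filter I; move=> cf cg.
rewrite (_ : partial_sum _ = fun J => a *: partial_sum f J + partial_sum g J).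
  by apply: is_cvgD => //; apply: is_cvgZl_tmp.
by apply/funext => J; rewrite !partial_sumE big_split -scaler_sumr.
Qed.

(** Outside of some finite set each term is the difference of two partial
    sums that are close to the limit. *)
Lemma cvg_partial_sum_bounded (f : I -> bop H) :
  cvg (partial_sum f @ totally) -> exists2 M, 0 <= M & forall i, opnorm (f i) <= M.
Proof.
have FT := @totally_filter I.
move=> /cvg_ex[l /cvg_rnormP/(_ _ ltr01)[J0 _ J0P]].
exists (\sum_(i <- J0) opnorm (f i) + 2) => [|i].
  by rewrite addr_ge0// sumr_ge0// => i _; exact: opnorm_ge0.
have [iJ|iJ] := boolP (i \in J0).
  rewrite (big_fsetD1 i)//= -addrA lerDl addr_ge0// sumr_ge0// => j _.
  exact: opnorm_ge0.
have -> : f i = (l - partial_sum f J0) - (l - partial_sum f (fsetU (fset1 i) J0)).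
  by rewrite opprB addrC subrKA !partial_sumE big_fsetU1//= addrK.
rewrite -rnorm_bop (le_trans (rnormD _ _))// rnormN.
have h1 := J0P J0 (fsubset_refl _).
have h2 := J0P _ (fsubsetUr (fset1 i) J0).
have : 0 <= \sum_(i <- J0) opnorm (f i) by rewrite sumr_ge0// => j _; exact: opnorm_ge0.
by move: h1 h2 => /=; lra.
Qed.
End Convergence.

(** * Factorizations of words and the weights of the model *)

Section Factorizations.
Variables (R : realType) (m : nat) (q : {fsfun seq 'I_m -> R with 0}).
Implicit Types (w v : seq 'I_m).

(** The factorizations of [w] into nonempty words; [d] bounds the recursion
    depth, and the list is complete as soon as [size w <= d]. *)
Fixpoint factorizations (d : nat) (T : eqType) (w : seq T) : seq (seq (seq T)) :=
  if w is [::] then [:: [::]] else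
  if d is d'.+1 then
    flatten [seq [seq take j w :: s | s <- factorizations d' (drop j w)] |
      j <- iota 1 (size w)]
  else [::].

Lemma factorizationsS d (T : eqType) (w : seq T) : w != [::] ->
  factorizations d.+1 w =
  flatten [seq [seq take j w :: s | s <- factorizations d (drop j w)] |
    j <- iota 1 (size w)].
Proof. by case: w. Qed.

Lemma mem_factorizations d w s : (size w <= d)%N ->
  (s \in factorizations d w) = (flatten s == w) && ([::] \notin s).
Proof.
have nil0 (s' : seq (seq 'I_m)) :
    (s' \in [:: [::]]) = (flatten s' == [::]) && ([::] \notin s').
  by case: s' => [|[|b v] s'] //=; rewrite !inE ?eqxx ?andbF.
elim: d w s => [|d IH] [|a w] s wd; rewrite ?nil0 //.
rewrite factorizationsS//; have : a :: w != [::] by [].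
move: (a :: w) wd => {a} {}w wd w0.
apply/flatten_mapP/idP => [[j]|].
  rewrite mem_iota add1n ltnS => /andP[j1 jw] /mapP[s' s'P ->].
  move: s'P; rewrite IH; last first.
    by rewrite size_drop leq_subLR (leq_trans wd)// -add1n leq_add2r.
  move=> /andP[/eqP fs' ns']; rewrite /= fs' cat_take_drop eqxx/= in_cons negb_or ns' andbT.
  by rewrite eq_sym -size_eq0 size_takel// -lt0n.
case: s => [|v s] /=; first by rewrite eq_sym (negbTE w0).
rewrite in_cons negb_or => /andP[/eqP vs /andP[v0 ns]].
have v1 : (0 < size v)%N by rewrite lt0n size_eq0 eq_sym.
exists (size v); first by rewrite mem_iota v1 add1n ltnS -vs size_cat leq_addr.
apply/mapP; exists s; last by rewrite -vs take_size_cat.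
rewrite IH -vs ?drop_size_cat// ?eqxx//.
move: wd; rewrite -vs size_cat => h; rewrite -ltnS (leq_trans _ h)//.
by rewrite -[X in (X < _)%N]add0n ltn_add2r.
Qed.

Lemma uniq_factorizations d w : uniq (factorizations d w).
Proof.
elim: d w => [|d IH] [|a w] //; rewrite factorizationsS//; set w' := a :: w.
apply: (allpairs_uniq_dep (s := iota 1 (size w'))
  (t := fun j => factorizations d (drop j w')) (f := fun j s => take j w' :: s)).
- exact: iota_uniq.
- by move=> j _; exact: IH.
move=> [i s] [j s'] /allpairsPdep[i' [s1 [ri _ [ei _]]]] /allpairsPdep[j' [s2 [rj _ [ej _]]]].
rewrite /=; move: ri rj; rewrite -ei -ej !mem_iota add1n !ltnS => /andP[_ iw] /andP[_ jw].
move=> [tij ss']; have ij : i = j.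
  by rewrite -(size_takel iw) -(size_takel jw) tij.
by rewrite ss' ij.
Qed.

(** In [b_coef] the factorizations are grouped by their number of factors, which
    lies between 1 and the length of [w]. *)
Lemma b_coefE d w : (size w <= d)%N ->
  b_coef q w = \sum_(s <- factorizations d w) \prod_(v <- s) q v.
Proof.
case: w => [|a w] wd.
  by case: d wd => [|d] _; rewrite big_seq1 big_nil.
rewrite /b_coef; set w' := a :: w in wd *.
transitivity (\sum_(1 <= p < (size w').+1) \sum_(s <- factorizations d w' | size s == p)
    \prod_(v <- s) q v).
  apply: eq_bigr => p _.
  pose P := [pred s : seq (seq 'I_m) |
    [&& size s == p, flatten s == w' & [::] \notin s]].
  have -> : [set s | [/\ size s = p, flatten s = w' & [::] \notin s]] = [set` P].
    apply/seteqP; split=> s /=.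
      by move=> [/eqP sp /eqP sw ns]; apply/and3P.
    by move=> /and3P[/eqP-> /eqP-> ->].
  rewrite -(@bigfs _ _ _ _ (factorizations d w')) ?uniq_factorizations//.
    rewrite [LHS]big_seq_cond [RHS]big_seq_cond; apply: eq_bigl => s.
    by rewrite /= mem_factorizations// andbCA !andbA; case: (size s == p);
      rewrite ?andbT ?andbF//= -!andbA andbA andbb.
  by move=> s /and3P[_ sw ns]; rewrite mem_factorizations// sw ns.
under eq_bigr do rewrite big_mkcond.
rewrite exchange_big/=; apply: eq_big_seq => s;
  rewrite mem_factorizations// => /andP[/eqP sw ns].
have sw' : (0 < size s < (size w').+1)%N.
  rewrite ltnS -sw lt0n size_eq0; apply/andP; split.
    by apply: contraTneq isT => s0; move: sw; rewrite s0.
  elim: s ns {sw} => //= v s IH; rewrite in_cons negb_or eq_sym => /andP[v0 /IH].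
  by rewrite size_cat -add1n; apply: leq_add; rewrite lt0n size_eq0.
rewrite (bigD1_seq (size s)) ?mem_index_iota ?iota_uniq//= eqxx.
rewrite [X in _ + X]big1 ?addr0// => p.
by rewrite eq_sym => /negbTE ->.
Qed.

(** Split off the first factor of each factorization. *)
Lemma b_coef_rec w : w != [::] ->
  b_coef q w = \sum_(1 <= j < (size w).+1) q (take j w) * b_coef q (drop j w).
Proof.
case: w => [//|a w] _; rewrite (b_coefE (leqnn _)) [size _]/= factorizationsS//.
rewrite big_flatten big_map /index_iota subSS subn0; apply: eq_big_seq => j.
rewrite mem_iota => /andP[j0 _].
rewrite (@b_coefE (size w)); last by rewrite size_drop/= leq_subLR -add1n leq_add2r.
by rewrite big_map mulr_sumr; apply: eq_bigr => s _; rewrite big_cons.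
Qed.

Hypothesis qP : positive_regular q.

Lemma b_coef_nil : b_coef q [::] = 1. Proof. by []. Qed.

Lemma b_coef_ge0 w : 0 <= b_coef q w.
Proof.
have [q0 _ _] := qP; rewrite (b_coefE (leqnn _)); apply: sumr_ge0 => s _.
exact: prodr_ge0.
Qed.

(** Keep the factorizations whose first factor is the letter [j]. This is what
    makes the weighted shifts bounded. *)
Lemma b_coef_cons j w : q [:: j] * b_coef q w <= b_coef q (j :: w).
Proof.
have [q0 _ _] := qP.
rewrite [leRHS]b_coef_rec// big_ltn//= take0 drop0 lerDl; apply: sumr_ge0 => i _.
by rewrite mulr_ge0// b_coef_ge0.
Qed.

Lemma b_coef_gt0 w : 0 < b_coef q w.
Proof.
have [_ _ q1] := qP; elim: w => [|j w IH]; first by rewrite b_coef_nil.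
by apply: lt_le_trans (b_coef_cons j w); exact: mulr_gt0.
Qed.
End Factorizations.

(** * Row contractions along words *)

Section WordSums.
Variable m : nat.

Fixpoint words (p : nat) : seq (seq 'I_m) :=
  if p is p'.+1 then [seq i :: w | i <- enum 'I_m, w <- words p'] else [:: [::]].

Lemma mem_words p w : (w \in words p) = (size w == p).
Proof.
elim: p w => [|p IH] w; first by rewrite inE -size_eq0.
apply/allpairsP/idP => [[[a b] /= [_ bp ->]]|]; first by rewrite /= eqSS -IH.
by case: w => // i w; rewrite /= eqSS -IH => wp; exists (i, w); rewrite mem_enum.
Qed.

Lemma uniq_words p : uniq (words p).
Proof.
elim: p => [|p IH] //=; apply: allpairs_uniq; rewrite ?enum_uniq//.
by move=> [a b] [a' b'] _ _ /= [-> ->].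
Qed.

Lemma big_words_cat (V : nmodType) (F : seq 'I_m -> V) j p :
  \sum_(w <- words (j + p)) F w =
  \sum_(u <- words j) \sum_(v <- words p) F (u ++ v).
Proof.
elim: j F => [|j IH] F; first by rewrite big_seq1.
rewrite addSn /= !big_allpairs_dep; apply: eq_bigr => i _.
by rewrite (IH (fun w => F (i :: w))).
Qed.
End WordSums.

Lemma ler_sum_uniq (R : realType) (T : eqType) (s t : seq T) (g : T -> R) :
  uniq s -> uniq t -> (forall u, 0 <= g u) -> (forall u, u \in s -> u \notin t -> g u = 0) ->
  \sum_(u <- s) g u <= \sum_(u <- t) g u.
Proof.
move=> us ut g0 gt.
have -> : \sum_(u <- s) g u = \sum_(u <- t | u \in s) g u.
  rewrite (bigID (mem t))/= addrC big1_seq ?add0r; last by move=> u /andP[ut' us']; exact: gt.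
  rewrite -[LHS]big_filter -[RHS]big_filter; apply: perm_big; apply: uniq_perm;
    rewrite ?filter_uniq// => u.
  by rewrite !mem_filter andbC.
by rewrite [leRHS](bigID (mem s))/= lerDl sumr_ge0.
Qed.

Section WordOperators.
Variables (R : realType) (H : hilbertType R).

Lemma wordop_cat m (Y : 'I_m -> bop H) u v :
  wordop Y (u ++ v) = wordop Y u * wordop Y v.
Proof. exact: big_cat. Qed.

(** By the recursion for [b], the sum over words of length [p] is
    [sum_u q_u S_(p - |u|)(Y_u^ * z)], where [S_j] is the sum for length [j] and [u]
    runs over the words of length 1 to [p]. By induction this is at most
    [sum_u q_u |Y_u^ * z|^2 <= |z|^2]. *)
Lemma words_contraction m (q : {fsfun seq 'I_m -> R with 0}) (Y : 'I_m -> bop H) :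
  positive_regular q ->
  (forall z, \sum_(w <- finsupp q) q w * rnorm (adjoint (wordop Y w) z) ^+ 2 <=
     rnorm z ^+ 2) ->
  forall p z, \sum_(w <- words m p) b_coef q w * rnorm (adjoint (wordop Y w) z) ^+ 2 <=
     rnorm z ^+ 2.
Proof.
move=> qP Y1 p; have [q0 qnil _] := qP.
have [n] := ubnP p; elim: n p => // n IH [|p] pn z.
  by rewrite big_seq1 b_coef_nil mul1r /wordop big_nil adjoint1.
have : (0 < p.+1)%N by []; move: p.+1 pn => {}p pn p0.
pose g w := q w * rnorm (adjoint (wordop Y w) z) ^+ 2.
have g0 w : 0 <= g w by rewrite mulr_ge0// sqr_ge0.
apply: le_trans (Y1 z).
apply: (@le_trans _ _ (\sum_(w <- [seq w | j <- iota 1 p, w <- words m j]) g w)); last first.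
  apply: ler_sum_uniq => //.
  - apply: allpairs_uniq_dep; [exact: iota_uniq|by move=> j _; exact: uniq_words|].
    move=> _ _ /allpairsPdep[i [u [_ + ->]]] /allpairsPdep[j [v [_ + ->]]] /= uv.
    by rewrite !mem_words uv => /eqP <- /eqP <-.
  - exact: fset_uniq.
  - by move=> u _ /fsfun_dflt; rewrite /g => ->; rewrite mul0r.
rewrite [leRHS]big_allpairs_dep.
have -> : \sum_(w <- words m p) b_coef q w * rnorm (adjoint (wordop Y w) z) ^+ 2 =
  \sum_(j <- iota 1 p) \sum_(w <- words m p)
    q (take j w) * b_coef q (drop j w) * rnorm (adjoint (wordop Y w) z) ^+ 2.
  rewrite exchange_big/=; apply: eq_big_seq => w; rewrite mem_words => /eqP wp.
  rewrite b_coef_rec -?size_eq0 ?wp -?lt0n// mulr_suml /index_iota subSS subn0.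
  by [].
rewrite big_seq [leRHS]big_seq; apply: ler_sum => j;
  rewrite mem_iota add1n !ltnS => /andP[j0 jp].
rewrite -[in leLHS](subnKC jp) big_words_cat !big_seq; apply: ler_sum => u.
rewrite mem_words => /eqP uj.
rewrite (eq_bigr (fun v => q u * (b_coef q v * rnorm (adjoint (wordop Y v) (adjoint (wordop
  Y u) z)) ^+ 2))).
  rewrite -mulr_sumr /g ler_wpM2l// IH//.
  by rewrite -ltnS (leq_trans _ pn)// ltnS ltn_subrL j0 p0.
move=> v _; rewrite -uj take_size_cat// drop_size_cat// wordop_cat adjointM bopE.
by rewrite mulrA.
Qed.
End WordOperators.

Section MultiWords.
Variables (k : nat) (n : 'I_k -> nat).
Implicit Types (w v : mword n).

Definition mdegree w : {ffun 'I_k -> nat} := [ffun i => size (w i)].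

Definition set_coord w (i : 'I_k) (u : seq 'I_(n i)) : mword n := [ffun j => dfwith w i u j].

Lemma set_coordE w i (u : seq 'I_(n i)) : set_coord w u i = u.
Proof. by rewrite ffunE dfwithin. Qed.

Lemma set_coordNE w i (u : seq 'I_(n i)) j : i != j -> set_coord w u j = w j.
Proof. by move=> ij; rewrite ffunE dfwithout. Qed.

(** The words of [Lambda p] when [r] lists all indices. A smaller [r] leaves
    the other components empty, which allows an induction on the set of indices. *)
Fixpoint degree_words (p : 'I_k -> nat) (r : seq 'I_k) : seq (mword n) :=
  if r is i :: r' then [seq set_coord w u | w <- degree_words p r', u <- words (n i) (p i)]
  else [:: mnil n].

Lemma mem_degree_words p r w : uniq r ->
  (w \in degree_words p r) = [forall i, size (w i) == (if i \in r then p i else 0)%N].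
Proof.
elim: r w => [|i r IH] w /=.
  rewrite inE => _; apply/eqP/forallP => [-> j|w0]; first by rewrite ffunE.
  by apply/ffunP => j; rewrite ffunE; apply/eqP; rewrite -size_eq0; exact: w0.
move=> /andP[ir ur]; apply/allpairsPdep/forallP => [[v [u [+ + ->]]] j|wP].
  rewrite IH// mem_words => /forallP vP up.
  have [<-|ij] := eqVneq i j; first by rewrite set_coordE mem_head.
  by rewrite set_coordNE// (eqP (vP j)) in_cons [j == i]eq_sym (negbTE ij).
exists (set_coord w [::] (i := i)), (w i); rewrite mem_words IH//; split.
- apply/forallP => j; have [<-|ij] := eqVneq i j; first by rewrite set_coordE (negbTE ir).
  by rewrite set_coordNE//; have := wP j; rewrite in_cons [j == i]eq_sym (negbTE ij).
- by have := wP i; rewrite mem_head.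
apply/ffunP => j; have [ij|ij] := eqVneq i j; last by rewrite !set_coordNE.
by subst j; rewrite set_coordE.
Qed.

Lemma uniq_degree_words p r : uniq r -> uniq (degree_words p r).
Proof.
elim: r => //= i r IH /andP[ir ur]; apply: allpairs_uniq; rewrite ?IH ?uniq_words//.
move=> _ _ /allpairsP[[v u] [/= + _ ->]] /allpairsP[[v' u'] [/= + _ ->]] /= e.
rewrite !mem_degree_words// => /forallP/(_ i) + /forallP/(_ i).
rewrite (negbTE ir) !size_eq0 => /eqP vi /eqP vi'; congr (_, _).
  apply/ffunP => j; have [<-|ij] := eqVneq i j; first by rewrite vi vi'.
  by have := congr1 (fun f : mword n => f j) e; rewrite !set_coordNE.
by have := congr1 (fun f : mword n => f i) e; rewrite !set_coordE.
Qed.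

Lemma fsbig_seqE (V : nmodType) (T : choiceType) (A : set T) (r : seq T) (F : T -> V) :
  uniq r -> (forall x, A x <-> x \in r) -> \sum_(x \in A) F x = \sum_(x <- r) F x.
Proof.
move=> ur Ar; rewrite [RHS]fsbig_seq//; apply: eq_fsbigl.
by apply/seteqP; split => x; rewrite Ar.
Qed.

Lemma LambdaE (V : nmodType) (p : {ffun 'I_k -> nat}) (F : mword n -> V) :
  \sum_(w \in Lambda p) F w = \sum_(w <- degree_words p (index_enum 'I_k)) F w.
Proof.
apply: fsbig_seqE => [|w]; first exact/uniq_degree_words/index_enum_uniq.
rewrite mem_degree_words ?index_enum_uniq//; split=> [wp|/forallP wp i].
  by apply/forallP => i; rewrite mem_index_enum wp.
by have := wp i; rewrite mem_index_enum => /eqP.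
Qed.

Lemma LambdaP (p : {ffun 'I_k -> nat}) w : Lambda p w <-> mdegree w = p.
Proof.
split=> [wp|<- i]; last by rewrite ffunE.
by apply/ffunP => i; rewrite ffunE wp.
Qed.

Lemma Lambda_mwordsE (V : nmodType) (p : {ffun 'I_k -> nat}) m (F : mword n -> V) :
  (forall i, p i <= m)%N ->
  \sum_(w \in Lambda p) F w = \sum_(w <- mwords n m | mdegree w == p) F w.
Proof.
move=> pm; rewrite -[RHS]big_filter; apply: fsbig_seqE => [|w].
  by rewrite filter_uniq// undup_uniq.
rewrite mem_filter mem_mwords LambdaP; split=> [wp|/andP[/eqP]//].
by rewrite wp eqxx; apply/forallP => i; move: (pm i); rewrite -wp ffunE.
Qed.
End MultiWords.

Section MultiContraction.
Variables (R : realType) (k : nat) (n : 'I_k -> nat).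
Variables (q : forall i, {fsfun seq 'I_(n i) -> R with 0}).
Hypothesis qP : forall i, positive_regular (q i).

Definition mb_coef (w : mword n) : R := \prod_(i < k) b_coef (q i) (w i).

Lemma mb_coef_gt0 w : 0 < mb_coef w.
Proof. by apply: prodr_gt0 => i _; exact: b_coef_gt0. Qed.

(** The adjoint of [Y_w] applies the adjoints of the factors one after the
    other, in the order of the indices; so the sum is bounded one index at a
    time. *)
Lemma degree_contraction (H : hilbertType R) (Y : optuple n H) :
  (forall i z, \sum_(w <- finsupp (q i)) q i w *
     rnorm (adjoint (wordop (Y i) w) z) ^+ 2 <= rnorm z ^+ 2) ->
  forall (p : {ffun 'I_k -> nat}) z,
  \sum_(w <- degree_words n p (index_enum 'I_k)) mb_coef w * rnorm (adjoint (mwordop Y w)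
    z) ^+ 2
    <= rnorm z ^+ 2.
Proof.
move=> Y1 p; rewrite /mb_coef /mwordop;
  elim: (index_enum _) (index_enum_uniq 'I_k) => [_ z|i r IH].
  by rewrite big_seq1 !big_nil mul1r adjoint1.
move=> /= /andP[ir ur] z.
rewrite big_allpairs_dep exchange_big/=.
apply: le_trans (words_contraction (qP i) (Y1 i) (p i) z).
apply: ler_sum => u _.
have uu w : w \in degree_words n p r ->
  (\prod_(j <- i :: r) b_coef (q j) (set_coord w u j)) *
    rnorm (adjoint (\prod_(j <- i :: r) wordop (Y j) (set_coord w u j)) z) ^+ 2 =
  b_coef (q i) u * ((\prod_(j <- r) b_coef (q j) (w j)) *
    rnorm (adjoint (\prod_(j <- r) wordop (Y j) (w j)) (adjoint (wordop (Y i) u) z)) ^+ 2).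
  move=> _; rewrite !big_cons !set_coordE adjointM bopE -mulrA.
  have neq j : j \in r -> i != j by apply: contraTneq => <-.
  rewrite [in LHS](eq_big_seq (fun j => b_coef (q j) (w j))) => [|j /neq ij];
    last by rewrite set_coordNE.
  by rewrite [in LHS](eq_big_seq (fun j => wordop (Y j) (w j))) => [|j /neq ij];
    last by rewrite set_coordNE.
rewrite (eq_big_seq _ uu) -mulr_sumr ler_wpM2l ?b_coef_ge0//.
exact: IH.
Qed.
End MultiContraction.

(** * Coercive operators *)

Section RealSums.
Variable R : realType.

Lemma sum_fset_nat_le (c : nat -> R) (B : R) :
  (forall l, 0 <= c l) -> (forall N, \sum_(l < N) c l <= B) ->
  forall J : {fset nat}, \sum_(l <- J) c l <= B.
Proof.
move=> c0 cB J; pose N := (\max_(l <- J) l).+1.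
apply: le_trans (cB N); rewrite -(big_mkord xpredT) /index_iota subn0.
apply: ler_sum_uniq; rewrite ?fset_uniq ?iota_uniq// => l lJ.
by rewrite mem_iota add0n ltnS leq_bigmax_seq.
Qed.

Lemma geometric_le (s : R) N : 0 <= s < 1 -> \sum_(l < N) s ^+ l <= (1 - s)^-1.
Proof.
move=> /andP[s0 s1]; have sp : 0 < 1 - s by rewrite subr_gt0.
rewrite -[leRHS]mul1r ler_pdivlMr// mulrC -[X in X <= _]opprK -mulNr opprB -subrX1.
by rewrite opprB lerBlDr lerDl exprn_ge0.
Qed.
End RealSums.

Section Coercive.
Variables (R : realType) (H : hilbertType R).
Implicit Types (S T U : bop H).

Lemma opnormM S T : opnorm (S * T) <= opnorm S * opnorm T.
Proof.
apply: opnorm_le => [|x]; first by rewrite mulr_ge0 ?opnorm_ge0.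
by rewrite bopE (le_trans (opnorm_ler _ _))// -mulrA ler_wpM2l ?opnorm_ge0 ?opnorm_ler.
Qed.

Lemma opnormX S s n : 0 <= s -> opnorm S <= s -> opnorm (S ^+ n) <= s ^+ n.
Proof.
move=> s0 Ss; elim: n => [|n IH].
  by rewrite !expr0; apply: opnorm_le => // x; rewrite mul1r.
by rewrite !exprS (le_trans (opnormM _ _))// ler_pM ?opnorm_ge0.
Qed.

Lemma opnormD S T : opnorm (S + T) <= opnorm S + opnorm T.
Proof. by rewrite -!rnorm_bop rnormD. Qed.

(** Sums over an exhausting sequence of finite sets form a subnet. *)
Lemma cvg_totally_seq (I : choiceType) (f : I -> bop H) (l : bop H) (J_ : nat -> {fset I}) :
  partial_sum f @ totally --> l ->
  (forall J : {fset I}, exists N, forall n, (N <= n)%N -> fsubset J (J_ n)) ->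
  (fun n => partial_sum f (J_ n)) @ \oo --> l.
Proof.
have FT := @totally_filter I.
move=> /cvg_rnormP fl JP; apply/cvg_rnormP => e /fl[J _ Je].
by have [N NP] := JP J; exists N => // n /= /NP; exact: Je.
Qed.

(** The inverse is the sum of the powers of [S]. *)
Lemma neumann S : opnorm S < 1 -> exists U, U * (1 - S) = 1 /\ (1 - S) * U = 1.
Proof.
move=> S1; set s := opnorm S in S1; have s0 : 0 <= s by exact: opnorm_ge0.
have [U /cvg_totally_seq SU] : exists U, partial_sum (fun i => S ^+ i) @ (@totally nat) --> U.
  apply/cvg_ex; apply: (@abs_summable_cvg _ _ _ _ (1 - s)^-1) => J.
  apply: (@le_trans _ _ (\sum_(i <- J) s ^+ i)).
    by apply: ler_sum => i _; exact: opnormX.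
  apply: sum_fset_nat_le => [l|N]; first exact: exprn_ge0.
  by apply: geometric_le; rewrite s0.
pose u n := \sum_(i < n) S ^+ i.
have uU : u @ \oo --> U.
  have := SU (fun n => [fset i in iota 0 n]%fset).
  have -> : (fun n => partial_sum (fun i => S ^+ i) [fset i in iota 0 n]%fset) = u.
    apply/funext => n; rewrite partial_sumE /u -(big_mkord xpredT) /index_iota subn0.
    apply: perm_big; apply: uniq_perm; rewrite ?fset_uniq ?iota_uniq// => i.
    by rewrite inE.
  apply => J; exists (\max_(i <- J) i).+1 => n Jn; apply/fsubsetP => i iJ.
  rewrite inE/= mem_iota add0n (leq_trans _ Jn)// ltnS.
  exact: leq_bigmax_seq.
have near_U (e : R) : 0 < e -> exists n, opnorm (U - u n) < e /\ opnorm (S ^+ n) <= e + e.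
  move=> e0; have /cvg_rnormP/(_ _ e0)[N _ NP] := uU.
  exists N; have h1 := NP N (leqnn _); have h2 := NP N.+1 (leqnSn _).
  split; first exact: h1.
  have -> : S ^+ N = (U - u N) - (U - u N.+1).
    by rewrite opprB [RHS]addrC subrKA /u big_ord_recr/= addrAC subrr add0r.
  by rewrite -rnorm_bop (le_trans (rnormD _ _))// rnormN lerD// ltW.
have uE n : u n * (1 - S) = 1 - S ^+ n /\ (1 - S) * u n = 1 - S ^+ n.
  have cS : (1 - S) * u n = 1 - S ^+ n.
    by rewrite -opprB mulNr -subrX1 opprB.
  split=> //; rewrite -cS /u mulr_suml mulr_sumr; apply: eq_bigr => i _.
  by rewrite mulrBl mulrBr mul1r mulr1 -exprS -exprSr.
have small V : (forall e : R, 0 < e -> opnorm V <= (opnorm (1 - S) + 2) * e) -> V = 0.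
  move=> Ve; apply/rnorm_eq0/eqP; rewrite eq_le rnorm_ge0 andbT rnorm_bop.
  by apply: le0_eps Ve; rewrite addr_ge0 ?opnorm_ge0.
exists U; split; apply/eqP; rewrite -subr_eq0; apply/eqP/small => e /near_U[n [Un Sn]].
  have -> : U * (1 - S) - 1 = (U - u n) * (1 - S) - S ^+ n.
    by rewrite mulrBl (uE n).1 opprB addrA addrAC addrK.
  rewrite (le_trans (opnormD _ _))// -[opnorm (- _)]rnorm_bop rnormN rnorm_bop.
  have := opnormM (U - u n) (1 - S); have := ler_wpM2r (opnorm_ge0 (1 - S)) (ltW Un).
  by move: Sn; lra.
have -> : (1 - S) * U - 1 = (1 - S) * (U - u n) - S ^+ n.
  by rewrite mulrBr (uE n).2 opprB addrA addrAC addrK.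
rewrite (le_trans (opnormD _ _))// -[opnorm (- _)]rnorm_bop rnormN rnorm_bop.
have := opnormM (1 - S) (U - u n); have := ler_wpM2l (opnorm_ge0 (1 - S)) (ltW Un).
by move: Sn; lra.
Qed.

Definition op_ge (c : R) T := forall x, c%:C * hdot x x <= hdot (T x) x.

Lemma op_ge0E T : op_ge0 T <-> op_ge 0 T.
Proof. by split=> T0 x; have := T0 x; rewrite mul0r. Qed.

Lemma op_geW c d T : c <= d -> op_ge d T -> op_ge c T.
Proof.
move=> cd Td x; apply: le_trans (Td x); rewrite ler_wpM2r ?hdotxx_ge0//.
by rewrite lecR.
Qed.

Lemma op_geD c d S T : op_ge c S -> op_ge d T -> op_ge (c + d) (S + T).
Proof. by move=> Sc Td x; rewrite bopDE hdotDl rmorphD mulrDl lerD. Qed.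

(** For small [a > 0] the operator [1 - a T] is a strict contraction, since
    [|x - a T x|^2 <= (1 - 2 a c + a^2 |T|^2) |x|^2]; so [a T] is inverted by a
    Neumann series. *)
Lemma op_ge_gt0 c T : 0 < c -> op_ge c T -> op_gt0 T.
Proof.
move=> c0 Tc; split; first by apply/op_ge0E; apply: op_geW Tc; exact: ltW.
set M := opnorm T; have M0 : 0 <= M by exact: opnorm_ge0.
(* a minimizes 1 - 2 a c + a^2 (c^2 + M^2), and s2 is the minimum *)
pose a := c / (c ^+ 2 + M ^+ 2).
have d0 : 0 < c ^+ 2 + M ^+ 2 by rewrite ltr_wpDr ?sqr_ge0// exprn_gt0.
have a0 : 0 < a by rewrite divr_gt0.
pose s2 := 1 - a * c.
have s2lt : s2 < 1 by rewrite /s2 ltrBlDr ltrDl mulr_gt0.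
have s2ge : 0 <= s2.
  rewrite /s2 subr_ge0 /a mulrAC ler_pdivrMr// mul1r -expr2.
  by rewrite lerDl sqr_ge0.
have Sx x : rnorm ((1 - a%:C *: T) x) ^+ 2 <= s2 * rnorm x ^+ 2.
  rewrite bopBE bopZE.
  have := rnorm_sqrD x (- (a%:C *: T x)); rewrite rnormN rnorm_sqrZ => ->.
  have Tx : rnorm (T x) ^+ 2 <= M ^+ 2 * rnorm x ^+ 2.
    by rewrite -exprMn ler_pXn2r ?nnegrE ?mulr_ge0 ?rnorm_ge0// opnorm_ler.
  have -> : complex.Re (hdot x (- (a%:C *: T x))) = - a * complex.Re (hdot (T x) x).
    rewrite -scaleNr -rmorphN hdotZr hdotC.
    by case: (hdot (T x) x) => u v; rewrite /Num.conj/=; ring.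
  have h : c * rnorm x ^+ 2 <= complex.Re (hdot (T x) x).
    have := Tc x; rewrite hdotxx -rmorphM; case: (hdot (T x) x) => u v.
    by rewrite lecE/= => /andP[_].
  have h1 : a ^+ 2 * rnorm (T x) ^+ 2 <= a ^+ 2 * (M ^+ 2 * rnorm x ^+ 2).
    by rewrite ler_wpM2l// sqr_ge0.
  have h2 : a * (c * rnorm x ^+ 2) <= a * complex.Re (hdot (T x) x).
    by rewrite ler_wpM2l// ltW.
  have h3 : a ^+ 2 * (M ^+ 2 * rnorm x ^+ 2) <= a * c * rnorm x ^+ 2.
    rewrite mulrA ler_wpM2r ?sqr_ge0// expr2 -mulrA ler_wpM2l ?(ltW a0)//.
    rewrite /a mulrAC ler_pdivrMr// ler_wpM2l ?(ltW c0)// lerDr.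
    exact: sqr_ge0.
  rewrite /s2; move: h1 h2 h3; move: (complex.Re _) => *; lra.
have [U [U1 U2]] : exists U, U * (1 - (1 - a%:C *: T)) = 1 /\ (1 - (1 - a%:C *: T)) * U = 1.
  apply: neumann; apply: (@le_lt_trans _ _ (Num.sqrt s2)).
    apply: opnorm_le => [|x]; first exact: sqrtr_ge0.
    rewrite -(@ler_pXn2r _ 2) ?nnegrE ?mulr_ge0 ?rnorm_ge0 ?sqrtr_ge0//.
    by rewrite exprMn sqr_sqrtr.
  by rewrite -sqrtr1 ltr_sqrt.
have aT : 1 - (1 - a%:C *: T) = a%:C *: T by rewrite opprB addrC subrK.
rewrite aT in U1 U2; exists (a%:C *: U); split; apply: bop_ext => x.
  by have := congr1 (fun V : bop H => V x) U1; rewrite !bopE !bopZE linearZ.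
by have := congr1 (fun V : bop H => V x) U2; rewrite !bopE !bopZE linearZ.
Qed.

(** Polarization: the form of [T] is real on [x + y] and on [x + i y]. *)
Lemma op_ge0_hermitian T : op_ge0 T ->
  forall x y, hdot (T y) x = Num.conj (hdot (T x) y).
Proof.
move=> T0 x y.
have T0' z : complex.Im (hdot (T z) z) = 0.
  by have := T0 z; case: (hdot _ _) => u v; rewrite lecE/= => /andP[/eqP].
have := T0' (x + y); have := T0' (x + 'i *: y).
rewrite !linearD linearZ/= !(hdotDl, hdotDr, hdotZl, hdotZr) !raddfD/=.
have := T0' x; have := T0' y.
case: (hdot (T x) x) => a1 b1; case: (hdot (T y) y) => a2 b2.
case: (hdot (T x) y) => a3 b3; case: (hdot (T y) x) => a4 b4.
rewrite /Num.conj/= => -> ->.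
rewrite !(mul0r, mul1r, mulN1r, mulr0, add0r, addr0, oppr0, sub0r, opprK) => h1 h2.
by apply/eqP; rewrite eq_complex/=; apply/andP; split; apply/eqP; lra.
Qed.

(** Cauchy-Schwarz for the form of [T] gives [|T x|^2 <= |T| <T x, x>], and
    invertibility gives [|x| <= |T^-1| |T x|]. *)
Lemma op_gt0_ge T : op_gt0 T -> exists2 c : R, 0 < c & op_ge c T.
Proof.
move=> [T0 [S [ST TS]]].
(* the summand 1 matters when the space is zero *)
pose d := opnorm S ^+ 2 * opnorm T + 1.
have d0 : 0 < d by rewrite ltr_wpDl// mulr_ge0 ?opnorm_ge0// sqr_ge0.
exists d^-1; first by rewrite invr_gt0.
move=> x; pose r := complex.Re (hdot (T x) x).
have rE y : hdot (T y) y = (complex.Re (hdot (T y) y))%:C.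
  by have := T0 y; case: (hdot _ _) => u v; rewrite lecE/= => /andP[/eqP->].
have r0 : 0 <= r by have := T0 x; rewrite rE lecR.
rewrite rE -/r hdotxx -rmorphM lecR -[leRHS]mul1r -(mulVf (lt0r_neq0 d0)) -mulrA.
rewrite ler_wpM2l ?invr_ge0 ?(ltW d0)//.
have Tx : rnorm (T x) ^+ 2 <= opnorm T * r.
  have := @psd_cauchy_schwarz R[i] H (fun x y => hdot (T x) y) _ _ T0 x (T x).
  rewrite hdotxx rnormC rnormCr rE -/r (rE (T x)) -rmorphM -rmorphXn lecR.
  rewrite (ger0_norm (sqr_ge0 _)) => /(_ _ _)/wrap[||h].
  - by move=> y a u v; rewrite linearP hdotDl hdotZl.
  - by move=> u v; exact: op_ge0_hermitian.
  have h1 : complex.Re (hdot (T (T x)) (T x)) <= opnorm T * rnorm (T x) ^+ 2.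
    rewrite (le_trans (@Re_rnorm _ _))// (le_trans (cauchy_schwarz _ _))// expr2 mulrA.
    by rewrite ler_wpM2r ?rnorm_ge0 ?opnorm_ler.
  have [->|n0] := eqVneq (rnorm (T x)) 0; first by rewrite expr0n/= mulr_ge0 ?opnorm_ge0.
  have np : 0 < rnorm (T x) ^+ 2 by rewrite exprn_gt0// lt_def n0 rnorm_ge0.
  rewrite -(ler_pM2r np) -expr2 (le_trans h)// mulrAC mulrC.
  by rewrite ler_wpM2r.
have Sx : rnorm x ^+ 2 <= opnorm S ^+ 2 * rnorm (T x) ^+ 2.
  rewrite -exprMn ler_pXn2r ?nnegrE ?mulr_ge0 ?rnorm_ge0 ?opnorm_ge0//.
  by have := opnorm_ler S (T x); rewrite -bopE ST.
have := ler_wpM2l (sqr_ge0 (opnorm S)) Tx.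
by move: Sx; rewrite /d; lra.
Qed.
End Coercive.

(** * Defects of a tuple *)

Lemma bop_scaleAl (R : realType) (H : hilbertType R) a (S T : bop H) :
  a *: (S * T) = (a *: S) * T.
Proof. exact: bop_ext. Qed.

Lemma bop_scaleAr (R : realType) (H : hilbertType R) a (S T : bop H) :
  a *: (S * T) = S * (a *: T).
Proof. by apply: bop_ext => x; rewrite bopE !bopZE linearZ. Qed.

Section CompletelyPositiveMap.
Variables (R : realType) (H : hilbertType R) (m : nat).
Variables (q : {fsfun seq 'I_m -> R with 0}) (X : 'I_m -> bop H).

Lemma PhiD Y Z : Phi q X (Y + Z) = Phi q X Y + Phi q X Z.
Proof.
rewrite /Phi -big_split; apply: eq_bigr => w _ /=.
by rewrite mulrDr mulrDl scalerDr.
Qed.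

Lemma PhiN Y : Phi q X (- Y) = - Phi q X Y.
Proof.
by rewrite /Phi -sumrN; apply: eq_bigr => w _; rewrite mulrN mulNr scalerN.
Qed.

Lemma hdot_Phi Y z : hdot (Phi q X Y z) z =
  \sum_(w <- finsupp q) (q w)%:C *
    hdot (Y (adjoint (wordop X w) z)) (adjoint (wordop X w) z).
Proof.
rewrite bop_sumE hdot_suml; apply: eq_bigr => w _.
by rewrite bopZE hdotZl !bopE adjointP.
Qed.

Lemma Phi_ge0 Y : (forall w, 0 <= q w) -> op_ge0 Y -> op_ge0 (Phi q X Y).
Proof.
move=> q0 Y0 z; rewrite hdot_Phi; apply: sumr_ge0 => w _.
by rewrite mulr_ge0 ?ler0c.
Qed.

Lemma Phi1_contraction : op_ge0 (1 - Phi q X 1) ->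
  forall z, \sum_(w <- finsupp q) q w * rnorm (adjoint (wordop X w) z) ^+ 2 <=
    rnorm z ^+ 2.
Proof.
move=> P0 z; have := P0 z; rewrite bopBE hdotBl hdot_Phi hdotxx subr_ge0.
under eq_bigr do rewrite hdotxx -rmorphM.
by rewrite -rmorph_sum lecR.
Qed.
End CompletelyPositiveMap.

Section Defects.
Variables (R : realType) (k : nat) (n : 'I_k -> nat).
Variables (q : forall i, {fsfun seq 'I_(n i) -> R with 0}).
Hypothesis q_ge0 : forall i w, 0 <= q i w.

Lemma wordop_comm (H : hilbertType R) (X : optuple n H) s t u v :
  cross_commuting X -> s != t -> GRing.comm (wordop (X s) u) (wordop (X t) v).
Proof.
move=> cX st; apply/commr_sym/commr_prod => j _; apply/commr_sym/commr_prod => l _.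
exact: cX.
Qed.

Definition defect_step (H : hilbertType R) (X : optuple n H) (i : 'I_k) (Y : bop H) : bop H :=
  Y - Phi (q i) (X i) Y.

Lemma Phi_comm (H : hilbertType R) (X : optuple n H) s t Y :
  cross_commuting X -> s != t ->
  Phi (q s) (X s) (Phi (q t) (X t) Y) = Phi (q t) (X t) (Phi (q s) (X s) Y).
Proof.
move=> cX st; rewrite /Phi.
under eq_bigr do rewrite mulr_sumr mulr_suml scaler_sumr.
under [RHS]eq_bigr do rewrite mulr_sumr mulr_suml scaler_sumr.
rewrite exchange_big/=; apply: eq_bigr => v _; apply: eq_bigr => u _.
rewrite -!bop_scaleAr -!bop_scaleAl !scalerA mulrC; congr (_ *: _).
have cuv := wordop_comm u v cX st.
rewrite -!mulrA -!adjointM -cuv !mulrA.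
by rewrite -cuv.
Qed.

Lemma defect_stepC (H : hilbertType R) (X : optuple n H) s t Y :
  cross_commuting X -> defect_step X s (defect_step X t Y) =
    defect_step X t (defect_step X s Y).
Proof.
move=> cX; have [->//|st] := eqVneq s t.
rewrite /defect_step !PhiD !PhiN (Phi_comm _ cX st) !opprD !opprK !addrA.
by congr (_ + _); rewrite addrAC.
Qed.

(** As the maps [id - Phi_i] commute, the new factor can be moved to the front
    from any place in the product. *)
Lemma defect_add (H : hilbertType R) (X : optuple n H) (p : 'I_k -> bool) j Y :
  cross_commuting X -> p j = false ->
  defect q X (fun l => (l == j) || p l) Y = defect_step X j (defect q X p Y).
Proof.
move=> cX pj; rewrite /defect.
have : j \in index_enum 'I_k by rewrite mem_index_enum.
elim: (index_enum _) (index_enum_uniq 'I_k) => // i r IH /= /andP[ir ur].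
rewrite in_cons !big_cons /= => /orP[/eqP ji|jr].
  subst i; rewrite eqxx pj /= -/(defect_step X j _); congr (defect_step X j _).
  apply: (congr1 (fun f : bop H -> bop H => f Y)); apply: eq_big_seq => l lr;
    have [lj|//] := eqVneq l j.
  by move: ir; rewrite -lj lr.
have -> : (i == j) = false by apply/eqP => ij; move: ir; rewrite ij jr.
by rewrite IH//; case: (p i) => //=; exact: defect_stepC.
Qed.

Lemma defect0 (H : hilbertType R) (X : optuple n H) Y :
  defect q X (fun=> false) Y = Y.
Proof. by rewrite /defect; elim/big_ind : _ => // f g /= fY gY; rewrite gY fY. Qed.

Lemma polydomain_minus_contraction (H : hilbertType R) (X : optuple n H) :
  polydomain_minus q X -> forall i z, \sum_(w <- finsupp (q i)) q i w *
     rnorm (adjoint (wordop (X i) w) z) ^+ 2 <= rnorm z ^+ 2.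
Proof.
move=> [cX X0] i; apply: Phi1_contraction.
by have := X0 (fun l => (l == i) || false); rewrite defect_add// defect0.
Qed.

(** Adding an index to [p] lowers the defect, by [Phi_j] of a positive
    operator; so all defects dominate the full one, which is bounded below. *)
Lemma polydomain_defect_ge (H : hilbertType R) (X : optuple n H) :
  polydomain q X -> exists2 c : R, 0 < c & forall p, op_ge c (defect q X p 1).
Proof.
move=> [[cX X0] /op_gt0_ge[c c0 Xc]]; exists c => // p.
have [N] := ubnP #|[pred i | ~~ p i]|; elim: N p => // N IH p pN.
have [/existsP[j pj]|/existsPn pT] := boolP [exists j, ~~ p j]; last first.
  by have -> : p = xpredT by apply/funext => i; have := pT i; rewrite negbK => ->.
have -> : defect q X p 1 =
    defect q X (fun l => (l == j) || p l) 1 + Phi (q j) (X j) (defect q X p 1).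
  by rewrite defect_add ?(negbTE pj)// subrK.
rewrite -[c]addr0; apply: op_geD; last first.
  by apply/op_ge0E; apply: Phi_ge0 => //; exact: X0.
apply: IH; move: pN; rewrite ltnS; apply: leq_trans; apply: proper_card.
apply/properP; split; last by exists j; rewrite !inE ?eqxx.
by apply/fintype.subsetP => i; rewrite !inE negb_or => /andP[].
Qed.
End Defects.

(** * Rescaling a tuple *)

Section Scaling.
Variables (R : realType) (H : hilbertType R).

Lemma wordop_scale m (X : 'I_m -> bop H) (r : R) w :
  wordop (fun j => r%:C *: X j) w = (r ^+ size w)%:C *: wordop X w.
Proof.
rewrite /wordop; elim: w => [|j w IH]; first by rewrite !big_nil expr0 scale1r.
by rewrite !big_cons IH -bop_scaleAl -bop_scaleAr scalerA -rmorphM -exprS.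
Qed.

Lemma mwordop_scale k (n : 'I_k -> nat) (X : optuple n H) (r : 'I_k -> R) w :
  mwordop (fun i j => (r i)%:C *: X i j) w =
  (\prod_(i < k) r i ^+ size (w i))%:C *: mwordop X w.
Proof.
rewrite /mwordop; elim: (index_enum _) => [|i s IH]; first by rewrite !big_nil scale1r.
by rewrite !big_cons IH wordop_scale -bop_scaleAl -bop_scaleAr scalerA -rmorphM.
Qed.

Lemma Phi_scale m (q : {fsfun seq 'I_m -> R with 0}) (X : 'I_m -> bop H) (r : R) Y :
  Phi q (fun j => r%:C *: X j) Y = \sum_(w <- finsupp q)
    (q w * (r ^+ size w) ^+ 2)%:C *: (wordop X w * Y * adjoint (wordop X w)).
Proof.
apply: eq_bigr => w _; rewrite wordop_scale adjointZ.
have -> : Num.conj (r ^+ size w)%:C = (r ^+ size w)%:C :> R[i] by exact: conjc_real.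
by rewrite -!bop_scaleAl -bop_scaleAr !scalerA -!rmorphM -mulrA -expr2.
Qed.

Lemma cvg_bop_mul (T : Type) (F : set_system T) (f : T -> bop H) (l A B : bop H) :
  Filter F -> f @ F --> l -> (fun x => A * f x * B) @ F --> A * l * B.
Proof.
move=> FF /cvg_rnormP fl; apply/cvg_rnormP => e e0.
have d0 : 0 < opnorm A * opnorm B + 1 by rewrite ltr_wpDl ?mulr_ge0 ?opnorm_ge0.
have {}fl : F [set x | rnorm (l - f x) < e / (opnorm A * opnorm B + 1)].
  exact: fl (divr_gt0 e0 d0).
suff : F [set x | rnorm (A * l * B - A * f x * B) < e] by [].
apply: filterS fl => x /=; rewrite ltr_pdivlMr//; apply: le_lt_trans.
rewrite -mulrBl -mulrBr !rnorm_bop.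
apply: (@le_trans _ _ (opnorm A * opnorm (l - f x) * opnorm B)).
  by rewrite (le_trans (opnormM _ _))// ler_wpM2r ?opnorm_ge0 ?opnormM.
by rewrite [opnorm A * _]mulrC -mulrA mulrDr mulr1 lerDl opnorm_ge0.
Qed.

Lemma cvg_real_complex (a : R) (f : R -> R) :
  f @ a --> f a -> (fun x => (f x)%:C : R[i]^o) @ a --> ((f a)%:C : R[i]^o).
Proof.
move=> /cvgrPdist_lt fa.
have FF : Filter ((fun x => (f x)%:C : R[i]^o) @ a) by exact: fmap_filter.
apply/(@cvg_rnormP _ R[i]^o) => e e0.
suff : nbhs a [set x | rnorm ((f a)%:C - (f x)%:C : R[i]^o) < e] by [].
have := fa e e0; apply: filterS => x /=.
by rewrite -rmorphB rnormCr.
Qed.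

Lemma cvg_Phi_scale m (q : {fsfun seq 'I_m -> R with 0}) (X : 'I_m -> bop H)
    (Y : R -> bop H) (l : bop H) :
  Y @ (1 : R) --> l ->
  (fun r => Phi q (fun j => r%:C *: X j) (Y r)) @ (1 : R) --> Phi q X l.
Proof.
move=> Yl; under eq_fun do rewrite Phi_scale.
rewrite /Phi; apply: cvg_big => [|w _]; first exact: add_continuous.
apply: cvgZ; last exact: cvg_bop_mul.
suff : (fun r : R => (q w * (r ^+ size w) ^+ 2)%:C : R[i]^o) @ (1 : R) -->
    ((q w * (1 ^+ size w) ^+ 2)%:C : R[i]^o) by rewrite !expr1n mulr1.
apply: (@cvg_real_complex 1 (fun r => q w * (r ^+ size w) ^+ 2)).
apply: cvgM; first exact: cvg_cst.
under eq_fun do rewrite -exprM; rewrite -exprM; exact: exprn_continuous.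
Qed.
End Scaling.

Section Openness.
Variables (R : realType) (k : nat) (n : 'I_k -> nat).
Variables (q : forall i, {fsfun seq 'I_(n i) -> R with 0}).
Hypothesis q_ge0 : forall i w, 0 <= q i w.

(** Reality of the quadratic form, in place of self-adjointness; it is directly
    inherited by [Phi]. *)
Definition op_real (H : hilbertType R) (T : bop H) :=
  forall x, complex.Im (hdot (T x) x) = 0.

(** The quadratic form of [S] must be assumed real: closeness to [T] only
    controls its real part. *)
Lemma op_ge_perturb (H : hilbertType R) (S T : bop H) c d :
  op_ge c T -> opnorm (T - S) <= d -> op_real S -> op_ge (c - d) S.
Proof.
move=> Tc TS Sr x.
have h0 : complex.Re (hdot (S x) x) =
  complex.Re (hdot (T x) x) - complex.Re (hdot ((T - S) x) x).
  by rewrite bopBE hdotBl raddfB/= opprB addrC subrK.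
have h1 := le_trans (@Re_rnorm _ (hdot ((T - S) x) x)) (cauchy_schwarz _ _).
have h2 := ler_wpM2r (rnorm_ge0 x) (opnorm_ler (T - S) x).
have h3 := ler_wpM2r (sqr_ge0 (rnorm x)) TS.
have h4 : c * rnorm x ^+ 2 <= complex.Re (hdot (T x) x).
  have := Tc x; rewrite hdotxx -rmorphM; case: (hdot (T x) x) => u v.
  by rewrite lecE/= => /andP[_].
have := Sr x; rewrite hdotxx -rmorphM; move: h0; case: (hdot (S x) x) => u v /= -> ->.
by rewrite lecE/= eqxx/=; move: h1 h2 h3 h4; rewrite expr2; lra.
Qed.

Lemma Phi_real (H : hilbertType R) m (q' : {fsfun seq 'I_m -> R with 0})
  (X : 'I_m -> bop H) Y : op_real Y -> op_real (Phi q' X Y).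
Proof.
move=> Yr z; rewrite hdot_Phi raddf_sum/= big1// => w _.
by have := Yr (adjoint (wordop X w) z); case: (hdot _ _) => u v /= ->;
  rewrite mulr0 mul0r addr0.
Qed.

Lemma defect_real (H : hilbertType R) (X : optuple n H) p : op_real (defect q X p 1).
Proof.
rewrite /defect; elim: (index_enum _) => [|i r IH].
  by rewrite big_nil => x; rewrite hdotxx.
rewrite big_cons /=; case: (p i) => //= x.
by rewrite bopBE hdotBl raddfB/= IH Phi_real// subr0.
Qed.

Lemma cross_commuting_scale (H : hilbertType R) (X : optuple n H) (r : 'I_k -> R) :
  cross_commuting X -> cross_commuting (fun i j => (r i)%:C *: X i j).
Proof.
move=> cX s t st j l; rewrite /GRing.comm -!bop_scaleAl -!bop_scaleAr !scalerA.
by rewrite mulrC (cX _ _ st).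
Qed.

Lemma cvg_defect_scale (H : hilbertType R) (X : optuple n H) p :
  (fun r => defect q (fun i j => r%:C *: X i j) p 1) @ (1 : R) --> defect q X p 1.
Proof.
rewrite /defect; elim: (index_enum _) => [|i s IH].
  by under eq_fun do rewrite big_nil; rewrite big_nil; exact: cvg_cst.
under eq_fun do rewrite big_cons; rewrite big_cons /=; case: (p i) => //=.
by apply: cvgB => //; exact: cvg_Phi_scale.
Qed.

(** The finitely many defects are bounded below by a common positive constant
    ([polydomain_defect_ge]) and depend continuously on the scaling factor. *)
Lemma polydomain_open (H : hilbertType R) (X : optuple n H) :
  polydomain q X -> exists2 tau : R, 1 < tau & polydomain q (fun i j => tau%:C *: X i j).
Proof.
move=> Xq; have [c c0 Xc] := polydomain_defect_ge q_ge0 Xq.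
have c2 : 0 < c / 2 by rewrite divr_gt0.
have near_p (p : {ffun 'I_k -> bool}) : nbhs (1 : R) [set r |
    opnorm (defect q X p 1 - defect q (fun i j => r%:C *: X i j) p 1) < c / 2].
  by have /cvg_rnormP/(_ _ c2) := @cvg_defect_scale H X p.
have [e /= e0 eP] := @filter_forall R _ _ (nbhs (1 : R)) _ near_p.
exists (1 + e / 2); first by rewrite ltrDl divr_gt0.
have near_tau : ball (1 : R) e (1 + e / 2).
  rewrite -ball_normE/= opprD addrA subrr sub0r normrN gtr0_norm ?divr_gt0//.
  by rewrite ltr_pdivrMr// mulrDr mulr1 ltrDl.
have tauP p : op_ge (c / 2) (defect q (fun i j => (1 + e / 2)%:C *: X i j) p 1).
  have -> : p = [ffun x => p x] by apply/funext => i; rewrite ffunE.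
  have -> : c / 2 = c - c / 2 by lra.
  apply: op_ge_perturb (Xc _) _ (defect_real _ _).
  by apply: ltW; apply: eP.
split; last exact: op_ge_gt0 (tauP _).
split; first by apply: cross_commuting_scale; case: Xq => -[].
by move=> p; apply/op_ge0E; apply: op_geW (tauP p); exact: ltW.
Qed.
End Openness.

(** * Finite Hilbert tensor products *)

Section BigTensor.
Variables (R : realType) (k : nat) (F : 'I_k -> hilbertType R) (T : hilbertType R).
Variable t : (forall i, F i) -> T.
Hypothesis ht : is_bigtensor t.

Lemma bigtensor_dot x y : hdot (t x) (t y) = \prod_i hdot (x i) (y i).
Proof. by have [_ -> _] := ht. Qed.

Lemma dfwith_id (x : forall i, F i) i : dfwith x i (x i) = x.
Proof.
apply: functional_extensionality_dep => j.
by have [<-|ij] := eqVneq i j; rewrite ?dfwithin ?dfwithout.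
Qed.

Lemma bigtensor_dot_dfwith i x y u v :
  hdot (t (dfwith x i u)) (t (dfwith y i v)) =
  hdot u v * \prod_(j | j != i) hdot (x j) (y j).
Proof.
rewrite bigtensor_dot (bigD1 i)//= !dfwithin; congr (_ * _).
by apply: eq_bigr => j ji; rewrite !dfwithout// eq_sym.
Qed.

(** The Gram kernel of elementary tensors is the product of those of their
    components; bound [B] in component [i] and multiply by the others. *)
Lemma bigtensor_opP i (B : bop (F i)) x :
  bigtensor_op t B (t x) = t (dfwith x i (B (x i))).
Proof.
have [_ _ dt] := ht.
have hB (s : seq (R[i] * (forall i, F i))) :
    rnorm (lcomb (fun x => t (dfwith x i (B (x i)))) s) <= opnorm B * rnorm (lcomb t s).
  rewrite -(@ler_pXn2r _ 2) ?nnegrE ?mulr_ge0 ?rnorm_ge0 ?opnorm_ge0// exprMn !lcomb_ord.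
  pose u l := tnth (in_tuple s) l.
  have BB z : \sum_(l <- [:: tt]) rnorm (B z) ^+ 2 <= opnorm B ^+ 2 * rnorm z ^+ 2.
    rewrite big_seq1 -exprMn ler_pXn2r ?nnegrE ?mulr_ge0 ?opnorm_ge0 ?rnorm_ge0//.
    exact: opnorm_ler.
  have := @psd_column_bound _ 'I_(size s) _ [:: tt] _ _ (fun=> B) _ (fun l => (u l).2 i)
    (fun l m => \prod_(j | j != i) hdot ((u l).2 j) ((u m).2 j))
    (fun=> fun l => t (dfwith (u l).2 i (B ((u l).2 i)))) (fun l => t (u l).2) BB.
  move=> gc; apply: le_trans _ (gc _ _ _ (fun l => (u l).1)); first by rewrite big_seq1.
  - by move=> K /psd_mul_prod_gram; exact.
  - by move=> _ l m; rewrite bigtensor_dot_dfwith.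
  - by move=> l m; rewrite bigtensor_dot (bigD1 i).
have [S SP _] := bop_extend dt (opnorm_ge0 B) hB.
suff -> : bigtensor_op t B = S by exact: SP.
apply: the_opE => [//|S' S'P].
by apply: (bop_eq_dense dt) => _ [y _ <-]; rewrite S'P SP.
Qed.

Lemma rnorm_bigtensor_dfwith i x y :
  rnorm (t (dfwith x i y)) = rnorm y * \prod_(j | j != i) rnorm (x j).
Proof.
apply/eqP; rewrite -(@eqrXn2 _ 2)// ?rnorm_ge0//; last first.
  by rewrite mulr_ge0 ?rnorm_ge0// prodr_ge0// => j _; exact: rnorm_ge0.
have := bigtensor_dot_dfwith (i := i) x x y y; rewrite !hdotxx.
under eq_bigr do rewrite hdotxx.
by rewrite -rmorph_prod -rmorphM exprMn -prodrXl => -[->].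
Qed.

(** Replace the components of an elementary tensor by basis vectors, one
    index at a time: in each component [t] is linear and bounded. *)
Lemma bigtensor_basis_dense (J : 'I_k -> eqType) (b : forall i, J i -> F i) :
  (forall i, dense (lspan (range (b i)))) ->
  dense (lspan (range (fun w : forall i, J i => t (fun i => b i (w i))))).
Proof.
move=> db; set e := fun w : forall i, J i => _; have [tl _ dt] := ht.
suff te x : in_closed_span (range e) (t x).
  apply: dense_closed_span; apply: (dense_ind dt) => /=.
  - by move=> _ [x _ <-].
  - exact: in_closed_span0.
  - by move=> a u v; exact: in_closed_span_linear.
  - by move=> v; exact: in_closed_span_closed.
have key (r : seq 'I_k) y : (forall i, i \notin r -> exists w, y i = b i w) ->
    in_closed_span (range e) (t y).
  elim: r y => [|i r IH] y yr.
    have {}yr i : {w | y i = b i w} by apply: cid; exact: yr.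
    apply: mem_closed_span; exists (fun i => sval (yr i)) => //.
    by congr t; apply: functional_extensionality_dep => i; case: (yr i).
  rewrite -(dfwith_id y i); move: (y i); apply: (dense_ind (db i)) => /=.
  - move=> _ [w _ <-]; apply: IH => j jr; have [<-|ij] := eqVneq i j.
      by exists w; rewrite dfwithin.
    by rewrite dfwithout//; apply: yr; rewrite in_cons eq_sym negb_or ij.
  - suff -> : t (dfwith y i 0) = 0 by exact: in_closed_span0.
    by apply: rnorm_eq0; rewrite rnorm_bigtensor_dfwith rnorm0 mul0r.
  - move=> a u v uA vA; rewrite (tl y i a u v); exact: in_closed_span_linear.
  move=> v vA; apply: in_closed_span_closed => d d0.
  set C := \prod_(j | j != i) rnorm (y j).
  have C0 : 0 < C + 1 by rewrite ltr_wpDl// prodr_ge0// => j _; exact: rnorm_ge0.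
  have [u uA vu] := vA _ (divr_gt0 d0 C0); exists (t (dfwith y i u)) => //.
  have -> : t (dfwith y i v) - t (dfwith y i u) = t (dfwith y i (v - u)).
    by rewrite addrC -scaleN1r -(tl y i (-1) u v) scaleN1r addrC.
  rewrite rnorm_bigtensor_dfwith -/C; move: vu; rewrite ltr_pdivlMr//.
  by apply: le_lt_trans; rewrite ler_wpM2l ?rnorm_ge0// lerDl.
by apply: (key (index_enum 'I_k)) => i; rewrite mem_index_enum.
Qed.
End BigTensor.

(** * The universal model *)

Lemma bop_linearZ (R : realType) (H : hilbertType R) (T : bop H) a x :
  T (a *: x) = a *: T x.
Proof. exact: linearZ. Qed.

Section OrthonormalFamilies.
Variables (R : realType) (H : hilbertType R) (I : eqType) (e : I -> H).
Hypothesis eP : orthonormal_basis e.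

Let edot a b : hdot (e a) (e b) = (a == b)%:R.
Proof. by have [-> _] := eP. Qed.

Lemma lcomb_dot (V : hilbertType R) (g : I -> V) s :
  hdot (lcomb g s) (lcomb g s) = \sum_(p <- s) \sum_(p' <- s)
    p.1 * Num.conj p'.1 * hdot (g p.2) (g p'.2).
Proof.
rewrite /lcomb hdot_suml; apply: eq_bigr => p _; rewrite hdot_sumr.
by apply: eq_bigr => p' _; rewrite hdotZl hdotZr mulrA.
Qed.

(** The difference of the two sides is the squared norm of the same
    combination of the vectors [sqrt (D - d a) e_a]. *)
Lemma orthogonal_bound (h : I -> H) (d : I -> R) (D : R) :
  (forall a b, hdot (h a) (h b) = (d a)%:C * (a == b)%:R) ->
  (forall a, d a <= D) ->
  forall s, rnorm (lcomb h s) ^+ 2 <= D * rnorm (lcomb e s) ^+ 2.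
Proof.
move=> hd dD s; rewrite -subr_ge0 -lecR rmorphB rmorphM/= -!hdotxx.
pose g a := (Num.sqrt (D - d a))%:C *: e a.
have gg a b : hdot (g a) (g b) = D%:C * hdot (e a) (e b) - hdot (h a) (h b).
  rewrite hd edot hdotZl hdotZr edot; have [<-|ab] := eqVneq a b; last by rewrite !mulr0 subrr.
  rewrite !mulr1 (_ : Num.conj _ = (Num.sqrt (D - d a))%:C); last exact: conjc_real.
  by rewrite -rmorphM -expr2 sqr_sqrtr ?subr_ge0// rmorphB.
have := hdotxx_ge0 (lcomb g s); congr (_ <= _).
rewrite !lcomb_dot mulr_sumr -sumrB; apply: eq_bigr => p _.
rewrite mulr_sumr -sumrB; apply: eq_bigr => p' _.
by rewrite gg mulrBr mulrCA.
Qed.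

Lemma orthogonal_extend (h : I -> H) (d : I -> R) (D : R) :
  (forall a b, hdot (h a) (h b) = (d a)%:C * (a == b)%:R) ->
  (forall a, d a <= D) -> 0 <= D ->
  exists S : bop H, forall a, S (e a) = h a.
Proof.
move=> hd dD D0; have [_ de] := eP.
have hD s : rnorm (lcomb h s) <= Num.sqrt D * rnorm (lcomb e s).
  rewrite -(@ler_pXn2r _ 2) ?nnegrE ?mulr_ge0 ?rnorm_ge0 ?sqrtr_ge0//.
  by rewrite exprMn sqr_sqrtr//; exact: orthogonal_bound dD s.
by have [S SP _] := bop_extend de (sqrtr_ge0 D) hD; exists S.
Qed.

Lemma basis_eq x y : (forall a, hdot (e a) x = hdot (e a) y) -> x = y.
Proof.
move=> xy; have [_ de] := eP; apply: hdot_eqr => z; apply/eqP.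
rewrite -subr_eq0 -hdotBr; apply/eqP.
apply: (@dense_linear0 _ _ R[i]^o (range e) (fun z => hdot z (x - y)) (rnorm (x - y)) _ _ _ de).
- by move=> a u v; rewrite hdotDl hdotZl.
- exact: rnorm_ge0.
- by move=> u; rewrite mulrC cauchy_schwarz.
by move=> _ [a _ <-]; rewrite hdotBr xy subrr.
Qed.

Lemma bop_basis_eq (S T : bop H) : (forall a, S (e a) = T (e a)) -> S = T.
Proof. by move=> ST; have [_ de] := eP; apply: (bop_eq_dense de) => _ [a _ <-]. Qed.

(** [D - c] is the square of the self-adjoint diagonal operator with entries
    [sqrt (f a - c)]. *)
Lemma diag_op_ge (D : bop H) (f : I -> R) (c C : R) :
  (forall a, D (e a) = (f a)%:C *: e a) -> (forall a, c <= f a <= C) -> op_ge c D.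
Proof.
move=> De fcC; pose g a : R := Num.sqrt (f a - c).
have g2 a : g a ^+ 2 = f a - c by rewrite sqr_sqrtr// subr_ge0; case/andP: (fcC a).
have gconj a : Num.conj (g a)%:C = (g a)%:C :> R[i] by exact: conjc_real.
have [|||E EP] := @orthogonal_extend (fun a => (g a)%:C *: e a) (fun a => f a - c) `|C - c|.
- move=> a b; rewrite hdotZl hdotZr edot gconj; have [<-|ab] := eqVneq a b;
  last by rewrite !mulr0.
  by rewrite !mulr1 -rmorphM -expr2 g2.
- by move=> a; rewrite (le_trans _ (ler_norm _))// lerD2r; case/andP: (fcC a).
- by [].
have Eadj : adjoint E = E.
  apply: bop_basis_eq => b; apply: basis_eq => a.
  rewrite -adjointP !EP hdotZl hdotZr gconj edot.
  by have [->|] := eqVneq a b; rewrite ?mulr0.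
have DE : D - c%:C *: (1 : bop H) = E * E.
  apply: bop_basis_eq => a; rewrite bopBE bopZE bopE EP bop_linearZ EP De scalerA.
  by rewrite -scalerBl -rmorphB -rmorphM -expr2 g2.
move=> x; rewrite -subr_ge0 -hdotZl -hdotBl.
have -> : D x - c%:C *: x = (D - c%:C *: (1 : bop H)) x by [].
by rewrite DE bopE adjointP Eadj hdotxx_ge0.
Qed.
End OrthonormalFamilies.

Section UniversalModel.
Variables (R : realType) (k : nat) (n : 'I_k -> nat).
Variables (q : forall i, {fsfun seq 'I_(n i) -> R with 0}).
Hypothesis qP : forall i, positive_regular (q i).
Variable F : fock_model R n.

Definition fbase (w : mword n) : fspace F := ftensor (fun i => fbasis F (w i)).

Lemma fbase_dot u v : hdot (fbase u) (fbase v) = (u == v)%:R.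
Proof.
rewrite (bigtensor_dot (ftensorP F)); have [->|uv] := eqVneq u v.
  by rewrite big1// => i _; have [-> _] := fbasisP F i; rewrite eqxx.
have [i ui] : exists i, u i != v i.
  apply/existsP; apply: contra_neqT uv => /existsPn uv.
  by apply/ffunP => i; have := uv i; rewrite negbK => /eqP.
by rewrite (bigD1 i)//=; have [-> _] := fbasisP F i; rewrite (negbTE ui) mul0r.
Qed.

Lemma fbase_basis : orthonormal_basis fbase.
Proof.
split; first exact: fbase_dot.
have db i : dense (lspan (range (@fbasis _ _ _ F i))) by have [] := fbasisP F i.
have := bigtensor_basis_dense (ftensorP F) db; congr (dense (lspan _)).
apply/seteqP; split=> _ [w _ <-].
  exists [ffun i => w i] => //.
  by congr ftensor; apply: functional_extensionality_dep => i; rewrite ffunE.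
by exists w.
Qed.

Lemma shiftP i (j : 'I_(n i)) w : Defs.shift q F j (fbasis F w) =
  (Num.sqrt (b_coef (q i) w / b_coef (q i) (j :: w)))%:C *: fbasis F (j :: w).
Proof.
pose r w := b_coef (q i) w / b_coef (q i) (j :: w).
have r0 u : 0 <= r u by rewrite divr_ge0 ?b_coef_ge0.
have [|||S SP] := @orthogonal_extend _ _ _ _ (fbasisP F i)
    (fun w => (Num.sqrt (r w))%:C *: fbasis F (j :: w)) r (q i [:: j])^-1.
- move=> a b; rewrite hdotZl hdotZr (_ : Num.conj _ = (Num.sqrt (r b))%:C);
  last exact: conjc_real.
  have [-> _] := fbasisP F i; rewrite eqseq_cons eqxx/=.
  have [<-|] := eqVneq a b; last by rewrite !mulr0.
  by rewrite !mulr1 -rmorphM -expr2 sqr_sqrtr.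
- move=> u; rewrite /r ler_pdivrMr ?b_coef_gt0// ler_pdivlMl; last by have [_ _ ->] := qP i.
  exact: b_coef_cons.
- by rewrite invr_ge0; have [-> _ _] := qP i.
suff -> : Defs.shift q F j = S by rewrite SP.
apply: the_opE => // S' S'P; apply: (bop_basis_eq (fbasisP F i)) => u.
by rewrite S'P SP.
Qed.

Lemma ftensorZ (x : forall i, fock F i) i a y :
  ftensor (dfwith x i (a *: y)) = a *: ftensor (dfwith x i y).
Proof.
have [tl _ _] := ftensorP F.
have t0 : ftensor (dfwith x i 0) = 0 :> fspace F.
  by apply: rnorm_eq0; rewrite (rnorm_bigtensor_dfwith (ftensorP F)) rnorm0 mul0r.
by have := tl x i a y 0; rewrite addr0 t0 addr0.
Qed.

Local Notation W := (universal_model q F).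

Lemma universal_modelE i (j : 'I_(n i)) w :
  W j (fbase w) = (Num.sqrt (b_coef (q i) (w i) / b_coef (q i) (j :: w i)))%:C *:
    fbase (set_coord w (j :: w i)).
Proof.
rewrite /universal_model /fbase (bigtensor_opP (ftensorP F)) shiftP ftensorZ.
congr (_ *: ftensor _); apply: functional_extensionality_dep => l.
by have [<-|il] := eqVneq i l; rewrite ?dfwithin ?set_coordE// dfwithout// set_coordNE.
Qed.

Lemma set_coord_set_coord (w : mword n) i (u v : seq 'I_(n i)) : set_coord (set_coord w u)
  v = set_coord w v.
Proof.
by apply/ffunP => l; have [<-|il] := eqVneq i l; rewrite ?set_coordE ?set_coordNE.
Qed.

Lemma set_coord_id (w : mword n) i : set_coord w (w i) = w.
Proof.
by apply/ffunP => l; have [<-|il] := eqVneq i l; rewrite ?set_coordE ?set_coordNE.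
Qed.

(** The weights of the successive shifts telescope. *)
Lemma wordop_model_fbase i u w :
  wordop (@universal_model _ _ _ q F i) u (fbase w) =
  (Num.sqrt (b_coef (q i) (w i) / b_coef (q i) (u ++ w i)))%:C *:
    fbase (set_coord w (u ++ w i)).
Proof.
rewrite /wordop; elim: u => [|j u IH].
  by rewrite big_nil /= divff ?gt_eqF ?b_coef_gt0// sqrtr1 scale1r set_coord_id.
rewrite big_cons bopE IH bop_linearZ universal_modelE scalerA -rmorphM set_coordE
  set_coord_set_coord.
rewrite -sqrtrM ?divr_ge0 ?b_coef_ge0//; congr ((Num.sqrt _)%:C *: _).
by field; rewrite !gt_eqF// b_coef_gt0.
Qed.

Lemma mwordop_vacuum v : mwordop W v (fbase (mnil n)) =
  (Num.sqrt (mb_coef q v)^-1)%:C *: fbase v.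
Proof.
pose restrict (r : seq 'I_k) : mword n := [ffun i => if i \in r then v i else [::]].
have key r : uniq r -> (\prod_(i <- r) wordop (@universal_model _ _ _ q F i) (v i))
    (fbase (mnil n)) =
    (Num.sqrt (\prod_(i <- r) b_coef (q i) (v i))^-1)%:C *: fbase (restrict r).
  elim: r => [_|i r IH /= /andP[ir ur]].
    by rewrite !big_nil invr1 sqrtr1 scale1r; congr (fbase _).
  rewrite !big_cons bopE IH// bop_linearZ wordop_model_fbase scalerA -rmorphM.
  have ri : restrict r i = [::] by rewrite ffunE (negbTE ir).
  rewrite ri cats0 b_coef_nil mul1r mulrC -sqrtrM ?invr_ge0 ?b_coef_ge0// -invfM.
  congr (_ *: fbase _); apply/ffunP => l; have [il|il] := eqVneq i l.
    by subst l; rewrite set_coordE ffunE mem_head.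
  by rewrite set_coordNE// !ffunE in_cons [l == i]eq_sym (negbTE il).
rewrite /mwordop key ?index_enum_uniq//; congr (_ *: fbase _).
by apply/ffunP => l; rewrite ffunE mem_index_enum.
Qed.
End UniversalModel.

Section ScaledModel.
Variables (R : realType) (k : nat) (n : 'I_k -> nat).
Variables (q : forall i, {fsfun seq 'I_(n i) -> R with 0}).
Hypothesis qP : forall i, positive_regular (q i).
Variable F : fock_model R n.
Local Notation W := (universal_model q F).
Local Notation Wi i := (@universal_model _ _ _ q F i).
Local Notation e := (fbase F).

Lemma set_coordC (w : mword n) i j (u : seq 'I_(n i)) (v : seq 'I_(n j)) :
  i != j -> set_coord (set_coord w u) v = set_coord (set_coord w v) u.
Proof.
move=> ij; apply/ffunP => l.
have [il|il] := eqVneq i l.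
  by subst l; rewrite set_coordE set_coordNE 1?eq_sym// set_coordE.
rewrite [RHS]set_coordNE//; have [jl|jl] := eqVneq j l; first by subst l; rewrite !set_coordE.
by rewrite !set_coordNE.
Qed.

Lemma universal_model_comm : cross_commuting W.
Proof.
move=> s t st j l; apply: (bop_basis_eq (fbase_basis F)) => w.
rewrite !bopE !universal_modelE// !bop_linearZ !universal_modelE// !scalerA.
have ts : t != s by rewrite eq_sym.
by rewrite (set_coordNE w _ st) (set_coordNE w _ ts) mulrC set_coordC.
Qed.

Lemma adjoint_wordop_fbase i u w :
  adjoint (wordop (Wi i) u) (e w) =
  if prefix u (w i) then
    (Num.sqrt (b_coef (q i) (drop (size u) (w i)) / b_coef (q i) (w i)))%:C *:
      e (set_coord w (drop (size u) (w i)))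
  else 0.
Proof.
apply: (basis_eq (fbase_basis F)) => v.
rewrite -adjointP wordop_model_fbase// hdotZl fbase_dot.
case: (boolP (prefix u (w i))) => [/prefixP[x wx]|npre]; last first.
  rewrite hdot0r; have [vw|_] := eqVneq (set_coord v _) w; last by rewrite mulr0.
  by case/negP: npre; rewrite -vw set_coordE prefix_prefix.
rewrite wx drop_size_cat// hdotZr fbase_dot (_ : Num.conj _ =
  (Num.sqrt (b_coef (q i) x / b_coef (q i) (u ++ x)))%:C); last exact: conjc_real.
have [vx|vx] := eqVneq v (set_coord w x).
  by rewrite vx set_coordE set_coord_set_coord -wx set_coord_id eqxx.
have [vw|_] := eqVneq (set_coord v _) w; last by rewrite !mulr0.
have xv : x = v i.
  have := congr1 (fun f : mword n => f i) vw; rewrite /= set_coordE wx => /eqP.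
  by rewrite eqseq_cat// eqxx => /eqP ->.
by case/eqP: vx; rewrite xv -vw set_coord_set_coord set_coord_id.
Qed.

Variable r : 'I_k -> R.
Hypothesis r01 : forall i, 0 <= r i < 1.

Let X : optuple n (fspace F) := fun i j => (r i)%:C *: universal_model q F j.

(** The diagonal entry of [Phi_i(1)] at the words with component [x] at [i]. *)
Let d i (x : seq 'I_(n i)) : R := \sum_(u <- finsupp (q i) | prefix u x)
  q i u * (r i ^+ size u) ^+ 2 * (b_coef (q i) (drop (size u) x) / b_coef (q i) x).

(** The adjoint of [W_u] removes the prefix [u] from component [i] and [W_u]
    restores it, so a diagonal operator that does not depend on this component
    is multiplied by the diagonal of [Phi_i(1)]. *)
Lemma Phi_diag i (D : bop (fspace F)) (f : mword n -> R) :
  (forall w, D (e w) = (f w)%:C *: e w) ->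
  (forall w (x : seq 'I_(n i)), f (set_coord w x) = f w) ->
  forall w, Phi (q i) (@X i) D (e w) = (d (w i) * f w)%:C *: e w.
Proof.
move=> De fi w.
rewrite /d mulr_suml rmorph_sum scaler_suml/= [RHS]big_mkcond/=.
rewrite /X Phi_scale bop_sumE; apply: eq_bigr => u _.
rewrite bopZE !bopE adjoint_wordop_fbase.
case: (boolP (prefix u (w i))) => [/prefixP[x wx]|_]; last by rewrite !linear0.
rewrite bop_linearZ De bop_linearZ bop_linearZ wordop_model_fbase// set_coordE
  set_coord_set_coord fi !scalerA.
rewrite wx drop_size_cat// -wx set_coord_id -!rmorphM; congr ((_)%:C *: _).
set a := Num.sqrt _; have a2 : a * a = b_coef (q i) x / b_coef (q i) (w i).
  by rewrite -expr2 sqr_sqrtr// divr_ge0 ?b_coef_ge0.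
by rewrite -a2; ring.
Qed.

(** For [r i = 1] the sum would be 1 on nonempty words, by the recursion for [b].
    As [q_i] has no constant term, each summand carries a factor at most
    [r i ^+ 2]. *)
Lemma d_bounds i x : 0 <= d (i := i) x <= r i ^+ 2.
Proof.
have [q0 qnil _] := qP i; have /andP[r0 r1] := r01 i.
have b0 := b_coef_gt0 (qP i).
have t0 u : 0 <= q i u * (r i ^+ size u) ^+ 2 * (b_coef (q i) (drop (size u) x) / b_coef (q
  i) x).
  apply: mulr_ge0; last by rewrite divr_ge0 ?(ltW (b0 _)).
  by rewrite mulr_ge0// sqr_ge0.
apply/andP; split; first by apply: sumr_ge0 => u _.
have [->|x0] := eqVneq x [::].
  rewrite /d big1_seq ?sqr_ge0// => u /andP[/prefixP[v /eqP]].
  rewrite eq_sym -size_eq0 size_cat addn_eq0 size_eq0 => /andP[/eqP-> _].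
  by rewrite mem_finsupp qnil eqxx.
pose g u := q i u * b_coef (q i) (drop (size u) x).
have g0 u : 0 <= g u by rewrite mulr_ge0// ltW.
apply: (@le_trans _ _ (\sum_(u <- finsupp (q i) | prefix u x) r i ^+ 2 / b_coef (q i) x * g u)).
  rewrite /d big_seq_cond [leRHS]big_seq_cond; apply: ler_sum => u /andP[uq _].
  have u1 : (0 < size u)%N.
    by rewrite lt0n size_eq0; apply: contraTneq uq => ->; rewrite mem_finsupp qnil eqxx.
  have -> : q i u * (r i ^+ size u) ^+ 2 * (b_coef (q i) (drop (size u) x) / b_coef (q i) x) =
      (r i ^+ size u) ^+ 2 * ((b_coef (q i) x)^-1 * g u) by rewrite /g; ring.
  rewrite -[leRHS]mulrA ler_wpM2r ?mulr_ge0 ?invr_ge0 ?(ltW (b0 _))//.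
  rewrite ler_pXn2r ?nnegrE ?exprn_ge0// -(prednK u1) exprS ler_piMr//.
  by rewrite exprn_ile1// ltW.
rewrite -mulr_sumr -mulrA ler_piMr ?sqr_ge0//.
rewrite ler_pdivrMl// mulr1 [leRHS]b_coef_rec//.
have -> : \sum_(1 <= j < (size x).+1) q i (take j x) * b_coef (q i) (drop j x) =
    \sum_(u <- [seq take j x | j <- index_iota 1 (size x).+1]) g u.
  rewrite big_map; apply: eq_big_seq => j; rewrite mem_index_iota ltnS => /andP[_ jx].
  by rewrite /g size_takel.
rewrite -[leLHS]big_filter; apply: ler_sum_uniq => //.
- by rewrite filter_uniq// fset_uniq.
- rewrite map_inj_in_uniq ?iota_uniq// => j l; rewrite !mem_index_iota !ltnS.
  by move=> /andP[_ jx] /andP[_ lx] jl; rewrite -(size_takel jx) -(size_takel lx) jl.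
move=> u; rewrite mem_filter => /andP[/prefixP[v xv] uq] /negP[].
apply/mapP; exists (size u); last by rewrite xv take_size_cat.
rewrite mem_index_iota ltnS xv size_cat leq_addr andbT lt0n size_eq0.
by apply: contraTneq uq => ->; rewrite mem_finsupp qnil eqxx.
Qed.

Lemma scaled_model_defect p w :
  defect q X p 1 (e w) = (\prod_(i < k | p i) (1 - d (w i)))%:C *: e w.
Proof.
rewrite /defect; elim: (index_enum _) (index_enum_uniq 'I_k) w => [|i s IH] /=.
  by move=> _ w; rewrite !big_nil scale1r.
move=> /andP[is_ us] w; rewrite !big_cons /=; case: (p i) => /=; last exact: IH.
set D := (\big[_/_]_(_ <- _) _) 1; have De := IH us.
rewrite [LHS]bopBE (Phi_diag De) ?De//.
  by rewrite -scalerBl -rmorphB mulrBl mul1r.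
move=> w' x; rewrite big_seq_cond [RHS]big_seq_cond; apply: eq_bigr => l /andP[ls _].
by rewrite set_coordNE//; apply: contraNneq is_ => ->.
Qed.

(** The defects are diagonal, and their entries are at least the product of
    the [1 - r i ^+ 2]. *)
Lemma scaled_model_polydomain : polydomain q X.
Proof.
have r2 i : r i ^+ 2 < 1 by have /andP[r0 r1] := r01 i; rewrite expr_lt1.
pose c (p : 'I_k -> bool) := \prod_(i < k | p i) (1 - r i ^+ 2).
have c0 p : 0 < c p by apply: prodr_gt0 => i _; rewrite subr_gt0.
have cP p : op_ge (c p) (defect q X p 1).
  apply: (diag_op_ge (fbase_basis F) (scaled_model_defect p) (C := 1)) => w.
  apply/andP; split; last first.
    apply: prodr_ile1 => i _; have /andP[d0 d1] := d_bounds (w i).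
    by rewrite gerBl d0 subr_ge0 (le_trans d1)// ltW.
  apply: ler_prod => i _; have /andP[d0 d1] := d_bounds (w i).
  by rewrite subr_ge0 ltW//= lerB.
split; last exact: op_ge_gt0 (c0 _) (cP _).
split; first exact/cross_commuting_scale/universal_model_comm.
by move=> p; apply/op_ge0E/(op_geW (ltW (c0 p)))/cP.
Qed.
End ScaledModel.

(** * Multidegrees *)

Section MultiDegrees.
Variables (k : nat).
Local Notation deg := {ffun 'I_k -> nat}.

Definition box_degrees (N : nat) : seq deg :=
  [seq [ffun i => val (f i)] | f : {ffun 'I_k -> 'I_N}].

Lemma mem_box_degrees N (p : deg) : (p \in box_degrees N) = [forall i, p i < N]%N.
Proof.
apply/mapP/forallP => [[f _ ->] i|pN]; first by rewrite ffunE; exact: ltn_ord.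
exists [ffun i => Ordinal (pN i)]; first by rewrite mem_enum.
by apply/ffunP => i; rewrite !ffunE.
Qed.

Lemma uniq_box_degrees N : uniq (box_degrees N).
Proof.
rewrite map_inj_uniq ?enum_uniq// => f g fg; apply/ffunP => i; apply: val_inj.
by have := congr1 (fun p : deg => p i) fg; rewrite !ffunE.
Qed.

Lemma box_degrees_cover (J : {fset deg}) : exists N, {subset J <= box_degrees N}.
Proof.
exists (\max_(p <- J) \max_i p i)%N.+1 => p pJ; rewrite mem_box_degrees; apply/forallP => i.
by rewrite ltnS (leq_trans (leq_bigmax i))// (leq_bigmax_seq (F := fun p : deg => \max_i p i)).
Qed.

Variable R : realType.

(** Enlarge [J] to a box of multidegrees, over which the sum of products is a
    product of sums. *)
Lemma sum_fset_prod_le (c : nat -> R) (B : R) :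
  (forall l, 0 <= c l) -> (forall N, \sum_(l < N) c l <= B) ->
  forall J : {fset deg}, \sum_(p <- J) \prod_i c (p i) <= B ^+ k.
Proof.
move=> c0 cB J; have [N JN] := box_degrees_cover J.
have pc0 (p : deg) : 0 <= \prod_i c (p i) by exact: prodr_ge0.
apply: (@le_trans _ _ (\sum_(p <- box_degrees N) \prod_i c (p i))).
  apply: ler_sum_uniq; rewrite ?fset_uniq ?uniq_box_degrees// => p /JN ->//.
rewrite big_map big_enum/=.
under eq_bigr do under eq_bigr do rewrite ffunE.
rewrite -(bigA_distr_bigA (fun _ (j : 'I_N) => c j)) prodr_const card_ord.
by apply: lerXn2r; rewrite ?nnegrE ?sumr_ge0//; apply: le_trans (cB 0%N); rewrite big_ord0.
Qed.

Lemma big_pick (V : nmodType) (T : eqType) (r : seq T) (y : T) (F : T -> V) :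
  uniq r -> \sum_(x <- r) (if y == x then F x else 0) = if y \in r then F y else 0.
Proof.
move=> ur; case: ifPn => yr; last first.
  by rewrite big1_seq// => x /andP[_ xr]; case: eqP yr => // ->; rewrite xr.
rewrite (bigD1_seq y)//= eqxx big1 ?addr0// => x.
by rewrite eq_sym => /negbTE ->.
Qed.
End MultiDegrees.

Section TotalDegree.
Variables (k : nat) (n : 'I_k -> nat).
Implicit Types w : mword n.

Definition total_degree w := (\sum_(i < k) size (w i))%N.

Definition degrees_below (N : nat) : {fset {ffun 'I_k -> nat}} :=
  [fset p in [seq p : {ffun 'I_k -> nat} <- box_degrees k N | (\sum_(i < k) p i < N)%N]]%fset.

Lemma mem_degrees_below N (p : {ffun 'I_k -> nat}) :
  (p \in degrees_below N) = (\sum_i p i < N)%N.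
Proof.
rewrite !inE mem_filter mem_box_degrees; apply/andP/idP => [[]//|pN]; split=> //.
apply/forallP => i; apply: leq_ltn_trans pN.
by rewrite (bigD1 i)//= leq_addr.
Qed.

Lemma degrees_below_cover (J : {fset {ffun 'I_k -> nat}}) :
  exists N, forall m, (N <= m)%N -> fsubset J (degrees_below m).
Proof.
exists (\max_(p <- J) \sum_(i < k) p i)%N.+1 => m Jm; apply/fsubsetP => p pJ.
rewrite mem_degrees_below (leq_trans _ Jm)// ltnS.
exact: (leq_bigmax_seq (F := fun p : {ffun 'I_k -> nat} => \sum_i p i)%N).
Qed.

Lemma total_mwords w N : (total_degree w <= N)%N -> w \in mwords n N.
Proof.
move=> wN; rewrite mem_mwords; apply/forallP => i; apply: leq_trans wN.
by rewrite /total_degree (bigD1 i)//= leq_addr.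
Qed.

Lemma total_mdegree w : total_degree w = (\sum_i mdegree w i)%N.
Proof. by apply: eq_bigr => i _; rewrite ffunE. Qed.

Lemma total_mwordsE (V : nmodType) m N (G : mword n -> V) : (m <= N)%N ->
  \sum_(w \in [set w : mword n | (\sum_(i < k) size (w i))%N = m]) G w =
  \sum_(w <- mwords n N | total_degree w == m) G w.
Proof.
move=> mN; rewrite -[RHS]big_filter; apply: fsbig_seqE => [|w].
  by rewrite filter_uniq// undup_uniq.
rewrite mem_filter; split=> [/= wm|/andP[/eqP]//].
by rewrite {1}/total_degree wm eqxx total_mwords// /total_degree wm.
Qed.

(** Both sides are the sum of [G] over the words of total length less than
    [N]. *)
Lemma sum_total_degrees (V : nmodType) N (G : mword n -> V) :
  \sum_(m < N) \sum_(w \in [set w : mword n | (\sum_(i < k) size (w i))%N = m]) G w =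
  \sum_(p <- degrees_below N) \sum_(w \in Lambda p) G w.
Proof.
transitivity (\sum_(w <- mwords n N | (total_degree w < N)%N) G w).
  under eq_bigr => m _ do rewrite (@total_mwordsE _ _ N)// 1?ltnW// big_mkcond.
  rewrite exchange_big [RHS]big_mkcond; apply: eq_bigr => w _ /=.
  rewrite -(big_mkord xpredT (fun m => if total_degree w == m then G w else 0)).
  by rewrite big_pick ?iota_uniq// mem_index_iota.
transitivity (\sum_(p <- degrees_below N) \sum_(w <- mwords n N | mdegree w == p) G w).
  under [RHS]eq_bigr do rewrite big_mkcond.
  rewrite exchange_big [LHS]big_mkcond; apply: eq_bigr => w _ /=.
  by rewrite big_pick ?fset_uniq// mem_degrees_below -total_mdegree.
apply: eq_big_seq => p; rewrite mem_degrees_below => pN; rewrite (@Lambda_mwordsE _ _ _ _ N)//.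
by move=> i; rewrite (leq_trans _ (ltnW pN))// (bigD1 i)//= leq_addr.
Qed.
End TotalDegree.

Section Commutation.
Variables (R : realType) (k : nat) (n : 'I_k -> nat).

Lemma mwordop_cat (H : hilbertType R) (X : optuple n H) u v : cross_commuting X ->
  mwordop X (mcat u v) = mwordop X u * mwordop X v.
Proof.
move=> cX; rewrite /mwordop; elim: (index_enum _) (index_enum_uniq 'I_k) =>
  [_|i r IH /= /andP[ir ur]].
  by rewrite !big_nil mulr1.
rewrite !big_cons IH// ffunE wordop_cat -!mulrA; congr (_ * _); rewrite !mulrA; congr (_ * _).
rewrite big_seq; apply: commr_prod => j jr; apply: wordop_comm => //.
by apply: contraNneq ir => ->.
Qed.
End Commutation.

(** * Free holomorphic functions *)

Section HolomorphicFunctions.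
Variables (R : realType) (k : nat) (n : 'I_k -> nat).
Variables (q : forall i, {fsfun seq 'I_(n i) -> R with 0}) (rho : 'I_k -> R).
Hypothesis qP : forall i, positive_regular (q i).
Hypothesis rho0 : forall i, 0 < rho i.
Implicit Types (K H T : hilbertType R).

Let q0 i w : 0 <= q i w.
Proof. by have [] := qP i. Qed.

Definition homog_part K H T (t : {bilinear K -> H -> T}) (A : mword n -> bop K)
    (X : optuple n H) (p : {ffun 'I_k -> nat}) : bop T :=
  \sum_(w \in Lambda p) tensor_op t (A w) (mwordop X w).

Lemma homog_partE K H T (t : {bilinear K -> H -> T}) A (X : optuple n H) p :
  homog_part t A X p = \sum_(w <- degree_words n p (index_enum 'I_k))
    tensor_op t (A w) (mwordop X w).
Proof. exact: LambdaE. Qed.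

Lemma mem_degree_words_mdegree (p : {ffun 'I_k -> nat}) w :
  (w \in degree_words n p (index_enum 'I_k)) = (mdegree w == p).
Proof.
rewrite mem_degree_words ?index_enum_uniq//; apply/forallP/eqP => [wp|<- i].
  by apply/ffunP => i; have := wp i; rewrite mem_index_enum ffunE => /eqP.
by rewrite mem_index_enum ffunE.
Qed.

Lemma degree_words_prod (p : {ffun 'I_k -> nat}) w (s : 'I_k -> R) :
  w \in degree_words n p (index_enum 'I_k) ->
  \prod_(i < k) s i ^+ size (w i) = \prod_(i < k) s i ^+ p i.
Proof.
rewrite mem_degree_words_mdegree => /eqP <-; apply: eq_bigr => i _; by rewrite ffunE.
Qed.

Lemma homog_part_scale K H T (t : {bilinear K -> H -> T}) A (X : optuple n H) (s : 'I_k ->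
  R) p :
  is_tensor t -> homog_part t A (fun i j => (s i)%:C *: X i j) p =
  (\prod_(i < k) s i ^+ p i)%:C *: homog_part t A X p.
Proof.
move=> ht; rewrite !homog_partE scaler_sumr; apply: eq_big_seq => w wp.
by rewrite mwordop_scale tensor_opZr// (degree_words_prod s wp).
Qed.

(** This leaves room between a point of the scaled polydomain and the
    boundary, from which all geometric convergence rates are drawn. *)
Lemma scaled_polydomain_open H (X : optuple n H) : scaled_polydomain rho q X ->
  exists2 tau : R, 1 < tau &
    exists2 Y, polydomain q Y & X = fun i j => (rho i / tau)%:C *: Y i j.
Proof.
move=> [Y Yq <-]; have [tau tau1 Yt] := polydomain_open q0 Yq.
exists tau => //; exists (fun i j => tau%:C *: Y i j) => //.
apply: functional_extensionality_dep => i; apply/funext => j.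
by rewrite scalerA -rmorphM divfK// gt_eqF// (lt_trans ltr01).
Qed.

Lemma abs_summable_geometric (I : choiceType) H (f : I -> bop H) (c : I -> R) (M B : R) :
  0 <= M -> (forall i, opnorm (f i) <= M * c i) ->
  (forall J : {fset I}, \sum_(i <- J) c i <= B) ->
  forall J : {fset I}, \sum_(i <- J) opnorm (f i) <= M * B.
Proof.
move=> M0 fM cB J; apply: (@le_trans _ _ (\sum_(i <- J) M * c i)).
  by apply: ler_sum => i _; exact: fM.
by rewrite -mulr_sumr ler_wpM2l.
Qed.

Lemma sum_geometric_degrees (theta : R) (J : {fset {ffun 'I_k -> nat}}) : 0 <= theta < 1 ->
  \sum_(p <- J) \prod_(i < k) theta ^+ p i <= ((1 - theta)^-1) ^+ k.
Proof.
move=> th; have /andP[th0 _] := th.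
apply: (sum_fset_prod_le (c := fun l => theta ^+ l)) => [l|N]; first exact: exprn_ge0.
exact: geometric_le.
Qed.

Section SeriesToHolomorphic.
Variables (F : fock_model R n) (K : hilbertType R) (A : mword n -> bop K).
Variables (T : hilbertType R) (t : {bilinear K -> fspace F -> T}).
Hypothesis ht : is_tensor t.

Let u (s : 'I_k -> R) (m : nat) : bop T :=
  \sum_(w \in [set w : mword n | (\sum_(i < k) size (w i))%N = m])
    tensor_op t (A w) ((\prod_(i < k) s i ^+ size (w i))%:C *:
      mwordop (universal_model q F) w).

(** The tuple [s W = rho (s / rho) W] is a point of the scaled
    polydomain, and the partial sums of the series are unordered partial sums over
    the sets of multidegrees of total degree less than [N]. *)
Lemma model_series_of_holomorphic (s : 'I_k -> R) :
  free_holomorphic rho q A -> (forall i, 0 <= s i < rho i) -> cvgn (series (u s)).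
Proof.
move=> hA s0.
have r01 i : 0 <= s i / rho i < 1.
  by have /andP[? ?] := s0 i; rewrite divr_ge0 ?(ltW (rho0 i))//= ltr_pdivrMr// mul1r.
have Wr := scaled_model_polydomain qP F r01.
have /cvg_ex[l hl] := hA _ _ t ht _ (imageP (fun X => fun i j => (rho i)%:C *: X i j) Wr).
apply/cvg_ex; exists l.
suff -> : series (u s) = fun N => partial_sum (fun p => \sum_(w \in Lambda p)
    tensor_op t (A w) (mwordop (fun i j =>
      (rho i)%:C *: ((s i / rho i)%:C *: universal_model q F j)) w)) (degrees_below k N).
  exact: cvg_totally_seq hl (@degrees_below_cover k).
apply/funext => N; rewrite partial_sumE seriesEord.
rewrite /= /u sum_total_degrees; apply: eq_bigr => p _.
rewrite !LambdaE; apply: eq_bigr => w _; congr tensor_op.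
rewrite -mwordop_scale; congr (mwordop _ w).
apply: functional_extensionality_dep => i; apply/funext => j.
by rewrite scalerA -rmorphM mulrC divfK// gt_eqF.
Qed.

(** On [x (x) e_0] the operator [A_w (x) W_w] takes the value
    [b_w^(-1/2) A_w x (x) e_w], and these vectors are orthogonal for distinct [w]. *)
Lemma vacuum_bound (s : 'I_k -> R) m M x : opnorm (u s m) <= M ->
  \sum_(w <- mwords n m | total_degree w == m)
     (\prod_(i < k) s i ^+ size (w i)) ^+ 2 / mb_coef q w * rnorm (A w x) ^+ 2 <=
   M ^+ 2 * rnorm x ^+ 2.
Proof.
move=> uM; set e0 := fbase F (mnil n).
have e01 : rnorm e0 = 1.
  have := hdotxx e0; rewrite fbase_dot eqxx => /(congr1 (@complex.Re R))/= /esym/eqP.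
  by rewrite sqrf_eq1 => /orP[/eqP//|/eqP h]; have := rnorm_ge0 e0; rewrite h ler0N1.
pose c (w : mword n) := (\prod_(i < k) s i ^+ size (w i)) * Num.sqrt (mb_coef q w)^-1.
have uE : u s m (t x e0) = \sum_(w <- mwords n m | total_degree w == m) t (A w x) ((c w)%:C
  *: fbase F w).
  rewrite /u (total_mwordsE _ (leqnn m)) bop_sumE; apply: eq_bigr => w _.
  by rewrite tensor_opP// bopZE mwordop_vacuum// scalerA -rmorphM.
have h : rnorm (u s m (t x e0)) <= M * rnorm x.
  by rewrite (le_trans (opnorm_ler _ _))// rnorm_tensor// e01 mulr1 ler_wpM2r ?rnorm_ge0.
have M0 : 0 <= M by apply: le_trans uM; exact: opnorm_ge0.
rewrite -exprMn; apply: (@le_trans _ _ (rnorm (u s m (t x e0)) ^+ 2)); last first.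
  by rewrite ler_pXn2r ?nnegrE ?mulr_ge0 ?rnorm_ge0.
rewrite -[leLHS]big_filter -lecR -hdotxx uE -[X in hdot X X]big_filter.
set r := [seq w <- mwords n m | total_degree w == m].
have ur : uniq r by rewrite filter_uniq// undup_uniq.
rewrite hdot_suml rmorph_sum/=.
rewrite le_eqVlt; apply/orP; left; apply/eqP; apply: eq_big_seq => w wr.
have [td _] := ht.
have -> : hdot (t (A w x) ((c w)%:C *: fbase F w))
    (\sum_(v <- r) t (A v x) ((c v)%:C *: fbase F v)) =
  \sum_(v <- r) (if w == v then (c v ^+ 2 * rnorm (A v x) ^+ 2)%:C else 0).
  rewrite hdot_sumr; apply: eq_bigr => v _; rewrite td hdotZl hdotZr fbase_dot.
  case: eqVneq => [<-|]; last by rewrite !mulr0.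
  rewrite mulr1 (_ : Num.conj _ = (c w)%:C); last exact: conjc_real.
  by rewrite hdotxx -!rmorphM -expr2 mulrC.
rewrite big_pick// wr /c exprMn sqr_sqrtr//.
by rewrite invr_ge0 ltW// mb_coef_gt0.
Qed.

Lemma series_term_bounded (s : 'I_k -> R) :
  cvgn (series (u s)) -> exists2 M : R, 0 <= M & forall m, opnorm (u s m) <= M.
Proof.
move=> /cvg_ex[l /cvg_rnormP sl].
have [N _ NP] := sl 1 ltr01.
have uS m : u s m = series (u s) m.+1 - series (u s) m.
  by rewrite !seriesEord/= big_ord_recr/= addrAC subrr add0r.
exists (\sum_(m < N) opnorm (u s m) + 2) => [|m].
  by rewrite addr_ge0// sumr_ge0// => i _; exact: opnorm_ge0.
have S0 : 0 <= \sum_(m < N) opnorm (u s m) by rewrite sumr_ge0// => i _; exact: opnorm_ge0.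
have [mN|Nm] := ltnP m N.
  rewrite (bigD1 (Ordinal mN))//= -addrA lerDl addr_ge0// sumr_ge0// => i _.
  exact: opnorm_ge0.
have -> : u s m = (l - series (u s) m) - (l - series (u s) m.+1).
  by rewrite uS opprB [RHS]addrC subrKA.
rewrite -rnorm_bop (le_trans (rnormD _ _))// rnormN.
by have := NP m Nm; have := NP m.+1 (leqW Nm); move=> /=; lra.
Qed.

(** Write [X = (rho / tau) Y] with [tau > 1] and choose [s = rho / sigma]
    with [1 < sigma < tau]. The column bound on the [A_w] ([vacuum_bound]) and
    the row bound on the [Y_w] ([degree_contraction]) have inverse weights, so
    together they bound [s^p] times the part of degree [p] at [Y] by [M]; the part
    of degree [p] at [X] is then at most [M (sigma / tau)^|p|]. *)
Lemma holomorphic_of_model_series :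
  (forall s : 'I_k -> R, (forall i, 0 <= s i < rho i) -> cvgn (series (u s))) ->
  free_holomorphic rho q A.
Proof.
move=> us H T' t' ht' X Xq; have [tau tau1 [Y Yq ->]] := scaled_polydomain_open Xq.
have [Yq_ _] := Yq; have Y1 := polydomain_minus_contraction Yq_.
(* any sigma strictly between 1 and tau would do *)
pose sigma := (1 + tau) / 2; have sigma1 : 1 < sigma by rewrite /sigma; lra.
have sigma_tau : sigma < tau by rewrite /sigma; lra.
have sigma0 : 0 < sigma by lra.
have tau0 : 0 < tau by lra.
pose s i := rho i / sigma.
have s0 i : 0 < s i by rewrite divr_gt0.
have [|M M0 uM] := @series_term_bounded s.
  by apply: us => i; rewrite ltW//= /s gtr_pMr// invf_lt1.
pose theta := sigma / tau.
have th : 0 <= theta < 1 by rewrite /theta divr_ge0 ?ltW//= ltr_pdivrMr// mul1r.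
have sp0 (p : {ffun 'I_k -> nat}) : 0 < \prod_(i < k) s i ^+ p i.
  by apply: prodr_gt0 => i _; rewrite exprn_gt0.
have hY (p : {ffun 'I_k -> nat}) : (\prod_(i < k) s i ^+ p i) * opnorm (homog_part t' A Y
  p) <= M.
  set sp := \prod_(i < k) s i ^+ p i; set r := degree_words n p (index_enum 'I_k).
  have -> : sp * opnorm (homog_part t' A Y p) = opnorm (\sum_(w <- r)
      tensor_op t' ((sp * Num.sqrt (mb_coef q w)^-1)%:C *: A w)
        ((Num.sqrt (mb_coef q w))%:C *: mwordop Y w)).
    have sp_gt0 : 0 < sp by exact: sp0.
    rewrite -[X in X * _](ger0_norm (ltW sp_gt0)) -!rnorm_bop -rnormZr homog_partE scaler_sumr.
    congr rnorm; apply: eq_bigr => w _; rewrite tensor_opZr//.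
    have := tensor_op_linearl ht' (sp * Num.sqrt (mb_coef q w)^-1)%:C (A w) 0 (mwordop Y w).
    rewrite tensor_op0l// !addr0 => ->; rewrite scalerA -rmorphM; congr (_%:C *: _).
    have b0 : 0 < Num.sqrt (mb_coef q w) by rewrite sqrtr_gt0 mb_coef_gt0.
    by rewrite sqrtrV ?ltW ?mb_coef_gt0//; field; rewrite gt_eqF.
  rewrite -[leRHS]mulr1; apply: tensor_row_column => // [x|z].
    pose m := (\sum_(i < k) p i)%N.
    have vb := vacuum_bound x (uM m); apply: le_trans _ vb.
    rewrite -[leRHS]big_filter.
    rewrite [leLHS](eq_big_seq (fun w : mword n =>
      (\prod_(i < k) s i ^+ size (w i)) ^+ 2 / mb_coef q w * rnorm (A w x) ^+ 2)); last first.
      move=> w wr; rewrite bopZE rnormZr exprMn real_normK ?num_real// exprMn sqr_sqrtr.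
        by rewrite (degree_words_prod s wr).
      by rewrite invr_ge0 ltW// mb_coef_gt0.
    apply: ler_sum_uniq => [|||w].
    - exact/uniq_degree_words/index_enum_uniq.
    - by rewrite filter_uniq// undup_uniq.
    - by move=> w; rewrite mulr_ge0 ?sqr_ge0// divr_ge0 ?sqr_ge0// ltW// mb_coef_gt0.
    rewrite mem_degree_words_mdegree mem_filter => /eqP wp /negP[].
    have tw : total_degree w = (\sum_i p i)%N by rewrite total_mdegree wp.
    by rewrite tw eqxx total_mwords// tw.
  rewrite expr1n mul1r; apply: le_trans _ (degree_contraction qP Y1 p z).
  apply: ler_sum => w _; rewrite adjointZ bopZE.
  rewrite (_ : Num.conj _ = (Num.sqrt (mb_coef q w))%:C); last exact: conjc_real.
  by rewrite rnormZr exprMn real_normK ?num_real// sqr_sqrtr// ltW// mb_coef_gt0.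
have hX (p : {ffun 'I_k -> nat}) : opnorm (homog_part t' A (fun i j =>
  (rho i / tau)%:C *: Y i j) p) <=
    M * \prod_(i < k) theta ^+ p i.
  rewrite homog_part_scale// -rnorm_bop rnormZr rnorm_bop ger0_norm; last first.
    by apply: prodr_ge0 => i _; rewrite exprn_ge0// divr_ge0 ?ltW.
  have -> : \prod_(i < k) (rho i / tau) ^+ p i =
      (\prod_(i < k) theta ^+ p i) * \prod_(i < k) s i ^+ p i.
    rewrite -big_split; apply: eq_bigr => i _ /=; rewrite -exprMn; congr (_ ^+ _).
    by rewrite /theta /s; field; rewrite !gt_eqF.
  rewrite -mulrA mulrC; apply: ler_wpM2r => //.
  by apply: prodr_ge0 => i _; rewrite exprn_ge0//; case/andP: th.
apply: (abs_summable_cvg (B := M * ((1 - theta)^-1) ^+ k)).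
by apply: (abs_summable_geometric M0 hX) => J; exact: sum_geometric_degrees.
Qed.
End SeriesToHolomorphic.

Section ScalarCoefficients.
Local Notation C1 := (1 : bop (scalarH R)).
Variables (H T : hilbertType R) (t : {bilinear scalarH R -> H -> T}).
Hypothesis ht : is_tensor t.
Variable X : optuple n H.

Definition scalar_coefs (phi : fps R[i] n) : mword n -> bop (scalarH R) :=
  fun w => phi w *: C1.

Definition monomial_op (w : mword n) : bop T := tensor_op t C1 (mwordop X w).

Lemma tensor_op_scalar (a : R[i]) B : tensor_op t (a *: C1) B = a *: tensor_op t C1 B.
Proof. by have := tensor_op_linearl ht a C1 0 B; rewrite tensor_op0l// !addr0. Qed.

Lemma scalar_homog_partE phi p : homog_part t (scalar_coefs phi) X p =
  \sum_(w <- degree_words n p (index_enum 'I_k)) phi w *: monomial_op w.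
Proof.
by rewrite homog_partE; apply: eq_bigr => w _; rewrite tensor_op_scalar.
Qed.

Lemma scalar_homog_part_mwordsE phi (p : {ffun 'I_k -> nat}) N : (forall i, p i <= N)%N ->
  homog_part t (scalar_coefs phi) X p =
  \sum_(w <- mwords n N | mdegree w == p) phi w *: monomial_op w.
Proof.
move=> pN; rewrite /homog_part (Lambda_mwordsE _ pN); apply: eq_bigr => w _.
by rewrite tensor_op_scalar.
Qed.

Lemma monomial_op_cat u v : cross_commuting X -> monomial_op (mcat u v) =
  monomial_op u * monomial_op v.
Proof. by move=> cX; rewrite /monomial_op tensor_opM// mulr1 mwordop_cat. Qed.

Lemma mdegree_cat (u v : mword n) : mdegree (mcat u v) =
  [ffun i => (mdegree u i + mdegree v i)%N].
Proof. by apply/ffunP => i; rewrite !ffunE size_cat. Qed.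

Local Notation term phi p := (homog_part t (scalar_coefs phi) X p).

(** Both sides are the sum of [phi u * psi v] times the monomial of [uv] over
    the pairs of words such that [uv] has degree [p]; as [p] is in the box, so are
    the degrees of [u] and [v]. *)
Lemma homog_part_mul phi psi (p : {ffun 'I_k -> nat}) N :
  cross_commuting X -> p \in box_degrees k N ->
  term (phi * psi) p = \sum_(p1 <- box_degrees k N) \sum_(p2 <- box_degrees k N)
    if [ffun i => (p1 i + p2 i)%N] == p then term phi p1 * term psi p2 else 0.
Proof.
move=> cX; rewrite mem_box_degrees => /forallP pN.
have degN p1 : p1 \in box_degrees k N -> forall i, (p1 i <= N)%N.
  by rewrite mem_box_degrees => /forallP h i; exact: ltnW.
set ws := mwords n N.
pose G u v := if mdegree (mcat u v) == p then phi u * psi v *: (monomial_op u * monomial_op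
  v) else 0.
transitivity (\sum_(u <- ws) \sum_(v <- ws) G u v).
  rewrite (scalar_homog_part_mwordsE _ (fun i => ltnW (pN i))) big_mkcond.
  transitivity (\sum_(w <- ws) \sum_(u <- ws) \sum_(v <- ws)
      if mcat u v == w then G u v else 0).
    apply: eq_big_seq => w ws_w; case: ifPn => wp; last first.
      rewrite big1// => u _; rewrite big1// => v _.
      by case: eqP => // uvw; rewrite /G uvw (negbTE wp).
    rewrite [(phi * psi) w](fpsME _ _ ws_w) scaler_suml; apply: eq_bigr => u _.
    rewrite scaler_suml; apply: eq_bigr => v _.
    case: eqP => [uvw|_]; last by rewrite scale0r.
    by rewrite /G uvw wp -uvw monomial_op_cat.
  rewrite exchange_big; apply: eq_bigr => u _ /=; rewrite exchange_big.
  apply: eq_bigr => v _ /=; rewrite big_pick ?undup_uniq//; case: ifPn => //.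
  rewrite /G mem_mwords; case: eqP => // uvp /forallP[] i.
  by have := ltnW (pN i); rewrite -uvp ffunE.
symmetry.
have termE phi' p' : p' \in box_degrees k N -> term phi' p' =
    \sum_(u <- ws) if mdegree u == p' then phi' u *: monomial_op u else 0.
  by move=> /degN p'N; rewrite (scalar_homog_part_mwordsE _ p'N) big_mkcond.
transitivity (\sum_(p1 <- box_degrees k N) \sum_(p2 <- box_degrees k N) \sum_(u <- ws)
  \sum_(v <- ws)
    if mdegree u == p1 then if mdegree v == p2 then G u v else 0 else 0).
  apply: eq_big_seq => p1 p1N; apply: eq_big_seq => p2 p2N.
  rewrite (termE phi)// (termE psi)//; case: ifPn => pp; last first.
    rewrite big1// => u _; rewrite big1// => v _.
    case: eqP => // up; case: eqP => // vp; rewrite /G mdegree_cat up vp.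
    by rewrite (negbTE pp).
  rewrite mulr_suml; apply: eq_bigr => u _; rewrite mulr_sumr; apply: eq_bigr => v _.
  case: eqP => [up|_]; last by rewrite mul0r.
  case: eqP => [vp|_]; last by rewrite mulr0.
  by rewrite /G mdegree_cat up vp pp -bop_scaleAl -bop_scaleAr scalerA.
rewrite (eq_bigr (fun p1 => \sum_(u <- ws) \sum_(v <- ws) \sum_(p2 <- box_degrees k N)
    if mdegree u == p1 then if mdegree v == p2 then G u v else 0 else 0)); last first.
  move=> p1 _; rewrite exchange_big; apply: eq_bigr => u _ /=.
  by rewrite exchange_big.
rewrite exchange_big; apply: eq_bigr => u _ /=.
rewrite exchange_big; apply: eq_bigr => v _ /=.
rewrite (eq_bigr (fun p1 => if mdegree u == p1 then
    if mdegree v \in box_degrees k N then G u v else 0 else 0)); last first.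
  move=> p1 _; case: eqP => _; last by rewrite big1.
  by rewrite big_pick ?uniq_box_degrees.
rewrite big_pick ?uniq_box_degrees// /G; case: eqP => [uvp|_]; last by rewrite !if_same.
have uN : mdegree u \in box_degrees k N.
  rewrite mem_box_degrees; apply/forallP => i; apply: leq_ltn_trans (pN i).
  by rewrite -uvp mdegree_cat [leqRHS]ffunE leq_addr.
have vN : mdegree v \in box_degrees k N.
  rewrite mem_box_degrees; apply/forallP => i; apply: leq_ltn_trans (pN i).
  by rewrite -uvp mdegree_cat [leqRHS]ffunE leq_addl.
by rewrite uN vN.
Qed.

(** The norms of the Cauchy product are dominated by the product of the sums of
    norms over a box of multidegrees. *)
Lemma abs_summable_mul phi psi (B1 B2 : R) : cross_commuting X ->
  (forall J : {fset {ffun 'I_k -> nat}}, \sum_(p <- J) opnorm (term phi p) <= B1) ->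
  (forall J : {fset {ffun 'I_k -> nat}}, \sum_(p <- J) opnorm (term psi p) <= B2) ->
  forall J : {fset {ffun 'I_k -> nat}}, \sum_(p <- J) opnorm (term (phi * psi) p) <= B1 * B2.
Proof.
move=> cX phiB psiB J; have [N JN] := box_degrees_cover J.
pose J' : {fset {ffun 'I_k -> nat}} := [fset p in box_degrees k N]%fset.
have degsE (c : {ffun 'I_k -> nat} -> R) : \sum_(p <- box_degrees k N) c p = \sum_(p <- J') c p.
  apply: perm_big; apply: uniq_perm; rewrite ?uniq_box_degrees ?fset_uniq// => p.
  by rewrite inE.
pose a p := opnorm (term phi p); pose b p := opnorm (term psi p).
have a0 p : 0 <= a p by exact: opnorm_ge0.
have b0 p : 0 <= b p by exact: opnorm_ge0.
apply: (@le_trans _ _ (\sum_(p <- box_degrees k N) \sum_(p1 <- box_degrees k N) \sum_(p2 <-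
  box_degrees k N)
    if [ffun i => (p1 i + p2 i)%N] == p then a p1 * b p2 else 0)).
  apply: (@le_trans _ _ (\sum_(p <- J) \sum_(p1 <- box_degrees k N) \sum_(p2 <- box_degrees k N)
    if [ffun i => (p1 i + p2 i)%N] == p then a p1 * b p2 else 0)).
    rewrite big_seq [leRHS]big_seq; apply: ler_sum => p /JN pN.
    rewrite (homog_part_mul _ _ cX pN) -rnorm_bop (le_trans (rnorm_sum _ _ _))//.
    apply: ler_sum => p1 _; rewrite (le_trans (rnorm_sum _ _ _))//.
    apply: ler_sum => p2 _; case: eqP => _; last by rewrite rnorm0.
    by rewrite rnorm_bop opnormM.
  apply: ler_sum_uniq => [||p|p /JN ->//]; [exact: fset_uniq|exact: uniq_box_degrees|].
  apply: sumr_ge0 => p1 _; apply: sumr_ge0 => p2 _; case: eqP => // _.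
  exact: (mulr_ge0 (a0 p1) (b0 p2)).
apply: (@le_trans _ _ (\sum_(p1 <- box_degrees k N) \sum_(p2 <- box_degrees k N) a p1 * b p2)).
  rewrite exchange_big; apply: ler_sum => p1 _ /=.
  rewrite exchange_big; apply: ler_sum => p2 _ /=.
  by rewrite big_pick ?uniq_box_degrees//; case: ifP => // _; exact: (mulr_ge0 (a0 p1) (b0 p2)).
under eq_bigr do rewrite -mulr_sumr.
have aB : \sum_(p <- box_degrees k N) a p <= B1 by rewrite degsE; exact: phiB.
have bB : \sum_(p <- box_degrees k N) b p <= B2 by rewrite degsE; exact: psiB.
have sa0 : 0 <= \sum_(p <- box_degrees k N) a p by apply: sumr_ge0 => p _; exact: a0.
have sb0 : 0 <= \sum_(p <- box_degrees k N) b p by apply: sumr_ge0 => p _; exact: b0.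
by rewrite -mulr_suml; exact: (ler_pM sa0 sb0 aB bB).
Qed.
End ScalarCoefficients.

(** The homogeneous parts are bounded at [tau X], because their unordered sum
    converges there; those at [X] are smaller by the factor [tau^(-|p|)]. *)
Lemma Hol_abs_summable (phi : fps R[i] n) (H T : hilbertType R)
    (t : {bilinear scalarH R -> H -> T}) (X : optuple n H) :
  is_tensor t -> Hol rho q phi -> scaled_polydomain rho q X ->
  exists B : R, forall J : {fset {ffun 'I_k -> nat}},
    \sum_(p <- J) opnorm (homog_part t (scalar_coefs phi) X p) <= B.
Proof.
move=> ht hphi Xq; have [tau tau1 [Y Yq ->]] := scaled_polydomain_open Xq.
have tau0 : 0 < tau by lra.
have Yr := imageP (fun Y : optuple n H => fun i j => (rho i)%:C *: Y i j) Yq.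
have [M M0 hM] := cvg_partial_sum_bounded (hphi H T t ht _ Yr).
pose theta := tau^-1.
have th : 0 <= theta < 1 by rewrite invr_ge0 ltW//= invf_lt1.
have hX (p : {ffun 'I_k -> nat}) :
    opnorm (homog_part t (scalar_coefs phi) (fun i j => (rho i / tau)%:C *: Y i j) p) <=
    M * \prod_(i < k) theta ^+ p i.
  have -> : (fun i j => (rho i / tau)%:C *: Y i j) =
      (fun i j => theta%:C *: ((rho i)%:C *: Y i j)) :> optuple n H.
    apply: functional_extensionality_dep => i; apply/funext => j.
    by rewrite scalerA -rmorphM mulrC.
  have c0 : 0 <= \prod_(i < k) theta ^+ p i.
    by apply: prodr_ge0 => i _; rewrite exprn_ge0//; case/andP: th.
  rewrite (homog_part_scale _ (fun i j =>
    (rho i)%:C *: Y i j) (fun=> theta) p ht) -rnorm_bop rnormZr rnorm_bop ger0_norm//.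
  by rewrite mulrC; apply: ler_wpM2r => //; exact: hM.
by eexists; apply: (abs_summable_geometric M0 hX) => J; exact: sum_geometric_degrees.
Qed.

Lemma Hol1 : Hol rho q 1.
Proof.
move=> H T t ht X Xq; pose p0 : {ffun 'I_k -> nat} := [ffun i => 0%N].
pose f p := homog_part t (scalar_coefs 1) X p.
have f0 p : p != p0 -> f p = 0.
  move=> pp0; rewrite /f scalar_homog_partE// big_seq big1// => w.
  rewrite mem_degree_words_mdegree => /eqP wp.
  have -> : (1 : fps R[i] n) w = (w == mnil n)%:R by [].
  case: eqP => [w0|_]; last by rewrite scale0r.
  by case/eqP: pp0; rewrite -wp w0; apply/ffunP => i; rewrite !ffunE.
suff : cvg (partial_sum f @ totally) by [].
apply: (abs_summable_cvg (B := opnorm (f p0))) => J.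
rewrite (eq_bigr (fun p => if p0 == p then opnorm (f p) else 0)).
  by rewrite big_pick ?fset_uniq//; case: ifP => // _; exact: opnorm_ge0.
move=> p _; rewrite eq_sym; case: eqP => // /eqP/f0 ->.
by rewrite -rnorm_bop rnorm0.
Qed.

Lemma Hol_linear (a : R[i]) phi psi : Hol rho q phi -> Hol rho q psi ->
  Hol rho q (a *: phi + psi).
Proof.
move=> hphi hpsi H T t ht X Xq.
have termE : (fun p => homog_part t (scalar_coefs (a *: phi + psi)) X p) =
    fun p => a *: homog_part t (scalar_coefs phi) X p + homog_part t (scalar_coefs psi) X p.
  apply/funext => p; rewrite !scalar_homog_partE// scaler_sumr -big_split.
  by apply: eq_bigr => w _ /=; rewrite scalerA -scalerDl.
suff : cvg (partial_sum (fun p =>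
  homog_part t (scalar_coefs (a *: phi + psi)) X p) @ totally) by [].
rewrite termE; apply: cvg_partial_sum_linear; first exact: hphi.
exact: hpsi.
Qed.

Lemma Hol_mul phi psi : Hol rho q phi -> Hol rho q psi -> Hol rho q (phi * psi).
Proof.
move=> hphi hpsi H T t ht X Xq.
have [B1 h1] := Hol_abs_summable ht hphi Xq.
have [B2 h2] := Hol_abs_summable ht hpsi Xq.
have cX : cross_commuting X.
  by case: Xq => Y [[cY _] _] <-; exact: cross_commuting_scale.
exact: abs_summable_cvg (abs_summable_mul ht cX h1 h2).
Qed.
End HolomorphicFunctions.

Theorem corollary2p13 (R : realType) (k : nat) (n : 'I_k -> nat)
    (q : forall i, {fsfun seq 'I_(n i) -> R with 0}) (rho : 'I_k -> R) :
  (0 < k)%N -> (forall i, 0 < n i)%N ->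
  (forall i, positive_regular (q i)) -> (forall i, 0 < rho i) ->
  (forall (F : fock_model R n) (K : hilbertType R) (A : mword n -> bop K)
      (T : hilbertType R) (t : {bilinear K -> fspace F -> T}), is_tensor t ->
    free_holomorphic rho q A <->
    forall s : 'I_k -> R, (forall i, 0 <= s i < rho i) ->
      cvgn (series (fun m : nat =>
        \sum_(w \in [set w : mword n | (\sum_(i < k) size (w i))%N = m])
          tensor_op t (A w)
            ((\prod_(i < k) s i ^+ size (w i))%:C *:
               mwordop (universal_model q F) w)))) /\
  GRing.subalg_closed (mem (Hol rho q)).
Proof.
move=> _ _ qP rho0; split=> [F K A T t ht|].
  split=> [hA s s0|]; first exact: model_series_of_holomorphic.
  exact: holomorphic_of_model_series.
have HolP (phi : fps R[i] n) : phi \in mem (Hol rho q) <-> Hol rho q phi.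
  by split=> [/set_mem|/mem_set].
split.
- by apply/HolP; exact: Hol1.
- move=> a phi psi /HolP hphi /HolP hpsi; apply/HolP; exact: Hol_linear.
- move=> phi psi /HolP hphi /HolP hpsi; apply/HolP.
  exact: (Hol_mul qP hphi hpsi).
Qed.
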